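(* The following hold. (1) For $n<\omega$, if $\kappa$ is $\Pi^1_n$-indescribable then the $\Pi^1_n$-indescribable ideal on $\kappa$ is nowhere $\kappa$-saturated. (2) If $\kappa$ is almost ineffable then the almost ineffable ideal on $\kappa$ is nowhere $\kappa$-saturated, and if $\kappa$ is ineffable then the ineffable ideal on $\kappa$ is nowhere $\kappa$-saturated. (3) If $\kappa$ is Ramsey then the Ramsey ideal on $\kappa$ is nowhere $\kappa$-saturated. (4) If $\kappa$ is weakly compact and subtle then the subtle ideal on $\kappa$ is nowhere $\kappa$-saturated.
   Context: For an ideal $I$ on $\kappa$, $I^+=\{X\subseteq\kappa\mid X\notin I\}$, and for $S\in I^+$, $I\upharpoonright S=\{X\subseteq\kappa\mid X\cap S\in I\}$. $I$ is $\kappa$-saturated if $P(\kappa)/I$ has the $\kappa$-chain condition, and nowhere $\kappa$-saturated if $I\upharpoonright S$ is not $\kappa$-saturated for every $S\in I^+$. A set $S\subseteq\kappa$ is $\Pi^1_n$-indescribable if for every $A\subseteq V_\kappa$ and every $\Pi^1_n$-sentence $\varphi$ with $(V_\kappa,\in,A)\models\varphi$ there is $\alpha\in S$ with $(V_\alpha,\in,A\cap V_\alpha)\models\varphi$. An $S$-list is a sequence $\vec S=\langle S_\alpha\mid\alpha\in S\rangle$ with $S_\alpha\subseteq\alpha$; $H\subseteq S$ is homogeneous for $\vec S$ if $S_\alpha=S_\beta\cap\alpha$ for all $\alpha<\beta$ in $H$. $S\subseteq\kappa$ is subtle if for every $S$-list and every club $C\subseteq\kappa$ there are $\alpha<\beta$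 in $S\cap C$ with $S_\alpha=S_\beta\cap\alpha$; almost ineffable if every $S$-list has a homogeneous set $H\subseteq S$ of size $\kappa$; ineffable if every $S$-list has a homogeneous set $H\subseteq S$ stationary in $\kappa$. $S\subseteq\kappa$ is Ramsey if every regressive $f:[S]^{<\omega}\to\kappa$ (i.e. $f(a)<\min a$ for all nonempty $a$ with $\min a>0$) has a set $H\subseteq S$ of size $\kappa$ such that $f\upharpoonright[H]^m$ is constant for all $m<\omega$. For each of these properties, $\kappa$ has the property if the set $\kappa\subseteq\kappa$ does, and the corresponding ideal on $\kappa$ is the collection of all $X\subseteq\kappa$ which do not have the property. *)

(* Defs.v *)
From mathcomp Require Import all_boot boolp.

Set Implicit Arguments.
Unset Strict Implicit.
Unset Printing Implicit Defensive.

(* The universe of sets [V]: well-founded trees of small types (Aczel),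
   quotiented by extensional equality, so that [=] on [V] is equality of sets.
   An element of [V] is an equivalence class of trees.  With the classical
   axioms of [boolp], [V] satisfies ZFC, with separation and replacement for
   arbitrary predicates and functions on [V]. *)

Inductive tree : Type := Tree (I : Type) (f : I -> tree).

Fixpoint teq (x y : tree) : Prop :=
  match x, y with
  | Tree T f, Tree J g =>
      (forall i, exists j, teq (f i) (g j)) /\
      (forall j, exists i, teq (f i) (g j))
  end.

Lemma teq_refl x : teq x x.
Proof. by elim: x => T f IH /=; split=> i; exists i. Qed.

Lemma teq_sym x y : teq x y -> teq y x.
Proof.
elim: x y => T f IH [J g] /= [h1 h2]; split=> i.
- by have [j /IH] := h2 i; exists j.
- by have [j /IH] := h1 i; exists j.
Qed.

Lemma teq_trans x y z : teq x y -> teq y z -> teq x z.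
Proof.
elim: x y z => T f IH [J g] [K h] /= [a1 a2] [b1 b2]; split=> i.
- have [j hj] := a1 i; have [k hk] := b1 j.
  by exists k; apply: IH hj hk.
- have [j hj] := b2 i; have [k hk] := a2 j.
  by exists k; apply: IH hk hj.
Qed.

Definition V : Type := {C : tree -> Prop | exists x, C = teq x}.

Definition cls (x : tree) : V := exist _ (teq x) (ex_intro _ x erefl).
Definition repr (X : V) : tree := sval (cid (svalP X)).

Lemma V_eq (X Y : V) : sval X = sval Y -> X = Y.
Proof. by case: X Y => [C hC] [D hD] /= e; subst D; rewrite (Prop_irrelevance hC hD). Qed.

Lemma cls_eq x y : teq x y <-> cls x = cls y.
Proof.
split=> [xy|/(congr1 sval) /= ->]; last exact: teq_refl.
apply: V_eq; apply/predeqP => z; split; last exact: teq_trans.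
exact/teq_trans/teq_sym.
Qed.

Lemma reprK X : cls (repr X) = X.
Proof. by apply: V_eq; rewrite /= /repr; case: cid => x /= <-. Qed.

(* [El X] indexes, possibly with repetitions, the elements of [X]. *)
Definition El (X : V) : Type := let: Tree T _ := repr X in T.
Definition elt (X : V) : El X -> V :=
  match repr X as t return (let: Tree T _ := t in T) -> V with
  | Tree _ f => fun i => cls (f i)
  end.

Definition mem (x X : V) : Prop := exists i : El X, x = elt i.

(* The set {f i | i : I}. *)
Definition mkset (I : Type) (f : I -> V) : V := cls (Tree (fun i => repr (f i))).

Declare Scope zf_scope.
Delimit Scope zf_scope with zf.
Local Open Scope zf_scope.

Notation "x ∈ X" := (mem x X) (at level 70, no associativity) : zf_scope.
Notation "x ∉ X" := (~ mem x X) (at level 70, no associativity) : zf_scope.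

Definition sub (X Y : V) : Prop := forall x, x ∈ X -> x ∈ Y.
Notation "X ⊆ Y" := (sub X Y) (at level 70, no associativity) : zf_scope.

Lemma mem_cls x (I : Type) (f : I -> tree) :
  x ∈ cls (Tree f) <-> exists i, x = cls (f i).
Proof.
have : teq (repr (cls (Tree f))) (Tree f) by apply/cls_eq; rewrite reprK.
rewrite /mem /elt /El; case: repr => J g /= [h1 h2].
split=> -[i ->].
- by have [j /cls_eq] := h1 i; exists j.
- by have [j /cls_eq] := h2 i; exists j.
Qed.

Lemma mem_mkset x (I : Type) (f : I -> V) :
  x ∈ mkset f <-> exists i, x = f i.
Proof. by rewrite mem_cls; split=> -[i ->]; exists i; rewrite reprK. Qed.

Lemma V_ext (X Y : V) : (forall x, x ∈ X <-> x ∈ Y) -> X = Y.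
Proof.
rewrite -(reprK X) -(reprK Y); case: (repr X) (repr Y) => T f [J g] h.
apply/cls_eq; split=> i.
- have /h/mem_cls[j e] : cls (f i) ∈ cls (Tree f) by apply/mem_cls; exists i.
  by exists j; apply/cls_eq.
- have /h/mem_cls[j e] : cls (g i) ∈ cls (Tree g) by apply/mem_cls; exists i.
  by exists j; apply/cls_eq.
Qed.

Lemma V_ind (P : V -> Prop) :
  (forall X, (forall x, x ∈ X -> P x) -> P X) -> forall X, P X.
Proof.
move=> h X; rewrite -(reprK X); elim: (repr X) => T f IH.
by apply: h => x /mem_cls[i ->]; apply: IH.
Qed.

Definition empty : V := mkset (fun e : False => match e with end).
Notation "∅" := empty : zf_scope.

Definition sep (X : V) (P : V -> Prop) : V :=
  mkset (fun i : {i : El X | P (elt i)} => elt (sval i)).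

Definition inter (X Y : V) : V := sep X (fun x => x ∈ Y).
Notation "X ∩ Y" := (inter X Y) (at level 40, left associativity) : zf_scope.

Definition pow (X : V) : V :=
  mkset (fun Q : El X -> Prop => mkset (fun i : {i : El X | Q i} => elt (sval i))).

Definition bigcup (I : Type) (F : I -> V) : V :=
  mkset (fun p : {i : I & El (F i)} => elt (projT2 p)).

Definition succ (X : V) : V :=
  mkset (fun o : option (El X) => if o is Some i then elt i else X).

Definition num (n : nat) : V := iter n succ ∅.
Definition omega : V := mkset num.

(* V_α = ⋃_{β ∈ α} P(V_β), by recursion on the tree representing α. *)
Fixpoint tlevel (x : tree) : V :=
  let: Tree T f := x in bigcup (fun i => pow (tlevel (f i))).
Definition Vlevel (a : V) : V := tlevel (repr a).

Lemma mem_empty x : x ∉ ∅.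
Proof. by case/mem_mkset. Qed.

Lemma mem_sep x X P : x ∈ sep X P <-> x ∈ X /\ P x.
Proof.
rewrite mem_mkset; split=> [[[i Pi] ->]|[[i ->] Pi]]; last by exists (exist _ i Pi).
by split=> //=; exists i.
Qed.

Lemma mem_inter x X Y : x ∈ X ∩ Y <-> x ∈ X /\ x ∈ Y.
Proof. exact: mem_sep. Qed.

Lemma mem_pow X Y : Y ∈ pow X <-> Y ⊆ X.
Proof.
rewrite mem_mkset; split=> [[Q ->] x /mem_mkset[i ->]|YX]; first by exists (sval i).
exists (fun i => elt i ∈ Y); apply: V_ext => x; rewrite mem_mkset.
split=> [xY|[[i hi] ->] //].
by have [i e] := YX _ xY; rewrite e in xY *; exists (exist _ i xY).
Qed.

Lemma mem_bigcup x (I : Type) (F : I -> V) :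
  x ∈ bigcup F <-> exists i, x ∈ F i.
Proof.
rewrite mem_mkset; split=> [[[i j] ->]|[i [j ->]]]; first by exists i, j.
by exists (existT _ i j).
Qed.

Lemma mem_succ x X : x ∈ succ X <-> x ∈ X \/ x = X.
Proof.
rewrite mem_mkset; split=> [[[i|] ->]|[[i ->]|->]].
- by left; exists i.
- by right.
- by exists (Some i).
- by exists None.
Qed.

Lemma mem_omega x : x ∈ omega <-> exists n, x = num n.
Proof. exact: mem_mkset. Qed.

Lemma tlevel_teq x y : teq x y -> tlevel x = tlevel y.
Proof.
elim: x y => T f IH [J g] /= [h1 h2]; apply: V_ext => x; rewrite !mem_bigcup.
split=> -[i xi].
- by have [j /IH e] := h1 i; exists j; rewrite -e.
- by have [j /IH e] := h2 i; exists j; rewrite e.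
Qed.

Lemma mem_Vlevel x a : x ∈ Vlevel a <-> exists2 b, b ∈ a & x ⊆ Vlevel b.
Proof.
have E t : Vlevel (cls t) = tlevel t.
  by apply/tlevel_teq/cls_eq; rewrite reprK.
rewrite -{1 2}(reprK a) E; case: (repr a) => T f /=; rewrite mem_bigcup.
split=> [[i /mem_pow xi]|[b /mem_cls[i ->]]]; last first.
  by rewrite E => xi; exists i; apply/mem_pow.
by exists (cls (f i)); [apply/mem_cls; exists i | rewrite E].
Qed.

(* Ordinals are von Neumann ordinals ([∈] is well-founded on [V]), so that
   [a ∈ b] also plays the role of [a < b]. *)

Definition transitive (X : V) : Prop := forall x, x ∈ X -> x ⊆ X.
Definition ordinal (a : V) : Prop :=
  transitive a /\ forall b, b ∈ a -> transitive b.

(* Functions with domain a set are represented by functions on [V], whose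
   values outside the domain are irrelevant. *)
Definition equipotent (X Y : V) : Prop := exists f : V -> V,
  [/\ forall x, x ∈ X -> f x ∈ Y,
      forall x x', x ∈ X -> x' ∈ X -> f x = f x' -> x = x'
    & forall y, y ∈ Y -> exists2 x, x ∈ X & y = f x].

Definition cardinal (k : V) : Prop :=
  ordinal k /\ forall a, a ∈ k -> ~ equipotent a k.
Definition infinite_cardinal (k : V) : Prop := cardinal k /\ omega ⊆ k.
Definition uncountable_cardinal (k : V) : Prop := cardinal k /\ omega ∈ k.

Definition card_lt (X k : V) : Prop := exists2 a, a ∈ k & equipotent X a.

(* [X]^m *)
Definition nsubsets (m : nat) (X : V) : V :=
  sep (pow X) (fun a => equipotent a (num m)).
(* [X]^{<ω} *)
Definition finsubsets (X : V) : V :=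
  sep (pow X) (fun a => exists m, equipotent a (num m)).

Definition unbounded (k C : V) : Prop :=
  forall x, x ∈ k -> exists2 c, c ∈ C & x ∈ c.
(* [unbounded d (C ∩ d)] with [d] nonempty forces [d] to be a limit ordinal. *)
Definition club (k C : V) : Prop :=
  [/\ C ⊆ k, unbounded k C &
      forall d, d ∈ k -> d <> ∅ -> unbounded d (C ∩ d) -> d ∈ C].
Definition stationary (k S : V) : Prop :=
  S ⊆ k /\ forall C, club k C -> exists x, x ∈ S ∩ C.

(* The quotient P(k)/I, whose elements are the classes
   [X] = {Y ⊆ k | X Δ Y ∈ I}. *)

Definition symdiff (k X Y : V) : V :=
  sep k (fun x => (x ∈ X /\ x ∉ Y) \/ (x ∈ Y /\ x ∉ X)).
Definition qclass (k I X : V) : V := sep (pow k) (fun Y => symdiff k X Y ∈ I).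
Definition quotient (k I : V) : V :=
  sep (pow (pow k)) (fun c => exists2 X, X ⊆ k & c = qclass k I X).

(* The meet of [X] and [Y] in P(k)/I is [X ∩ Y], and the least element is [∅]. *)
Definition antichain (k I A : V) : Prop :=
  [/\ A ⊆ quotient k I, qclass k I ∅ ∉ A &
      forall X Y, X ⊆ k -> Y ⊆ k ->
        qclass k I X ∈ A -> qclass k I Y ∈ A -> qclass k I X <> qclass k I Y ->
        qclass k I (X ∩ Y) = qclass k I ∅].

Definition saturated (k I : V) : Prop :=
  forall A, antichain k I A -> card_lt A k.

Definition positive (k I S : V) : Prop := S ⊆ k /\ S ∉ I.
Definition restrict (k I S : V) : V := sep (pow k) (fun X => X ∩ S ∈ I).

Definition nowhere_saturated (k I : V) : Prop :=
  forall S, positive k I S -> ~ saturated k (restrict k I S).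

(* Second-order formulas in the language {∈, A}.  First- and second-order
   variables are named by natural numbers, in two separate name spaces.
   Negation, conjunction, disjunction and the first-order existential
   quantifier are expressed through [FBot], [FImp] and [FAll]. *)

Inductive formula : Type :=
| FMem (i j : nat)              (* v_i ∈ v_j *)
| FEq (i j : nat)               (* v_i = v_j *)
| FPred (i : nat)               (* A(v_i) *)
| FVar (X i : nat)              (* X(v_i) *)
| FBot
| FImp (p q : formula)
| FAll (i : nat) (p : formula)  (* ∀ v_i *)
| FAll2 (X : nat) (p : formula) (* ∀ X *)
| FEx2 (X : nat) (p : formula). (* ∃ X *)

Definition update (r : nat -> V) (i : nat) (x : V) : nat -> V :=
  fun j => if j == i then x else r j.

(* Satisfaction in (M, ∈, A), with assignments [r] of elements of [M] to the
   first-order variables and [R] of subsets of [M] to the second-order ones. *)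
Fixpoint sat (M A : V) (R r : nat -> V) (p : formula) : Prop :=
  match p with
  | FMem i j => r i ∈ r j
  | FEq i j => r i = r j
  | FPred i => r i ∈ A
  | FVar X i => r i ∈ R X
  | FBot => False
  | FImp p q => sat M A R r p -> sat M A R r q
  | FAll i p => forall x, x ∈ M -> sat M A R (update r i x) p
  | FAll2 X p => forall Y, Y ⊆ M -> sat M A (update R X Y) r p
  | FEx2 X p => exists2 Y, Y ⊆ M & sat M A (update R X Y) r p
  end.

(* All free variables are in [s] (second-order) or [t] (first-order). *)
Fixpoint free_in (s t : seq nat) (p : formula) : bool :=
  match p with
  | FMem i j | FEq i j => (i \in t) && (j \in t)
  | FPred i => i \in t
  | FVar X i => (X \in s) && (i \in t)
  | FBot => true
  | FImp p q => free_in s t p && free_in s t q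
  | FAll i p => free_in s (i :: t) p
  | FAll2 X p | FEx2 X p => free_in (X :: s) t p
  end.

Definition sentence (p : formula) : bool := free_in [::] [::] p.

Fixpoint first_order (p : formula) : bool :=
  match p with
  | FMem _ _ | FEq _ _ | FPred _ | FVar _ _ | FBot => true
  | FImp p q => first_order p && first_order q
  | FAll _ p => first_order p
  | FAll2 _ _ | FEx2 _ _ => false
  end.

(* Prenex formulas with n alternating blocks of second-order quantifiers in
   front of a first-order matrix; blocks may be empty, so that the classes are
   cumulative. *)
Inductive Pi1 : nat -> formula -> Prop :=
| Pi1_first_order p : first_order p -> Pi1 0 p
| Pi1_Sigma1 n p : Sigma1 n p -> Pi1 n.+1 p
| Pi1_all n X p : Pi1 n.+1 p -> Pi1 n.+1 (FAll2 X p)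
with Sigma1 : nat -> formula -> Prop :=
| Sigma1_first_order p : first_order p -> Sigma1 0 p
| Sigma1_Pi1 n p : Pi1 n p -> Sigma1 n.+1 p
| Sigma1_ex n X p : Sigma1 n.+1 p -> Sigma1 n.+1 (FEx2 X p).

(* For a sentence the choice of the assignments is irrelevant. *)
Definition models (M A : V) (p : formula) : Prop :=
  sat M A (fun=> ∅) (fun=> ∅) p.

Definition indescribable (n : nat) (k S : V) : Prop :=
  S ⊆ k /\
  forall A p, A ⊆ Vlevel k -> Pi1 n p -> sentence p -> models (Vlevel k) A p ->
    exists2 a, a ∈ S & models (Vlevel a) (A ∩ Vlevel a) p.

Definition is_list (S : V) (L : V -> V) : Prop := forall a, a ∈ S -> L a ⊆ a.
Definition homogeneous (L : V -> V) (H : V) : Prop :=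
  forall a b, a ∈ H -> b ∈ H -> a ∈ b -> L a = L b ∩ a.

Definition subtle (k S : V) : Prop :=
  S ⊆ k /\
  forall L C, is_list S L -> club k C ->
    exists a b, [/\ a ∈ S ∩ C, b ∈ S ∩ C, a ∈ b & L a = L b ∩ a].

Definition almost_ineffable (k S : V) : Prop :=
  S ⊆ k /\
  forall L, is_list S L ->
    exists H, [/\ H ⊆ S, homogeneous L H & equipotent H k].

Definition ineffable (k S : V) : Prop :=
  S ⊆ k /\
  forall L, is_list S L ->
    exists H, [/\ H ⊆ S, homogeneous L H & stationary k H].

Definition is_min (x a : V) : Prop :=
  x ∈ a /\ forall y, y ∈ a -> x = y \/ x ∈ y.

(* [f : [S]^{<ω} -> k] regressive; [m <> ∅] says that the minimum is > 0. *)
Definition regressive (k S : V) (f : V -> V) : Prop :=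
  (forall a, a ∈ finsubsets S -> f a ∈ k) /\
  (forall a m, a ∈ finsubsets S -> is_min m a -> m <> ∅ -> f a ∈ m).

Definition ramsey (k S : V) : Prop :=
  S ⊆ k /\
  forall f, regressive k S f ->
    exists H, [/\ H ⊆ S, equipotent H k &
      forall m a b, a ∈ nsubsets m H -> b ∈ nsubsets m H -> f a = f b].

(* κ is uncountable and κ → (κ)^2_2. *)
Definition weakly_compact (k : V) : Prop :=
  uncountable_cardinal k /\
  forall f : V -> bool,
    exists H, [/\ H ⊆ k, equipotent H k &
      forall a b, a ∈ nsubsets 2 H -> b ∈ nsubsets 2 H -> f a = f b].

(* {X ⊆ k | X does not have the property P} *)
Definition ideal_of (k : V) (P : V -> V -> Prop) : V :=
  sep (pow k) (fun X => ~ P k X).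

(* Main.v *)
(* Let I be one of the ideals on k and S a positive set such that the quotient by
   the restriction of I to S is k-saturated.  As I is normal, sets [W a], for a
   in S, generate modulo a null set a tree of initial segments w, each shared by
   the [W a] for positively many a.  The property defining I (weak compactness,
   for the subtle ideal) gives a cofinal branch b of this tree.  The sets of a
   such that [W a] first leaves b at d are disjoint, so by saturation those which
   are positive have bounded d; hence [W a] is an initial segment of b for
   positively many a.

   The set of a in S such that S ∩ a does not have the property at a is positive,
   by induction on k.  Let [W a] be a witness for this.  On a positive set these
   witnesses cohere, and their limit b contradicts the positivity of S.

   For Π^1_0 there is no such branch; but positive sets are then the stationary
   subsets of an inaccessible k, and Solovay's argument applies: the [W a] are
   clubs in a disjoint from S, and saturation only has to bound their next
   elements.  For Π^1_n with n >= 1, normality needs a universal Π^1_n sentence: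
   a first-order formula holds iff it holds at the levels in a club, so that it
   can be replaced by a quantifier over clubs and by the class of the levels,
   with the traces of the variables, at which it holds. *)

From mathcomp Require Import all_boot boolp.
Require Import Defs.

Set Implicit Arguments.
Unset Strict Implicit.
Unset Printing Implicit Defensive.
Local Open Scope zf_scope.

(** * Ordinals *)

(** For the combinatorial ideals, the positivity of the set of [a] at which [S ∩ a] fails is proved
    by an induction through all smaller ordinals, also singular ones, successors and those of
    countable cofinality. So size [k] is replaced by unboundedness and stationarity by [stat],
    notions that behave well at every ordinal; only at the cardinal [k] itself are they matched with
    the given definitions. Every ideal enters through two abstractions: [nfam], normality of its
    positive sets, and [thin], the trace of saturation. Lists, clubs and colourings become sets of
    ordinals through a pairing function and codes of finite sets; for indescribability the tree is
    layered by the levels [Vlevel xi] instead. Replacing first-order truth by a quantifier over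
    clubs is justified at inaccessible levels, where Skolem witnesses can be bounded.
    Inaccessibility is therefore written into the universal sentence, so that it is reflected
    together with the rest. *)

Definition eps (P : V -> Prop) : V :=
  if pselect (exists x, P x) is left h then sval (cid h) else ∅.

Lemma epsP P : (exists x, P x) -> P (eps P).
Proof. by rewrite /eps; case: pselect => // h _; case: cid. Qed.

Lemma mem_irr x : x ∉ x.
Proof. by elim/V_ind: x => X IH XX; apply: (IH X XX). Qed.

Lemma mem_asym x y : x ∈ y -> y ∉ x.
Proof.
elim/V_ind: x y => x IH y xy yx.
exact: (IH y yx x yx xy).
Qed.

Lemma sub_anti x y : x ⊆ y -> y ⊆ x -> x = y.
Proof. by move=> a b; apply: V_ext => z; split; [exact: a | exact: b]. Qed.

Lemma ord_mem a b : ordinal a -> b ∈ a -> ordinal b.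
Proof.
move=> [ta ha] ba; split; first exact: ha.
by move=> c cb; apply: ha; apply: ta cb.
Qed.

Lemma ord_trans a b c : ordinal c -> a ∈ b -> b ∈ c -> a ∈ c.
Proof. by move=> [tc _] ab bc; apply: tc ab. Qed.

Lemma ord_tri a b : ordinal a -> ordinal b -> [\/ a ∈ b, a = b | b ∈ a].
Proof.
elim/V_ind: a b => a IHa b; elim/V_ind: b => b IHb oa ob.
have [ab|/existsNP[x /not_implyP[xa xb]]] := pselect (a ⊆ b).
  have [ba|/existsNP[x /not_implyP[xb xa]]] := pselect (b ⊆ a).
    by constructor 2; apply: sub_anti.
  have [ax|ax|xa'] // := IHb x xb oa (ord_mem ob xb).
    by constructor 1; apply: ord_trans ax xb.
  by constructor 1; rewrite ax.
have [bx|bx|xb'] // := IHa x xa b (ord_mem oa xa) ob.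
  by constructor 3; rewrite -bx.
by constructor 3; apply: ord_trans xb' xa.
Qed.

Lemma ord_least (P : V -> Prop) a : ordinal a -> P a ->
  exists b, [/\ ordinal b, P b & forall c, c ∈ b -> ~ P c].
Proof.
elim/V_ind: a => a IH oa Pa.
have [h|/existsNP[c /not_implyP[ca /contrapT Pc]]] := pselect (forall c, c ∈ a -> ~ P c).
  by exists a.
exact: (IH c ca (ord_mem oa ca) Pc).
Qed.

(* [~ b ∈ a] means [a <= b] for ordinals. *)
Lemma ord_le a b : ordinal a -> ordinal b -> b ∉ a -> a ∈ succ b.
Proof.
by move=> oa ob nab; apply/mem_succ; case: (ord_tri oa ob) => h //; [left|right].
Qed.

Lemma ord_le_sub a b : ordinal b -> a ∈ succ b -> a ⊆ b.
Proof. by move=> [tb _] /mem_succ[/tb|->]. Qed.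

Lemma ord_nmem_sub a b : ordinal a -> ordinal b -> b ∉ a -> a ⊆ b.
Proof. by move=> oa ob h; apply: ord_le_sub ob (ord_le oa ob h). Qed.

Lemma ord_succ a : ordinal a -> ordinal (succ a).
Proof.
move=> oa; have [ta ha] := oa; split.
  move=> x /mem_succ[xa|->] y yx; apply/mem_succ; left => //.
  exact: ta yx.
by move=> b /mem_succ[/ha|->].
Qed.

Lemma ord_0 : ordinal ∅.
Proof. by split=> x /mem_empty. Qed.

Lemma neq0P X : X <> ∅ -> exists x, x ∈ X.
Proof.
move=> X0; apply: contrapT => h; apply: X0; apply: V_ext => x; split.
  by move=> xX; case: h; exists x.
by move/mem_empty.
Qed.

Lemma mem_neq0 x X : x ∈ X -> X <> ∅.
Proof. by move=> xX e; rewrite e in xX; apply: mem_empty xX. Qed.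

Lemma ord_0_mem a x : ordinal a -> x ∈ a -> ∅ ∈ a.
Proof.
by move=> oa xa; case: (ord_tri ord_0 oa) => [//|h|/mem_empty //]; rewrite -h in xa; case: (mem_empty xa).
Qed.

Definition img (X : V) (f : V -> V) : V := mkset (fun i : El X => f (elt i)).

Lemma mem_img X f y : y ∈ img X f <-> exists2 x, x ∈ X & y = f x.
Proof.
rewrite mem_mkset; split=> [[i ->]|[x [i ->] ->]]; last by exists i.
by exists (elt i) => //; exists i.
Qed.

Definition cup (X : V) (F : V -> V) : V := bigcup (fun i : El X => F (elt i)).

Lemma mem_cup X F y : y ∈ cup X F <-> exists2 x, x ∈ X & y ∈ F x.
Proof.
rewrite mem_bigcup; split=> [[i h]|[x [i ->] h]]; last by exists i.
by exists (elt i) => //; exists i.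
Qed.

Lemma ord_cup X F : (forall x, x ∈ X -> ordinal (F x)) -> ordinal (cup X F).
Proof.
move=> h; split.
  move=> y /mem_cup[x xX yF] z zy; apply/mem_cup; exists x => //.
  exact: (ord_trans (h x xX)) zy yF.
by move=> y /mem_cup[x xX /(ord_mem (h x xX))] [].
Qed.

Definition un (X Y : V) : V := bigcup (fun b : bool => if b then X else Y).

Lemma mem_un x X Y : x ∈ un X Y <-> x ∈ X \/ x ∈ Y.
Proof.
rewrite mem_bigcup; split=> [[[] h]|[h|h]]; [by left|by right|by exists true|by exists false].
Qed.

Definition one (x : V) : V := mkset (fun _ : unit => x).

Lemma mem_one x y : y ∈ one x <-> y = x.
Proof. by rewrite mem_mkset; split=> [[]|->]; last exists tt. Qed.

Definition two (x y : V) : V := un (one x) (one y).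

Lemma mem_two z x y : z ∈ two x y <-> z = x \/ z = y.
Proof. by rewrite mem_un !mem_one. Qed.

Lemma ord_max a b : ordinal a -> ordinal b -> ordinal (un a b).
Proof.
move=> oa ob; split.
  by move=> x /mem_un[] xa y yx; apply/mem_un; [left; apply: ord_trans yx xa|right; apply: ord_trans yx xa].
by move=> x /mem_un[/(ord_mem oa)|/(ord_mem ob)] [].
Qed.

Lemma ord_max_or a b : ordinal a -> ordinal b -> un a b = a \/ un a b = b.
Proof.
move=> oa ob; have [ab|ab] := pselect (b ∈ a).
  by left; apply: sub_anti => x; [case/mem_un => // xb; apply: ord_trans xb ab | move=> xa; apply/mem_un; left].
right; apply: sub_anti => x; first by case/mem_un => // /(ord_nmem_sub oa ob ab).
by move=> xb; apply/mem_un; right.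
Qed.

Lemma mem_wf : well_founded mem.
Proof. by elim/V_ind => X IH; constructor. Qed.

(** [Fix] supplies values only at members of [x]; extending them by [∅] lets [F] take a total
    function, and the side condition of [VrecE] says that the extension is never looked at. *)
Definition Vrec (F : V -> (V -> V) -> V) : V -> V :=
  Fix mem_wf (fun _ => V)
    (fun x rec => F x (fun y => if pselect (y ∈ x) is left h then rec y h else ∅)).

Lemma VrecE (F : V -> (V -> V) -> V) x :
  (forall g h, (forall y, y ∈ x -> g y = h y) -> F x g = F x h) ->
  Vrec F x = F x (Vrec F).
Proof.
move=> loc; rewrite {1}/Vrec Fix_eq /=.
  by apply: loc => y yx; case: pselect.
move=> z f g fg; congr (F z _); apply: funext => y; case: pselect => // h; exact: fg.
Qed.

Lemma cup_ext X F G : (forall x, x ∈ X -> F x = G x) -> cup X F = cup X G.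
Proof.
move=> h; apply: V_ext => y; rewrite !mem_cup.
by split=> -[x xX yF]; exists x => //; move: yF; rewrite h.
Qed.

Lemma ord_num n : ordinal (num n).
Proof. by elim: n => [|n IH]; [exact: ord_0 | exact: ord_succ]. Qed.

Lemma num_lt m n : m < n -> num m ∈ num n.
Proof.
elim: n => // n IH; rewrite ltnS leq_eqVlt => /orP[/eqP->|/IH h]; apply/mem_succ; [by right|by left].
Qed.

Lemma mem_num x n : x ∈ num n <-> exists2 m, m < n & x = num m.
Proof.
split; last by move=> [m mn ->]; exact: num_lt.
elim: n => [/mem_empty //|n IH /mem_succ[/IH[m mn ->]|->]]; last by exists n.
by exists m => //; apply: ltnW.
Qed.

Lemma num_inj m n : num m = num n -> m = n.
Proof.
move=> e; case: (ltngtP m n) => // /num_lt; rewrite e => h; by case: (mem_irr h).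
Qed.

Lemma ord_omega : ordinal omega.
Proof.
split.
  move=> x /mem_omega[n ->] y /mem_num[m _ ->]; apply/mem_omega; by exists m.
by move=> x /mem_omega[n ->]; case: (ord_num n).
Qed.

Definition lim (k : V) : Prop :=
  [/\ ordinal k, ∅ ∈ k & forall x, x ∈ k -> succ x ∈ k].

Lemma lim_ord k : lim k -> ordinal k. Proof. by case. Qed.

Lemma lim_num k n : lim k -> num n ∈ k.
Proof. by case=> _ k0 ks; elim: n => // n IH; apply: ks. Qed.

Lemma lim_omega k : lim k -> omega ⊆ k.
Proof. by move=> kl x /mem_omega[n ->]; exact: lim_num. Qed.

Lemma lim_max k a b : lim k -> a ∈ k -> b ∈ k -> un a b ∈ k.
Proof.
move=> [ok _ _] ak bk.
by case: (ord_max_or (ord_mem ok ak) (ord_mem ok bk)) => ->.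
Qed.

Lemma equip_sym X Y : equipotent X Y -> equipotent Y X.
Proof.
move=> [f [f1 f2 f3]].
have h y : y ∈ Y -> exists x, x ∈ X /\ y = f x by move=> /f3[x]; exists x.
pose g y := eps (fun x => x ∈ X /\ y = f x).
have gP y : y ∈ Y -> g y ∈ X /\ y = f (g y) by move=> /h /epsP.
exists g; split.
- by move=> y /gP[].
- by move=> y y' /gP[_ {2}->] /gP[_ {2}->] ->.
- move=> x xX; have [gX e] := gP _ (f1 _ xX); exists (f x); first exact: f1.
  by apply: f2.
Qed.

Lemma equip_trans X Y Z : equipotent X Y -> equipotent Y Z -> equipotent X Z.
Proof.
move=> [f [f1 f2 f3]] [g [g1 g2 g3]]; exists (g \o f); split => /=.
- by move=> x /f1/g1.
- by move=> x x' xX x'X /g2 e; apply: f2 => //; apply: e; apply: f1.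
- by move=> z /g3[y /f3[x xX ->] ->]; exists x.
Qed.

(** Were [k = succ x], then [x] would contain [omega], and Hilbert's hotel would map [x] onto
    [succ x]: [num 0] goes to the new point [x], [num n.+1] to [num n], and the rest stays. *)
Lemma inf_card_lim k : infinite_cardinal k -> lim k.
Proof.
move=> [[ok ck] wk]; split => //.
  by apply: wk; apply/mem_omega; exists 0.
move=> x xk; have ox := ord_mem ok xk.
case: (ord_tri (ord_succ ox) ok) => // [e|h]; last first.
  have /mem_succ[kx|kx] := h; first by case: (mem_asym xk kx).
  by rewrite kx in xk; case: (mem_irr xk).
have wx n : num n ∈ x.
  have : num n ∈ k by apply: wk; apply/mem_omega; exists n.
  rewrite -e => /mem_succ[//|xn].
  have : num n.+1 ∈ k by apply: wk; apply/mem_omega; exists n.+1.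
  by rewrite -e -xn => /mem_irr.
case: (ck x xk); rewrite -e.
pose f y := if pselect (exists n, y = num n) is left h then
   (if sval (cid h) is m.+1 then num m else x) else y.
have f0 : f (num 0) = x.
  rewrite /f; case: pselect => [h|]; last by case; exists 0.
  by case: cid => m mE; rewrite [sval _]/= -(num_inj mE).
have fS n : f (num n.+1) = num n.
  rewrite /f; case: pselect => [h|]; last by case; exists n.+1.
  by case: cid => m mE; rewrite [sval _]/= -(num_inj mE).
have fo y : ~ (exists n, y = num n) -> f y = y by rewrite /f; case: pselect.
have nx n : x <> num n by move=> xn; have := wx n; rewrite xn => /mem_irr.
exists f; split.
- move=> y yx; apply/mem_succ; have [[[|n] ->]|h] := pselect (exists n, y = num n).
  + by right.
  + by left; rewrite fS.
  + by left; rewrite fo.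
- move=> y y' yx y'x; have [[n yn]|h] := pselect (exists n, y = num n).
    have [[n' yn']|h'] := pselect (exists n, y' = num n).
      rewrite yn yn'; case: n n' {yn yn'} => [|n] [|n'] //; rewrite ?f0 ?fS.
      + by move=> /nx.
      + by move=> /esym/nx.
      + by move=> /num_inj ->.
    rewrite yn (fo _ h'); case: n {yn} => [|n]; rewrite ?f0 ?fS => h2.
      by rewrite -h2 in y'x; case: (mem_irr y'x).
    by case: h'; exists n.
  rewrite (fo _ h); have [[n' yn']|h'] := pselect (exists n, y' = num n).
    rewrite yn'; case: n' {yn'} => [|n]; rewrite ?f0 ?fS => h2.
      by rewrite h2 in yx; case: (mem_irr yx).
    by case: h; exists n.
  by rewrite fo.
- move=> y /mem_succ[yx|->]; last by exists (num 0); rewrite ?f0.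
  have [[n ->]|h] := pselect (exists n, y = num n); last by exists y; rewrite ?fo.
  by exists (num n.+1); rewrite ?fS.
Qed.

Lemma unb_sub k C D : C ⊆ D -> unbounded k C -> unbounded k D.
Proof. by move=> CD uC x /uC[c /CD cD xc]; exists c. Qed.

Lemma sep_sub X P : sep X P ⊆ X. Proof. by move=> x /mem_sep[]. Qed.

Lemma not_unb k C : ~ unbounded k C -> exists2 x, x ∈ k & forall c, c ∈ C -> x ∉ c.
Proof.
move/existsNP => [x /not_implyP[xk h]]; exists x => // c cC xc; apply: h; by exists c.
Qed.

(** * Normal families and saturation *)

(** The positive sets of a normal ideal. Regressiveness is asked only above a threshold [c0], as no
    function is regressive at [∅]. Since the fibre is also cut at [c0], tails and additivity follow
    from constant and two-valued functions. *)
Record nfam (k : V) (P : V -> Prop) : Prop := NFam {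
  nf_sub : forall X, P X -> X ⊆ k;
  nf_up : forall X Y, P X -> X ⊆ Y -> Y ⊆ k -> P Y;
  nf_unb : forall X, P X -> unbounded k X;
  nf_norm : forall X g c0, P X -> c0 ∈ k -> (forall a, a ∈ X -> c0 ∈ a -> g a ∈ a) ->
    exists c, P (sep X (fun a => c0 ∈ a /\ g a = c)) }.

Definition reg (k : V) : Prop := forall a f, a ∈ k -> (forall i, i ∈ a -> f i ∈ k) ->
  exists2 c, c ∈ k & forall i, i ∈ a -> f i ∈ c.

Section NF.
Variables (k : V) (P : V -> Prop).
Hypotheses (kl : lim k) (nf : nfam k P).
Let ok : ordinal k := lim_ord kl.

Lemma nf_elt X : P X -> exists x, x ∈ X.
Proof. by case: kl => _ k0 _ /(nf_unb nf) /(_ _ k0)[x]; exists x. Qed.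

Lemma nf_mem X x : P X -> x ∈ X -> x ∈ k.
Proof. by move=> PX; apply: (nf_sub nf PX). Qed.

Lemma nf_sepW X (Q Q' : V -> Prop) : P (sep X Q) -> X ⊆ k ->
  (forall x, x ∈ X -> Q x -> Q' x) -> P (sep X Q').
Proof.
move=> h Xk QQ; apply: (nf_up nf h) => x /mem_sep[xX].
  by move=> /(QQ _ xX) q; apply/mem_sep.
by move=> _; apply: Xk.
Qed.

Lemma nf_norm_rel X (R : V -> V -> Prop) c0 : P X -> c0 ∈ k ->
  (forall a, a ∈ X -> c0 ∈ a -> exists2 c, c ∈ a & R a c) ->
  exists2 c, c ∈ k & P (sep X (fun a => [/\ c0 ∈ a, c ∈ a & R a c])).
Proof.
move=> PX c0k h; pose g a := eps (fun c => c ∈ a /\ R a c).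
have gP a : a ∈ X -> c0 ∈ a -> g a ∈ a /\ R a (g a).
  by move=> aX ca; apply: (epsP (P := fun c => c ∈ a /\ R a c)); have [c ? ?] := h a aX ca; exists c.
have [c Pc] := nf_norm nf PX c0k (fun a aX ca => (gP a aX ca).1).
have [a /mem_sep[aX [c0a gac]]] := nf_elt Pc.
exists c.
  rewrite -gac; exact: (ord_trans ok (gP a aX c0a).1 (nf_mem PX aX)).
apply: nf_sepW Pc (nf_sub nf PX) _ => b bX [c0b <-].
by have [] := gP b bX c0b; split.
Qed.

Lemma nf_add X (Q1 Q2 : V -> Prop) : P X -> (forall a, a ∈ X -> Q1 a \/ Q2 a) ->
  P (sep X Q1) \/ P (sep X Q2).
Proof.
move=> PX h.
have [|c Pc] := nf_norm (g := fun a => if pselect (Q1 a) then num 0 else num 1) nf PX (lim_num 1 kl).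
  move=> a aX a1; have oa := ord_mem ok (nf_mem PX aX).
  by case: pselect => ? //; exact: (ord_trans oa (@num_lt 0 1 isT) a1).
have [a /mem_sep[aX [_]]] := nf_elt Pc.
case: pselect => q e; move: Pc; rewrite -e => Pc; [left|right]; apply: (nf_sepW Pc (nf_sub nf PX)) => b bX [_].
  by case: pselect => // _ /num_inj.
by case: pselect => [_ /num_inj //|nb _]; case: (h b bX).
Qed.

Lemma nf_tail X c0 : P X -> c0 ∈ k -> P (sep X (fun a => c0 ∈ a)).
Proof.
move=> PX c0k.
have [|c Pc] := nf_norm (g := fun=> ∅) nf PX c0k.
  by move=> a aX /ord_0_mem; apply; apply: ord_mem ok (nf_mem PX aX).
by apply: (nf_sepW Pc (nf_sub nf PX)) => b bX [].
Qed.

Lemma nf_bdd X c : P X -> c ∈ k -> ~ (forall a, a ∈ X -> c ∉ a).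
Proof. by move=> PX ck h; have [a aX ca] := nf_unb nf PX ck; apply: h ca. Qed.

(** Let [f] on [a] be unbounded. Each [x] above [a] has an [i] in [a] with [f i] not below [x]; this
    choice is regressive, and a positive set with one fixed [i] would be bounded by [f i]. *)
Lemma nf_reg X : P X -> reg k.
Proof.
move=> PX a f ak fk; apply: contrapT => nb.
have bd x : x ∈ k -> exists2 i, i ∈ a & f i ∉ x.
  move=> xk; apply: contrapT => h; apply: nb; exists x => // i ia.
  by apply: contrapT => fx; apply: h; exists i.
have [|c ck Pc] := nf_norm_rel (R := fun x i => i ∈ a /\ f i ∉ x) PX ak.
  move=> x xX ax; have xk := nf_mem PX xX; have [i ia fx] := bd x xk.
  by exists i => //; apply: ord_trans (ord_mem ok xk) ia ax.
have [x /mem_sep[xX [_ _ [ca _]]]] := nf_elt Pc.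
apply: (nf_bdd Pc (fk _ ca)) => y /mem_sep[_ [_ _ [_ //]]].
Qed.

Lemma nf_closed X G : P X -> (forall x, x ∈ k -> G x ∈ k) ->
  P (sep X (fun a => forall x, x ∈ a -> G x ∈ a)).
Proof.
move=> PX Gk; have [//|Pn] := nf_add PX (Q2 := fun a => ~ (forall x, x ∈ a -> G x ∈ a)) (fun a _ => EM _).
have [|c ck Pc] := nf_norm_rel (R := fun a x => G x ∉ a) Pn (lim_num 0 kl).
  by move=> a /mem_sep[_ /existsNP[x /not_implyP[xa Gx]]] _; exists x.
by case: (nf_bdd Pc (Gk _ ck)) => a /mem_sep[_ []].
Qed.

Lemma nf_closed2 X G : P X -> (forall x y, x ∈ k -> y ∈ k -> G x y ∈ k) ->
  P (sep X (fun a => forall x y, x ∈ a -> y ∈ a -> G x y ∈ a)).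
Proof.
move=> PX Gk; have [//|Pn] := nf_add PX (Q2 := fun a => ~ (forall x y, x ∈ a -> y ∈ a -> G x y ∈ a)) (fun a _ => EM _).
have [|c ck Pc] := nf_norm_rel (R := fun a x => exists2 y, y ∈ a & G x y ∉ a) Pn (lim_num 0 kl).
  move=> a /mem_sep[_ /existsNP[x /existsNP[y /not_implyP[xa /not_implyP[ya Gx]]]]] _.
  by exists x => //; exists y.
have [|d dk Pd] := nf_norm_rel (R := fun a y => G c y ∉ a) Pc (lim_num 0 kl).
  by move=> a /mem_sep[_ [_ _ [y ya h]]] _; exists y.
by case: (nf_bdd Pd (Gk _ _ ck dk)) => a /mem_sep[_ []].
Qed.

(* All that the argument uses of the saturation of the restriction to [S]. *)
Definition thin S : Prop := forall D, (forall d, d ∈ k -> D d ⊆ S) ->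
  (forall d d' x, d ∈ k -> d' ∈ k -> x ∈ D d -> x ∈ D d' -> d = d') ->
  exists2 c, c ∈ k & forall d, d ∈ k -> P (D d) -> d ∈ c.

Lemma thin_sub S S' : thin S -> S' ⊆ S -> thin S'.
Proof. by move=> h SS D DS; apply: h => d dk x /(DS d dk)/SS. Qed.

(** The classes of the positive [D d] form an antichain, and distinct [d] give distinct classes
    because disjoint positive sets are not equivalent. Saturation leaves fewer than [k] classes, and
    regularity of [k] bounds their indices. *)
Lemma saturated_thin S (Q : V -> V -> Prop) : (P = fun X => Q k X) -> P S ->
  saturated k (restrict k (ideal_of k Q) S) -> thin S.
Proof.
move=> PQ PS sat D DS Ddis; set J := restrict _ _ _ in sat.
have Sk := nf_sub nf PS.
have JP X : X ∈ J <-> X ⊆ k /\ ~ P (X ∩ S).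
  rewrite mem_sep mem_pow mem_sep mem_pow PQ; split=> [[Xk [_ h]]|[Xk h]] //.
  by split=> //; split=> // x /mem_inter[/Xk].
have Jsub X Y : X ⊆ Y -> Y ∈ J -> X ∈ J.
  move=> XY /JP[Yk h]; apply/JP; split; first by move=> x /XY/Yk.
  move=> PX; apply: h; apply: (nf_up nf PX) => x /mem_inter[h1 h2]; last exact: Sk.
  by apply/mem_inter; split=> //; apply: XY.
have JU X Y : X ∈ J -> Y ∈ J -> un X Y ∈ J.
  move=> /JP[Xk hX] /JP[Yk hY]; apply/JP; split; first by move=> x /mem_un[/Xk|/Yk].
  move=> PU; case: (nf_add PU (Q1 := fun x => x ∈ X) (Q2 := fun x => x ∈ Y)).
  - by move=> a /mem_inter[/mem_un[]]; [left|right].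
  - move=> h; apply: hX; apply: (nf_up nf h) => x; last by case/mem_inter=> /Xk.
    by case/mem_sep=> /mem_inter[_ xS] xX; apply/mem_inter.
  - move=> h; apply: hY; apply: (nf_up nf h) => x; last by case/mem_inter=> /Yk.
    by case/mem_sep=> /mem_inter[_ xS] xX; apply/mem_inter.
have JD d : d ∈ k -> D d ∈ J <-> ~ P (D d).
  move=> dk; rewrite JP.
  have -> : D d ∩ S = D d.
    by apply: sub_anti => x; [case/mem_inter|move=> xD; apply/mem_inter; split=> //; apply: DS xD].
  by split=> [[]|h] //; split=> // x /(DS d dk)/Sk.
have qmem X Y : Y ∈ qclass k J X <-> Y ⊆ k /\ symdiff k X Y ∈ J.
  by rewrite mem_sep mem_pow.
have sdP X Y x : x ∈ symdiff k X Y <-> x ∈ k /\ ((x ∈ X /\ x ∉ Y) \/ (x ∈ Y /\ x ∉ X)).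
  by rewrite mem_sep.
have J0 : ∅ ∈ J.
  apply/JP; split=> [x /mem_empty //|P0].
  by have [x /mem_inter[/mem_empty]] := nf_elt P0.
have sdxx X : symdiff k X X ∈ J.
  by apply: Jsub J0 => x /sdP[_ [[]|[]]].
have qself X : X ⊆ k -> X ∈ qclass k J X by move=> Xk; apply/qmem.
have qJ X : X ∈ J -> qclass k J X = qclass k J ∅.
  move=> XJ; apply: V_ext => Y; rewrite !qmem; split=> -[Yk h]; split=> //.
    apply: Jsub (JU _ _ XJ h) => x /sdP[xk [[/mem_empty //]|[xY _]]].
    by apply/mem_un; case: (EM (x ∈ X)); [left|right; apply/sdP; split=> //; right].
  apply: Jsub (JU _ _ XJ h) => x /sdP[xk [[xX _]|[xY _]]]; apply/mem_un; first by left.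
  by right; apply/sdP; split=> //; right; split=> // /mem_empty.
have Dk d : d ∈ k -> D d ⊆ k by move=> dk x /(DS d dk)/Sk.
have sd0 X Y : X ⊆ k -> (forall x, x ∈ X -> x ∉ Y) -> symdiff k X Y ∈ J -> X ∈ J.
  move=> Xk dis; apply: Jsub => x xX; apply/sdP; split; first exact: Xk.
  by left; split=> //; apply: dis.
have dis d d' : d ∈ k -> d' ∈ k -> d <> d' -> forall x, x ∈ D d -> x ∉ D d'.
  by move=> dk d'k ne x xd xd'; apply: ne; apply: Ddis xd xd'.
pose I := sep k (fun d => P (D d)).
pose q d := qclass k J (D d).
have qinj d d' : d ∈ I -> d' ∈ I -> q d = q d' -> d = d'.
  move=> /mem_sep[dk Pd] /mem_sep[d'k Pd'] e; apply: contrapT => ne.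
  have : D d' ∈ q d by rewrite e; apply: qself; apply: Dk.
  case/qmem => _ h.
  by have /(JD d dk) := sd0 _ _ (Dk d dk) (dis d d' dk d'k ne) h.
have anti : antichain k J (img I q).
  split.
  - move=> c /mem_img[d /mem_sep[dk Pd] ->]; apply/mem_sep; split.
      by apply/mem_pow => Y /qmem[Yk _]; apply/mem_pow.
    by exists (D d) => //; exact: Dk.
  - case/mem_img => d /mem_sep[dk Pd] e.
    have : D d ∈ qclass k J ∅ by rewrite e; apply: qself; apply: Dk.
    case/qmem => _ h; suff /(JD d dk) : D d ∈ J by apply.
    apply: Jsub h => x xD.
    by apply/sdP; split; [exact: Dk xD | right; split=> // /mem_empty].
  - move=> X Y Xk Yk /mem_img[d dI eX] /mem_img[d' d'I eY] ne; apply: qJ.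
    have dd' : d <> d' by move=> e; apply: ne; rewrite eX eY e.
    move: dI d'I => /mem_sep[dk Pd] /mem_sep[d'k Pd'].
    have /qmem[_ hX] : X ∈ q d by rewrite -eX; apply: qself.
    have /qmem[_ hY] : Y ∈ q d' by rewrite -eY; apply: qself.
    apply: Jsub (JU _ _ hX hY) => x /mem_inter[xX xY]; apply/mem_un.
    case: (EM (x ∈ D d)) => xD; last by left; apply/sdP; split; [exact: Xk|right].
    by right; apply/sdP; split; [exact: Xk|right; split=> //; apply: (dis d d')].
have [a ak /equip_sym[f [f1 f2 f3]]] := sat _ anti.
pose h' i := eps (fun d => d ∈ I /\ f i = q d).
have h'P i : i ∈ a -> h' i ∈ I /\ f i = q (h' i).
  by move=> ia; apply: (epsP (P := fun d => d ∈ I /\ f i = q d)); have /mem_img[d dI e] := f1 i ia; exists d.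
have [|c ck hc] := nf_reg PS (f := h') ak.
  by move=> i /h'P[/mem_sep[]].
exists c => // d dk Pd; have dI : d ∈ I by apply/mem_sep.
have [|i ia e] := f3 (q d); first by apply/mem_img; exists d.
have [h'I e'] := h'P i ia; rewrite (qinj d (h' i)) //; first exact: hc.
by rewrite e.
Qed.

End NF.

(** * Homogenising the sets [W a] along a branch of their initial segments *)

Section Homog.
Variables (k : V) (P : V -> Prop).
Hypotheses (kl : lim k) (nf : nfam k P).
Let ok : ordinal k := lim_ord kl.

(* [K xi] is the [xi]-th layer of a filtration of the possible members of the
   sets [W a]; e.g. [K xi x := x = xi] for sets of ordinals. *)
Variable K : V -> V -> Prop.

Definition agree (xi : V) (U U' : V -> Prop) : Prop :=
  forall eta x, eta ∈ succ xi -> K eta x -> U x <-> U' x.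

Lemma agree_trans xi U1 U2 U3 : agree xi U1 U2 -> agree xi U2 U3 -> agree xi U1 U3.
Proof. by move=> h1 h2 e x exi Kx; rewrite (h1 e x) // (h2 e x). Qed.

Lemma agree_sym xi U1 U2 : agree xi U1 U2 -> agree xi U2 U1.
Proof. by move=> h1 e x exi Kx; rewrite (h1 e x). Qed.

Lemma agree_le xi xi' U1 U2 : ordinal xi' -> xi ∈ xi' -> agree xi' U1 U2 -> agree xi U1 U2.
Proof.
move=> ox' xx' h e x exi; apply: h; apply/mem_succ; left.
by case/mem_succ: exi => [h|-> //]; apply: ord_trans h xx'.
Qed.

(* A cofinal branch through the tree of initial segments of the [W a]. *)
Definition branch (X : V) (W : V -> V -> Prop) (b : V -> Prop) : Prop :=
  forall xi, xi ∈ k -> exists a, [/\ a ∈ X, xi ∈ a & agree xi (W a) b].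

Lemma homog S (W : V -> V -> Prop) : P S -> thin k P S ->
  (forall X, P X -> X ⊆ S -> exists b, branch X W b) ->
  exists H b, [/\ P H, H ⊆ S & forall a xi x, a ∈ H -> xi ∈ a -> K xi x -> W a x <-> b x].
Proof.
move=> PS sat br; have Sk := nf_sub nf PS.
(* [cl xi a] is the node through [W a] at height [xi]; [N] collects the [a] lying on a null node,
   and the claim is that [N] can be discarded. *)
pose cl xi a := sep S (fun a' => agree xi (W a') (W a)).
pose N a := exists2 xi, xi ∈ a & ~ P (cl xi a).
have QT : P (sep S (fun a => ~ N a)).
  case: (nf_add kl nf PS (Q1 := N) (Q2 := fun a => ~ N a) (fun a _ => EM _)) => // QN.
  have [|xi xik QN1] := nf_norm_rel kl nf (R := fun a xi => ~ P (cl xi a)) QN (lim_num 0 kl).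
    by move=> a /mem_sep[_ [x xa h]] _; exists x.
  set N1 := sep _ _ in QN1.
  have N1S : N1 ⊆ S by move=> a /mem_sep[/mem_sep[]].
  (* At the fixed height [xi], either positively many [a] share their node with an earlier [a'];
     pressing down fixes [a'], whose node is then positive after all. Or positively many do not, and
     a branch through these yields two of them on the same node. *)
  pose E a := exists2 a', a' ∈ a & a' ∈ N1 /\ agree xi (W a) (W a').
  case: (nf_add kl nf QN1 (Q1 := E) (Q2 := fun a => ~ E a) (fun a _ => EM _)) => [QE|QnE].
    have [|a0 _ Q0] := nf_norm_rel kl nf (R := fun a a' => a' ∈ N1 /\ agree xi (W a) (W a')) QE (lim_num 0 kl).
      by move=> a /mem_sep[_ [a' a'a h]] _; exists a'.
    have [a /mem_sep[_ [_ _ [a0N _]]]] := nf_elt kl nf Q0.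
    have /mem_sep[_ [_ _ []]] := a0N.
    apply: (nf_up nf Q0); last by move=> x /mem_sep[/Sk].
    by move=> x /mem_sep[/mem_sep[xN _] [_ _ [_ ag]]]; apply/mem_sep; split=> //; apply: N1S.
  have [|b bb] := br _ QnE; first by move=> x /mem_sep[/N1S].
  have [a [/mem_sep[aN _] xia ab]] := bb xi xik.
  have ak : a ∈ k by apply: Sk; apply: N1S.
  have [a' [/mem_sep[a'N nE] aa' a'b]] := bb a ak.
  case: nE; exists a => //; split=> //.
  apply: agree_trans (agree_sym ab); apply: agree_le a'b => //.
  exact: ord_mem ok ak.
set T := sep S _ in QT.
have TS : T ⊆ S by exact: sep_sub.
have [b bb] := br _ QT TS.
pose X xi := sep S (fun a => agree xi (W a) b).
have QX xi : xi ∈ k -> P (X xi).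
  move=> xik; have [a [/mem_sep[aS nN] xia ab]] := bb xi xik.
  have : P (cl xi a) by apply: contrapT => h; apply: nN; exists xi.
  move/(nf_up nf); apply; last by move=> x /mem_sep[/Sk].
  by move=> x /mem_sep[xS h]; apply/mem_sep; split=> //; apply: agree_trans ab.
pose bad a := exists2 xi, xi ∈ a & ~ agree xi (W a) b.
have badP a : a ∈ S -> ~ bad a -> forall xi x, xi ∈ a -> K xi x -> W a x <-> b x.
  move=> aS nb xi x xia Kx; have [|h] := EM (agree xi (W a) b).
    by move=> h; apply: (h xi) => //; apply/mem_succ; right.
  by case: nb; exists xi.
case: (nf_add kl nf PS (Q1 := bad) (Q2 := fun a => ~ bad a) (fun a _ => EM _)) => [_|QH]; last first.
  exists (sep S (fun a => ~ bad a)), b; split=> //; first exact: sep_sub.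
  by move=> a xi x /mem_sep[aS nb]; apply: badP.
(* The least height at which [W a] leaves [b]. It is unique for each [a], so the sets [D xi] are
   disjoint and [thin] bounds by [c] the heights at which they are positive. *)
pose lst a xi := xi ∈ a /\ (~ agree xi (W a) b /\ forall e, e ∈ xi -> agree e (W a) b).
pose D xi := sep S (fun a => lst a xi).
have [||c ck hc] := sat D.
- by move=> d _; exact: sep_sub.
- move=> d d' x dk d'k /mem_sep[_ [_ [n1 l1]]] /mem_sep[_ [_ [n2 l2]]].
  by case: (ord_tri (ord_mem ok dk) (ord_mem ok d'k)) => // [/l2|/l1].
(* If positively many [a] agreeing with [b] up to [c] left it elsewhere, pressing down would fix the
   place [d] of departure; but [d] lies below [c], where they agree. *)
have [Qb|Qc'] := nf_add kl nf (QX c ck) (Q1 := bad) (Q2 := fun a => ~ bad a) (fun a _ => EM _).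
  have Rl a : a ∈ sep (X c) bad -> ∅ ∈ a -> exists2 xi, xi ∈ a & lst a xi.
    move=> /mem_sep[/mem_sep[aS _] [xi xia nag]] _.
    have oxi : ordinal xi by apply: ord_mem (ord_mem ok (Sk _ aS)) xia.
    have oa := ord_mem ok (Sk _ aS).
    have [e [oe [ea ne] le]] := ord_least (P := fun e => e ∈ a /\ ~ agree e (W a) b) oxi (conj xia nag).
    exists e => //; split=> //; split=> // d de; apply: contrapT => nd.
    by apply: (le d de); split=> //; apply: ord_trans de ea.
  have [d dk Qd] := nf_norm_rel kl nf Qb (lim_num 0 kl) Rl.
  have dc : d ∈ c.
    apply: hc => //; apply: (nf_up nf Qd); last by move=> x /mem_sep[/Sk].
    by move=> x /mem_sep[/mem_sep[/mem_sep[xS _] _] [_ _ l]]; apply/mem_sep.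
  have [x /mem_sep[/mem_sep[/mem_sep[xS agc] _] [_ _ [_ [nag _]]]]] := nf_elt kl nf Qd.
  by case: nag; apply: agree_le agc => //; apply: ord_mem ok ck.
exists (sep (X c) (fun a => ~ bad a)), b; split=> //.
  by move=> x /mem_sep[/mem_sep[]].
by move=> a xi x /mem_sep[/mem_sep[aS _] nb]; apply: badP.
Qed.

End Homog.

(** * Ordinal pairing and closure points *)

Definition add (a : V) : V -> V := Vrec (fun b rec => un a (cup b (fun c => succ (rec c)))).

Lemma addE a b : add a b = un a (cup b (fun c => succ (add a c))).
Proof.
by apply: VrecE => g h gh; congr (un a _); apply: cup_ext => x xb; rewrite gh.
Qed.

Lemma add_subl a b : a ⊆ add a b.
Proof. by rewrite addE => x xa; apply/mem_un; left. Qed.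

Lemma add_mono a b c : c ∈ b -> add a c ∈ add a b.
Proof.
by move=> cb; rewrite (addE a b); apply/mem_un; right; apply/mem_cup; exists c => //; apply/mem_succ; right.
Qed.

Lemma ord_add a b : ordinal a -> ordinal (add a b).
Proof.
move=> oa; elim/V_ind: b => b IH; rewrite addE; apply: ord_max => //.
by apply: ord_cup => c /IH; exact: ord_succ.
Qed.

Lemma add_subr a b : ordinal a -> ordinal b -> b ⊆ add a b.
Proof.
move=> oa; elim/V_ind: b => b IH ob c cb; have oc := ord_mem ob cb.
have cac := IH c cb oc; have acb := add_mono a cb.
case: (ord_tri oc (ord_add b oa)) => // h; case: (@mem_irr (add a c)); apply: (cac (add a c)).
  by rewrite [X in _ ∈ X]h.
exact: ord_trans oc acb h.
Qed.

(** Start of row [x] of a triangle: row [x] has length [x], and the rows follow one another without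
    overlap. For [y ∈ x], [pr x y] is the place [y] in row [x]. *)
Definition qsum : V -> V := Vrec (fun x rec => cup x (fun y => succ (add (rec y) y))).

Lemma qsumE x : qsum x = cup x (fun y => succ (add (qsum y) y)).
Proof. by apply: VrecE => g h gh; apply: cup_ext => y yx; rewrite gh. Qed.

Lemma ord_qsum x : ordinal (qsum x).
Proof.
elim/V_ind: x => x IH; rewrite qsumE; apply: ord_cup => y yx.
by apply: ord_succ; apply: ord_add; apply: IH.
Qed.

Lemma qsum_sub x : ordinal x -> x ⊆ qsum x.
Proof.
move=> ox y yx; rewrite qsumE; apply/mem_cup; exists y => //.
apply: ord_le; [exact: ord_mem ox yx | exact/ord_add/ord_qsum | ].
by move/(add_subr (ord_qsum y) (ord_mem ox yx)); exact: mem_irr.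
Qed.

Definition pr x y : V := add (qsum x) y.

Lemma pr_lt x x' y y' : x ∈ x' -> y ∈ x -> pr x y ∈ pr x' y'.
Proof.
move=> xx' yx; apply: add_subl; rewrite qsumE; apply/mem_cup; exists x => //.
by apply/mem_succ; left; apply: add_mono.
Qed.

Lemma pr_inj x x' y y' : ordinal x -> ordinal x' -> y ∈ x -> y' ∈ x' ->
  pr x y = pr x' y' -> x = x' /\ y = y'.
Proof.
move=> ox ox' yx y'x' e; case: (ord_tri ox ox') => [h|h|h].
- by have := pr_lt y' h yx; rewrite e => /mem_irr.
- split=> //; subst x'.
  case: (ord_tri (ord_mem ox yx) (ord_mem ox y'x')) => // /(add_mono (qsum x));
  by rewrite -/(pr x y) -/(pr x y') e => /mem_irr.
- by have := pr_lt y h y'x'; rewrite e => /mem_irr.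
Qed.

(** [pr] is injective only when its second argument is below the first. The successor of the maximum
    is above [x], and the inner value is above [y], so both uses are legitimate. *)
Definition pair x y : V := pr (pr (succ (un x y)) x) y.

Lemma maxl u v : ordinal u -> ordinal v -> u ∈ succ (un u v).
Proof.
move=> ou ov; apply: ord_le => //; first exact: ord_max.
by move=> h; case: (mem_irr (x := un u v)); apply/mem_un; left.
Qed.

Lemma maxr u v : ordinal u -> ordinal v -> v ∈ succ (un u v).
Proof.
move=> ou ov; apply: ord_le => //; first exact: ord_max.
by move=> h; case: (mem_irr (x := un u v)); apply/mem_un; right.
Qed.

Lemma pair_inj x x' y y' : ordinal x -> ordinal y -> ordinal x' -> ordinal y' ->
  pair x y = pair x' y' -> x = x' /\ y = y'.
Proof.
move=> ox oy ox' oy'.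
have h3 u v : ordinal u -> ordinal v -> v ∈ pr (succ (un u v)) u.
  move=> ou ov; apply: add_subl; apply: qsum_sub; last exact: maxr.
  exact/ord_succ/ord_max.
have o3 u v : ordinal u -> ordinal v -> ordinal (pr (succ (un u v)) u).
  by move=> ou ov; apply: ord_add; exact: ord_qsum.
case/pr_inj; [exact: o3|exact: o3|exact: h3|exact: h3|] => + ->.
case/pr_inj => //; try exact: maxl; exact/ord_succ/ord_max.
Qed.

Lemma pair_num_inj i j y y' : ordinal y -> ordinal y' ->
  pair (num i) y = pair (num j) y' -> i = j /\ y = y'.
Proof.
by move=> oy oy' /(pair_inj (ord_num i) oy (ord_num j) oy')[/num_inj -> ->].
Qed.

Section Closed.
Variable k : V.
Hypotheses (kl : lim k) (kr : reg k).
Let ok := lim_ord kl.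

Lemma reg_cup b F : b ∈ k -> (forall c, c ∈ b -> F c ∈ k) -> cup b F ∈ k.
Proof.
move=> bk Fk; have [g gk gP] := kr bk Fk.
have oc : ordinal (cup b F) by apply: ord_cup => x /Fk; exact: ord_mem.
have og := ord_mem ok gk.
have : cup b F ∈ succ g.
  apply: ord_le => // /mem_cup[x xb gx]; have := ord_trans og gx (gP x xb).
  exact: mem_irr.
by case/mem_succ => [h|-> //]; apply: ord_trans ok h gk.
Qed.

Lemma add_closed a b : a ∈ k -> b ∈ k -> add a b ∈ k.
Proof.
move=> ak; elim/V_ind: b => b IH bk; rewrite addE; apply: lim_max => //.
apply: reg_cup => // c cb; case: kl => _ _; apply; apply: IH => //.
exact: ord_trans ok cb bk.
Qed.

Lemma qsum_closed x : x ∈ k -> qsum x ∈ k.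
Proof.
elim/V_ind: x => x IH xk; rewrite qsumE; apply: reg_cup => // y yx.
have yk := ord_trans ok yx xk.
by case: kl => _ _; apply; apply: add_closed => //; apply: IH.
Qed.

Lemma pair_closed x y : x ∈ k -> y ∈ k -> pair x y ∈ k.
Proof.
move=> xk yk; apply: add_closed => //; apply: qsum_closed; apply: add_closed => //.
by apply: qsum_closed; case: kl => _ _; apply; apply: lim_max.
Qed.

End Closed.

(* Closure points of functions [k -> k]: [Q] holds on a club. *)
Definition clo (k : V) (Q : V -> Prop) : Prop :=
  exists2 G, forall x, x ∈ k -> G x ∈ k &
    forall a, a ∈ k -> a <> ∅ -> (forall x, x ∈ a -> G x ∈ a) -> Q a.

Lemma clo_imp k Q Q' : (forall a, a ∈ k -> a <> ∅ -> Q a -> Q' a) -> clo k Q -> clo k Q'.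
Proof. by move=> QQ [G Gk h]; exists G => // a ak a0 ha; apply: QQ => //; apply: h. Qed.

Lemma max_lt k x y : ordinal k -> ordinal x -> ordinal y -> un x y ∈ k -> x ∈ k /\ y ∈ k.
Proof.
move=> ok ox oy h.
have lt v : v ∈ succ (un x y) -> v ∈ k by case/mem_succ => [h'|-> //]; apply: ord_trans h' h.
by split; apply: lt; [exact: maxl|exact: maxr].
Qed.

Section Clo.
Variable k : V.
Hypothesis kl : lim k.
Let ok := lim_ord kl.

Lemma clo_and Q1 Q2 : clo k Q1 -> clo k Q2 -> clo k (fun a => Q1 a /\ Q2 a).
Proof.
move=> [G1 k1 h1] [G2 k2 h2]; exists (fun x => un (G1 x) (G2 x)).
  by move=> x xk; apply: lim_max => //; [exact: k1|exact: k2].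
move=> a ak a0 ha; have oa := ord_mem ok ak.
have h x : x ∈ a -> G1 x ∈ a /\ G2 x ∈ a.
  move=> xa; have xk := ord_trans ok xa ak.
  by apply: max_lt (ha x xa) => //; apply: ord_mem ok _; [exact: k1|exact: k2].
by split; [apply: h1|apply: h2] => // x /h[].
Qed.

Lemma clo_gt g : g ∈ k -> clo k (fun a => g ∈ a).
Proof. by move=> gk; exists (fun=> g) => // a _ /neq0P[x xa] /(_ x xa). Qed.

Lemma clo_lim : clo k lim.
Proof.
exists succ; first by case: kl.
move=> a ak /neq0P[x xa] h; have oa := ord_mem ok ak; split=> //; exact: ord_0_mem xa.
Qed.

Hypothesis kr : reg k.

Lemma clo2 F : (forall x y, x ∈ k -> y ∈ k -> F x y ∈ k) ->
  clo k (fun a => forall x y, x ∈ a -> y ∈ a -> F x y ∈ a).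
Proof.
move=> Fk; have [_ _ ks] := kl.
(* The supremum over all arguments up to [m] makes a binary closure condition unary: [m] is taken as
   the maximum of the two arguments. *)
exists (fun m => cup (succ m) (fun x => cup (succ m) (fun y => succ (F x y)))).
  move=> m mk; have sk x : x ∈ succ m -> x ∈ k by move=> xm; apply: ord_trans ok xm (ks _ mk).
  apply: reg_cup => //; first exact: ks.
  move=> x /sk xk; apply: reg_cup => //; first exact: ks.
  by move=> y /sk yk; apply: (ks); apply: Fk.
move=> a ak _ h x y xa ya; have oa := ord_mem ok ak.
have ox := ord_mem oa xa; have oy := ord_mem oa ya.
have ma : un x y ∈ a by case: (ord_max_or ox oy) => ->.
apply: ord_trans oa _ (h _ ma); apply/mem_cup; exists x; first exact: maxl.
apply/mem_cup; exists y; first exact: maxr.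
by apply/mem_succ; right.
Qed.

Definition limpt (C d : V) : Prop := d <> ∅ /\ unbounded d (C ∩ d).

(** A diagonal intersection: if [a] is closed under the next element of [C c] above [x], as a
    function of [c] and [x], then [a] is a limit point of each [C c] with [c] below [a]. *)
Lemma clo_diag C : (forall c, C c ⊆ k /\ unbounded k (C c)) ->
  clo k (fun a => forall c, c ∈ a -> limpt (C c) a).
Proof.
move=> Cu; pose nx c x := eps (fun y => y ∈ C c /\ x ∈ y).
have nxP c x : x ∈ k -> nx c x ∈ C c /\ x ∈ nx c x.
  move=> xk; apply: (epsP (P := fun y => y ∈ C c /\ x ∈ y)).
  by have [y yC xy] := (Cu c).2 x xk; exists y.
apply: (clo_imp _ (clo2 (F := nx) _)); last first.
  by move=> c x ck /(nxP c x)[h _]; apply: (Cu c).1.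
move=> a ak a0 h c ca; split=> // x xa; have [n1 n2] := nxP c x (ord_trans ok xa ak).
by exists (nx c x) => //; apply/mem_inter; split=> //; apply: h.
Qed.

Lemma clo_limpt C : C ⊆ k -> unbounded k C -> clo k (limpt C).
Proof.
move=> Ck uC; apply: (clo_imp _ (clo_diag (C := fun=> C) _)) => //.
by move=> a _ /neq0P[x xa] /(_ x xa).
Qed.

End Clo.

Definition pair_closed_ord (a : V) : Prop := forall x y, x ∈ a -> y ∈ a -> pair x y ∈ a.

Lemma clo_pair k : lim k -> reg k -> clo k pair_closed_ord.
Proof. by move=> kl kr; apply: clo2 => // x y; exact: pair_closed. Qed.

Definition eqK (xi x : V) : Prop := x = xi.

Lemma agree_eqK xi U U' : agree eqK xi U U' <-> forall x, x ∈ succ xi -> U x <-> U' x.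
Proof.
split=> [h x xxi|h e x exi ->]; first exact: (h x x).
exact: h.
Qed.

Definition has_branches (k : V) (P : V -> Prop) : Prop :=
  forall X W, P X -> exists b, branch k eqK X W b.

Lemma homog1 k P S W : lim k -> nfam k P -> has_branches k P ->
  P S -> thin k P S ->
  exists H b, [/\ P H, H ⊆ S & forall a x, a ∈ H -> x ∈ a -> W a x <-> b x].
Proof.
move=> kl nf br PS sat.
have [|H [b [PH HS h]]] := homog (K := eqK) kl nf (W := W) PS sat.
  by move=> X PX _; apply: br.
by exists H, b; split=> // a x aH xa; apply: h xa _.
Qed.

(** A binary relation on [a] is coded by [pair] as a set of ordinals; [H] is cut down to ordinals
    closed under [pair], where no code is lost. *)
Lemma homog2 k P S (M : V -> V -> V -> Prop) : lim k -> nfam k P -> has_branches k P ->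
  P S -> thin k P S ->
  exists H b, [/\ P H, H ⊆ S & forall a x y, a ∈ H -> x ∈ a -> y ∈ a -> M a x y <-> b x y].
Proof.
move=> kl nf br PS sat; have ok := lim_ord kl.
pose W a z := exists x y, [/\ x ∈ a, y ∈ a, z = pair x y & M a x y].
have [H [b [PH HS h]]] := homog1 W kl nf br PS sat.
have pk := pair_closed kl (nf_reg kl nf PS).
exists (sep H (fun a => forall x y, x ∈ a -> y ∈ a -> pair x y ∈ a)), (fun x y => b (pair x y)).
split; first exact: (nf_closed2 kl nf PH pk).
  by move=> x /mem_sep[/HS].
move=> a x y /mem_sep[aH ap] xa ya; rewrite -(h a) //; last exact: ap.
have oa : ordinal a by apply: ord_mem ok _; apply: (nf_sub nf PH).
split=> [m|]; first by exists x, y.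
move=> [x' [y' [x'a y'a]]] /pair_inj e.
by case: e; [exact: ord_mem xa|exact: ord_mem ya|exact: ord_mem x'a|exact: ord_mem y'a|move=> -> ->].
Qed.

(* For [u ∈ a] and [A ⊆ a] with [a] closed under pairing, [u] and [A] in one
   subset of [a]. *)
Definition code2 (a u A : V) : V :=
  sep a (fun z => z = pair (num 0) u \/ exists2 y, y ∈ A & z = pair (num 1) y).

Lemma code2_inj a b u v A B : ordinal b -> a ∈ b ->
  pair_closed_ord a -> pair_closed_ord b -> num 1 ∈ a -> u ∈ a -> v ∈ b -> A ⊆ a -> B ⊆ b ->
  code2 a u A = code2 b v B ∩ a -> u = v /\ A = B ∩ a.
Proof.
move=> ob ab pa pb a1 ua vb Aa Bb e; have oa := ord_mem ob ab.
have b1 := ord_trans ob a1 ab.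
have a0 : num 0 ∈ a := ord_trans oa (@num_lt 0 1 isT) a1.
have ou := ord_mem oa ua; have ov := ord_mem ob vb.
have key c w C y : ordinal c -> ordinal w -> C ⊆ c -> ordinal y ->
    pair (num 1) y ∈ code2 c w C <-> pair (num 1) y ∈ c /\ y ∈ C.
  move=> oc ow Cc oy; rewrite mem_sep; split=> -[h1 h2]; split=> //; last by right; exists y.
  case: h2 => [/(pair_num_inj oy ow)[] //|[y' y'C e']].
  by have [_ ->] := pair_num_inj oy (ord_mem oc (Cc _ y'C)) e'.
split.
  have : pair (num 0) u ∈ code2 b v B ∩ a by rewrite -e; apply/mem_sep; split; [exact: pa|left].
  case/mem_inter=> /mem_sep[_ [/(pair_num_inj ou ov)[] //|[y yB e']] _].
  by have [] := pair_num_inj ou (ord_mem ob (Bb _ yB)) e'.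
apply: V_ext => y; rewrite mem_inter; split=> [yA|[yB ya]].
  have ya := Aa _ yA; have oy := ord_mem oa ya; split=> //.
  have : pair (num 1) y ∈ code2 b v B ∩ a by rewrite -e; apply/key => //; split=> //; apply: pa.
  by case/mem_inter => /key[].
have oy := ord_mem oa ya.
have : pair (num 1) y ∈ code2 a u A.
  rewrite e; apply/mem_inter; split; last exact: pa.
  by apply/key => //; split=> //; apply: pb => //; apply: ord_trans ya ab.
by case/key.
Qed.

(** * Homogeneous sets for lists *)

(** Membership of [a] depends only on [S ∩ a], so traces of this set have the same form; this
    carries the inductions on [k]. *)
Definition lacking (phi : V -> V -> Prop) (S : V) : V := sep S (fun a => ~ phi a (S ∩ a)).

Lemma lacking_trace phi S a : ordinal a -> lacking phi S ∩ a = lacking phi (S ∩ a).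
Proof.
move=> oa; apply: V_ext => x; rewrite mem_inter !mem_sep.
have e : x ∈ a -> S ∩ a ∩ x = S ∩ x.
  move=> xa; apply: V_ext => y; rewrite !mem_inter.
  by split=> [[[]]|[]] // yS yx; split=> //; split=> //; apply: ord_trans yx xa.
by split=> [[[xS n] xa]|[[xS xa] n]]; move: n; rewrite ?e.
Qed.

(* A common form of "size [k]" and "stationary in [k]", for all ordinals [k]. *)
Record largeness (Lg : V -> V -> Prop) : Prop := Largeness {
  lg_unb : forall k Y, Lg k Y -> unbounded k Y;
  lg_up : forall k Y Y', Lg k Y -> Y ⊆ Y' -> Lg k Y';
  lg_or : forall k Y Q, ordinal k -> Y ⊆ k -> Lg k Y ->
     Lg k (sep Y Q) \/ Lg k (sep Y (fun a => ~ Q a));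
  lg_glue : forall k X Y, ordinal k -> Y ⊆ k -> Lg k Y ->
     (forall a, a ∈ Y -> Lg a (X ∩ a)) -> Lg k X }.

Section Lists.
Variable Lg : V -> V -> Prop.
Hypothesis lg : largeness Lg.

Definition listable (k S : V) : Prop :=
  S ⊆ k /\ forall L, is_list S L -> exists H, [/\ H ⊆ S, homogeneous L H & Lg k H].

Lemma listable_up k S S' : listable k S -> S ⊆ S' -> S' ⊆ k -> listable k S'.
Proof.
move=> [Sk h] SS S'k; split=> // L lL.
have [|H [HS hH lH]] := h L; first by move=> a /SS/lL.
by exists H; split=> // x /HS/SS.
Qed.

(** Lists defeating the two parts are glued into one list on [S]; a large homogeneous set for it is
    large on one of the parts. *)
Lemma listable_or k S Q : ordinal k -> listable k S ->
  listable k (sep S Q) \/ listable k (sep S (fun a => ~ Q a)).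
Proof.
move=> ok [Sk h]; apply: contrapT => /not_orP[h1 h2].
have {}h1 : ~ forall L, is_list (sep S Q) L -> exists H, [/\ H ⊆ sep S Q, homogeneous L H & Lg k H].
  by move=> h'; apply: h1; split=> // x /mem_sep[/Sk].
have {}h2 : ~ forall L, is_list (sep S (fun a => ~ Q a)) L -> exists H, [/\ H ⊆ sep S (fun a => ~ Q a), homogeneous L H & Lg k H].
  by move=> h'; apply: h2; split=> // x /mem_sep[/Sk].
move: h1 h2 => /existsNP[L1 /not_implyP[l1 n1]] /existsNP[L2 /not_implyP[l2 n2]].
pose L a := if pselect (Q a) then L1 a else L2 a.
have [|H [HS hH lH]] := h L.
  by move=> a aS; rewrite /L; case: pselect => q; [apply: l1|apply: l2]; apply/mem_sep.
have Hk : H ⊆ k by move=> x /HS/Sk.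
case: (lg_or lg Q ok Hk lH) => l; [apply: n1|apply: n2].
  exists (sep H Q); split=> //.
    by move=> x /mem_sep[/HS xS q]; apply/mem_sep.
  move=> a b /mem_sep[aH Qa] /mem_sep[bH Qb] ab; have := hH _ _ aH bH ab.
  by rewrite /L; case: pselect => //; case: pselect.
exists (sep H (fun a => ~ Q a)); split=> //.
  by move=> x /mem_sep[/HS xS q]; apply/mem_sep.
move=> a b /mem_sep[aH Qa] /mem_sep[bH Qb] ab; have := hH _ _ aH bH ab.
by rewrite /L; case: pselect => //; case: pselect.
Qed.

Section K.
Variable k : V.
Hypothesis kl : lim k.
Let ok := lim_ord kl.

(** A weak normality, obtained without pairing: the list of singletons of [m a] makes [m] constant
    on a homogeneous set. It yields regularity and closure points, which full normality needs in
    order to code pairs into lists. *)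
Lemma listable_small X m : listable k X -> (forall a, a ∈ X -> m a ∈ a) ->
  (forall c, c ∈ k -> exists2 g, g ∈ k & forall a, a ∈ X -> m a = c -> g ∉ a) -> False.
Proof.
move=> [Xk h] ma bd; have [|H [HX hH lH]] := h (fun a => one (m a)).
  by move=> a /ma h' x /mem_one ->.
have uH := lg_unb lg lH; have Hk : H ⊆ k by move=> x /HX/Xk.
have [a0 a0H _] : exists2 c, c ∈ H & ∅ ∈ c by apply: uH; case: kl.
have a0k := Hk _ a0H; have ma0k : m a0 ∈ k by apply: ord_trans ok (ma _ (HX _ a0H)) a0k.
have [g gk gP] := bd _ ma0k.
have [a aH ga] := uH _ (lim_max kl gk a0k).
have oa := ord_mem ok (Hk _ aH).
have lt u : ordinal u -> u ∈ succ (un g a0) -> u ∈ a.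
  by move=> ou /mem_succ[h'|->] //; apply: ord_trans oa h' ga.
have og := ord_mem ok gk; have oa0 := ord_mem ok a0k.
apply: (gP a (HX _ aH)); last by apply: lt => //; apply: maxl.
have a0a : a0 ∈ a by apply: lt => //; apply: maxr.
have e := hH _ _ a0H aH a0a; have : m a0 ∈ one (m a) ∩ a0 by rewrite -e; apply/mem_one.
by case/mem_inter => /mem_one.
Qed.

Lemma listable_tail X g : listable k X -> g ∈ k -> listable k (sep X (fun a => g ∈ a)).
Proof.
move=> PX gk; case: (listable_or (fun a => g ∈ a) ok PX) => // -[Xk h].
have [|H [HX _ /(lg_unb lg)]] := h (fun=> ∅); first by move=> a _ x /mem_empty.
by move=> /(_ g gk)[c /HX /mem_sep[]].
Qed.

Lemma listable_reg X : listable k X -> reg k.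
Proof.
move=> PX a f ak fk; apply: contrapT => nb.
have bd x : x ∈ k -> exists i, i ∈ a /\ f i ∉ x.
  move=> xk; apply: contrapT => h; apply: nb; exists x => // i ia.
  by apply: contrapT => fx; apply: h; exists i.
pose m x := eps (fun i => i ∈ a /\ f i ∉ x).
have mP x : x ∈ k -> m x ∈ a /\ f (m x) ∉ x by move/bd/epsP.
have [Xk _] := PX.
apply: (listable_small (m := m) (listable_tail PX ak)).
  move=> x /mem_sep[/Xk xk ax]; have [h _] := mP x xk.
  exact: ord_trans (ord_mem ok xk) h ax.
move=> c ck; exists (if pselect (c ∈ a) then f c else ∅).
  by case: pselect => [h|h] /=; [exact: fk|case: kl].
move=> x /mem_sep[/Xk xk ax] e; have [h1 h2] := mP x xk.
by rewrite e in h1 h2; case: pselect.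
Qed.

Lemma listable_clo X Q : listable k X -> clo k Q -> listable k (sep X Q).
Proof.
move=> PX [G Gk GQ]; have k0 := lim_num 0 kl; have PX0 := listable_tail PX k0.
case: (listable_or Q ok PX0) => [PY|PY].
  apply: listable_up PY _ _; last by move=> x /mem_sep[/(PX.1)].
  by move=> x /mem_sep[/mem_sep[xX _] q]; apply/mem_sep.
have Yk := PY.1; set Y := sep _ _ in PY Yk.
pose m a := eps (fun x => x ∈ a /\ G x ∉ a).
have mP a : a ∈ Y -> m a ∈ a /\ G (m a) ∉ a.
  move=> aY; apply: (epsP (P := fun x => x ∈ a /\ G x ∉ a)); apply: contrapT => h.
  have ak := Yk _ aY; case/mem_sep: aY => /mem_sep[_ /mem_neq0 a0]; apply; apply: GQ => // x xa.
  by apply: contrapT => n; apply: h; exists x.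
case: (listable_small PY (m := m)); first by move=> a /mP[].
by move=> c /Gk ck; exists (G c) => // a /mP[_ n] <-.
Qed.

Lemma listable_nfam : nfam k (listable k).
Proof.
split; first by move=> X [].
- by move=> X Y PX XY Yk; apply: listable_up PX XY Yk.
- move=> X [Xk h]; have [|H [HX _ /(lg_unb lg)]] := h (fun=> ∅).
    by move=> a _ x /mem_empty.
  exact: unb_sub.
move=> X g c0 PX c0k ga; apply: contrapT => /forallNP nP; have [Xk _] := PX.
pose Xc c := sep X (fun a => c0 ∈ a /\ g a = c).
have /choice[Lc LcP] : forall c, exists L, is_list (Xc c) L /\
    forall H, H ⊆ Xc c -> homogeneous L H -> Lg k H -> False.
  move=> c; apply: contrapT => h; apply: (nP c); split=> [x /mem_sep[/Xk] //|L lL].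
  apply: contrapT => h'; apply: h; exists L; split=> // H HX hH lH.
  by apply: h'; exists H.
have k1 := lim_num 1 kl.
have PX1 := listable_tail (listable_tail (listable_clo PX (clo_pair kl (listable_reg PX))) c0k) k1.
set X1 := sep _ _ in PX1; have [X1k h] := PX1.
(* One list carries the value of [g] and the entry of the list defeating its fibre: a homogeneous
   set lies in a single fibre and is homogeneous for that list too. *)
pose L a := code2 a (g a) (Lc (g a) a).
have [|H [HX hH lH]] := h L; first by move=> a aX1; exact: sep_sub.
have X1P a : a ∈ X1 -> [/\ a ∈ Xc (g a), ordinal a, g a ∈ a, num 1 ∈ a & pair_closed_ord a].
  move=> aX1; have oa := ord_mem ok (X1k _ aX1).
  move: aX1 => /mem_sep[/mem_sep[/mem_sep[aX pa] ca] a1]; split=> //; last exact: ga.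
  exact/mem_sep.
have HP a b : a ∈ H -> b ∈ H -> a ∈ b -> g a = g b /\ Lc (g a) a = Lc (g b) b ∩ a.
  move=> aH bH ab; have [aX oa gaa a1 pa] := X1P _ (HX _ aH).
  have [bX ob gbb b1 pb] := X1P _ (HX _ bH).
  apply: (code2_inj ob ab pa pb a1 gaa gbb); last exact: hH.
    exact: (LcP _).1.
  exact: (LcP _).1.
have [a0 a0H _] : exists2 c, c ∈ H & ∅ ∈ c by apply: (lg_unb lg lH); case: kl.
have gH a : a ∈ H -> g a = g a0.
  move=> aH; case: (ord_tri (ord_mem ok (X1k _ (HX _ aH))) (ord_mem ok (X1k _ (HX _ a0H)))).
  - by case/(HP _ _ aH a0H).
  - by move->.
  - by case/(HP _ _ a0H aH).
have HXc : H ⊆ Xc (g a0) by move=> a aH; rewrite -(gH a aH); case: (X1P _ (HX _ aH)).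
apply: (LcP (g a0)).2 HXc _ lH => a b aH bH ab.
by have [_] := HP a b aH bH ab; rewrite !gH.
Qed.

Lemma listable_branches : has_branches k (listable k).
Proof.
move=> X W [Xk h]; have [|H [HX hH lH]] := h (fun a => sep a (W a)).
  by move=> a _; exact: sep_sub.
have Hk : H ⊆ k by move=> x /HX/Xk.
exists (fun x => exists a, [/\ a ∈ H, x ∈ a & W a x]) => xi xik.
have [a aH xia] := lg_unb lg lH xik; exists a; split=> //; first exact: HX.
have oa := ord_mem ok (Hk _ aH).
apply/agree_eqK => x xxi; have xa : x ∈ a by case/mem_succ: xxi => [h'|-> //]; apply: ord_trans h' xia.
split=> [Wa|[b [bH xb Wb]]]; first by exists a.
case: (ord_tri oa (ord_mem ok (Hk _ bH))) => [ab|-> //|ba].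
  have : x ∈ sep b (W b) ∩ a by apply/mem_inter; split=> //; apply/mem_sep.
  by rewrite -(hH _ _ aH bH ab) => /mem_sep[].
have : x ∈ sep b (W b) by apply/mem_sep.
by rewrite (hH _ _ bH aH ba) => /mem_inter[/mem_sep[]].
Qed.

End K.

(** Otherwise [S ∩ a] has the property for positively many [a]. By induction so does the trace of
    [lacking listable S] on [a], which gives sets [X a] homogeneous for [L]. Read as a list, they
    cohere on a large [Y]; their union is homogeneous, and large by [lg_glue]. *)
Lemma listable_lacking k S : ordinal k -> listable k S -> listable k (lacking listable S).
Proof.
elim/V_ind: k S => k IH S ok PS; have [Sk _] := PS.
case: (listable_or (fun a => ~ listable a (S ∩ a)) ok PS) => // PS0.
set S0 := sep _ _ in PS0; split=> [x /mem_sep[/Sk] //|L lL].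
have T0 a : a ∈ S0 -> listable a (lacking listable S ∩ a).
  move=> /mem_sep[aS /contrapT La]; have ak := Sk _ aS; have oa := ord_mem ok ak.
  rewrite lacking_trace //; exact: IH.
have XP a : exists X, a ∈ S0 -> [/\ X ⊆ lacking listable S ∩ a, homogeneous L X & Lg a X].
  case: (EM (a ∈ S0)) => [aS0|]; last by exists ∅.
  have [_ /(_ L)[]] := T0 a aS0; first by move=> x /mem_inter[/lL].
  by move=> X hX; exists X.
have [X {}XP] := choice XP.
have [_ /(_ X)[]] := PS0.
  by move=> a /XP[h _ _] x /h /mem_inter[].
move=> Y [YS hY lY]; have Yk : Y ⊆ k by move=> x /YS/mem_sep[/Sk].
pose U := cup Y X.
have UX a : a ∈ Y -> U ∩ a = X a.
  move=> aY; apply: V_ext => x; rewrite mem_inter mem_cup; split; last first.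
    move=> xX; split; first by exists a.
    by have [h _ _] := XP _ (YS _ aY); have /mem_inter[] := h _ xX.
  move=> [[b bY xb] xa]; case: (ord_tri (ord_mem ok (Yk _ aY)) (ord_mem ok (Yk _ bY))) => [ab|-> //|ba].
    by rewrite (hY _ _ aY bY ab); apply/mem_inter.
  by move: xb; rewrite (hY _ _ bY aY ba) => /mem_inter[].
exists U; split.
- move=> x /mem_cup[a aY xa]; have [h _ _] := XP _ (YS _ aY).
  by have /mem_inter[] := h _ xa.
- move=> x y /mem_cup[a aY xa] /mem_cup[b bY yb] xy.
  have [h1 h2 _] := XP _ (YS _ bY).
  have /mem_inter[_ yb'] := h1 _ yb.
  apply: h2 => //; rewrite -UX //; apply/mem_inter; split; first by apply/mem_cup; exists a.
  exact: ord_trans (ord_mem ok (Yk _ bY)) xy yb'.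
- apply: (lg_glue lg ok Yk lY) => a aY; rewrite UX //.
  by have [_ _ h] := XP _ (YS _ aY).
Qed.

(** The only reflection property that has to be checked for each kind of largeness: a large set is
    large below some member of a thin positive set. *)
Hypothesis lg_reflect : forall k Y T, lim k -> nfam k (listable k) ->
  thin k (listable k) T -> listable k T -> Y ⊆ k -> Lg k Y ->
  (forall a, a ∈ T -> ~ Lg a (Y ∩ a)) -> False.

Lemma listable_not_thin k S : lim k -> listable k S -> thin k (listable k) S -> False.
Proof.
move=> kl PS tS; have nf := listable_nfam kl; have ok := lim_ord kl.
have [Sk SL] := PS.
have PT := listable_lacking ok PS; set T := lacking listable S in PT.
have TS : T ⊆ S by exact: sep_sub.
have MP a : exists M, a ∈ T -> is_list (S ∩ a) M /\
    forall H, H ⊆ S ∩ a -> homogeneous M H -> Lg a H -> False.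
  case: (EM (a ∈ T)) => [/mem_sep[aS n]|]; last by exists id.
  apply: contrapT => h; apply: n; split=> [x /mem_inter[] //|M lM].
  apply: contrapT => h'; apply: h; exists M => _; split=> // H HS hH lH.
  by apply: h'; exists H.
have [M {}MP] := choice MP.
(* For [a ∈ H] and [x ∈ S ∩ a] the entry [M a x] is the section of [b] at [x]; hence a set
   homogeneous for the sections is, below [a], homogeneous for [M a]. *)
have [H [b [PH HT hb]]] := homog2 (fun a x y => y ∈ M a x) kl nf (listable_branches kl) PT (thin_sub tS TS).
have [|Y [YS hY lY]] := SL (fun x => sep x (b x)); first by move=> a _; exact: sep_sub.
apply: (lg_reflect kl nf (thin_sub (thin_sub tS TS) HT) PH _ lY).
  by move=> x /YS/Sk.
move=> a aH l; have oa : ordinal a by apply: ord_mem ok _; apply: (nf_sub nf PH).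
have aT := HT _ aH.
apply: (MP a aT).2 l.
  by move=> x /mem_inter[/YS xS xa]; apply/mem_inter.
have e x : x ∈ S -> x ∈ a -> M a x = sep x (b x).
  move=> xS xa; apply: V_ext => y; rewrite mem_sep.
  have h : y ∈ M a x -> y ∈ x by apply: (MP a aT).1; apply/mem_inter.
  have ya : y ∈ x -> y ∈ a by move=> yx; apply: ord_trans yx xa.
  have hh yx := hb a x y aH xa (ya yx).
  by split=> [yM|[yx /(hh yx)] //]; have yx := h yM; split=> //; apply/(hh yx).
move=> x y /mem_inter[xY xa] /mem_inter[yY ya] xy.
by rewrite !e //; [apply: hY | exact: YS | exact: YS].
Qed.

End Lists.

(** * Almost ineffable and ineffable sets *)

Lemma nowhere_saturated_thin k Q P : lim k -> nfam k P -> (forall S, Q k S <-> P S) ->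
  (forall S, P S -> thin k P S -> False) -> nowhere_saturated k (ideal_of k Q).
Proof.
move=> kl nf QP h S [Sk SI] sat.
have PS : P S.
  apply/QP; apply: contrapT => nQ; apply: SI; apply/mem_sep; split=> //; exact/mem_pow.
apply: (h S PS); apply: (saturated_thin kl nf (Q := Q)) => //.
by apply: funext => X; apply/propext; split => /QP.
Qed.

Lemma limpt_sub C C' d : C ⊆ C' -> limpt C d -> limpt C' d.
Proof.
move=> CC [d0 u]; split=> //; apply: unb_sub u => x /mem_inter[/CC xC xd].
exact/mem_inter.
Qed.

Lemma limpt_limpt k C d : ordinal k -> d ∈ k -> limpt (sep k (limpt C)) d -> limpt C d.
Proof.
move=> ok dk [d0 u]; split=> // x /u[c /mem_inter[/mem_sep[ck [_ uc]] cd] /uc[e /mem_inter[eC ec] xe]].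
exists e => //; apply/mem_inter; split=> //; apply: ord_trans ec cd; exact: ord_mem dk.
Qed.

Lemma unb_tail k C g : lim k -> C ⊆ k -> unbounded k C -> g ∈ k -> unbounded k (sep C (fun c => g ∈ c)).
Proof.
move=> kl Ck u gk x xk; have ok := lim_ord kl.
have [c cC h] := u _ (lim_max kl gk xk); have oc := ord_mem ok (Ck _ cC).
have og := ord_mem ok gk; have ox := ord_mem ok xk.
have lt v : v ∈ succ (un g x) -> v ∈ c by case/mem_succ => [h'|-> //]; apply: ord_trans h' h.
exists c; last by apply: lt; apply: maxr.
by apply/mem_sep; split=> //; apply: lt; apply: maxl.
Qed.

Lemma unb_or k Y Q : ordinal k -> Y ⊆ k -> unbounded k Y ->
  unbounded k (sep Y Q) \/ unbounded k (sep Y (fun a => ~ Q a)).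
Proof.
move=> ok Yk u; apply: contrapT => /not_orP[/not_unb[x xk hx] /not_unb[y yk hy]].
have ox := ord_mem ok xk; have oy := ord_mem ok yk.
have mk : un x y ∈ k by case: (ord_max_or ox oy) => ->.
have [c cY h] := u _ mk; have oc := ord_mem ok (Yk _ cY).
have lt v : v ∈ succ (un x y) -> v ∈ c by case/mem_succ => [h'|-> //]; apply: ord_trans h' h.
case: (EM (Q c)) => q.
  by case: (hx c); [apply/mem_sep|apply: lt; apply: maxl].
by case: (hy c); [apply/mem_sep|apply: lt; apply: maxr].
Qed.

Lemma unb_largeness : largeness unbounded.
Proof.
split=> //; [by move=> k Y Y' u YY; apply: unb_sub u | by move=> k Y Q; apply: unb_or |].
move=> k X Y ok Yk uY h x /uY[c cY /(h c cY)[e /mem_inter[eX _] xe]]; by exists e.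
Qed.

(** If each [Y ∩ a] were bounded in [a], pressing down would give one bound [c] for a positive set
    of [a]; but [Y] has an element above [c], and some such [a] lies above that element. *)
Lemma unb_reflect k P Y T : lim k -> nfam k P -> P T -> Y ⊆ k -> unbounded k Y ->
  ~ (forall a, a ∈ T -> ~ unbounded a (Y ∩ a)).
Proof.
move=> kl nf PT Yk uY h; have ok := lim_ord kl.
have [|c ck Pc] := nf_norm_rel kl nf (R := fun a x => forall c, c ∈ Y ∩ a -> x ∉ c) PT (lim_num 0 kl).
  by move=> a /h/not_unb[x] xa hx _; exists x.
have [y yY cy] := uY c ck.
have [a /mem_sep[_ [_ _ n]] ya] := nf_unb nf Pc (Yk _ yY).
by case: (n y) => //; apply/mem_inter.
Qed.

(* For ordinals of uncountable cofinality this is stationarity; for other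
   ordinals it fails. *)
Definition stat (k Y : V) : Prop := unbounded k Y /\
  forall C, C ⊆ k -> unbounded k C -> exists2 y, y ∈ Y & limpt C y.

(** Interleaving replaces the intersection of clubs, which may be empty in countable cofinality. The
    set keeps those [c ∈ C2] below which an element of [C1] dominates all earlier elements of [C2],
    so its limit points are limits of [C1] as well. *)
Lemma unb_limpt2 k C1 C2 : lim k -> C1 ⊆ k -> C2 ⊆ k -> unbounded k C1 -> unbounded k C2 ->
  exists C, [/\ C ⊆ k, unbounded k C & forall d, d ∈ k -> limpt C d -> limpt C1 d /\ limpt C2 d].
Proof.
move=> kl C1k C2k u1 u2; have ok := lim_ord kl.
pose R c := exists c1, [/\ c1 ∈ C1, c1 ∈ c & forall c', c' ∈ C2 -> c' ∈ c -> c' ∈ succ c1].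
exists (sep C2 R); split; first by move=> x /mem_sep[/C2k].
  move=> x xk; have [c1 c1C xc1] := u1 x xk; have c1k := C1k _ c1C.
  have [c cC c1c] := u2 c1 c1k; have oc := ord_mem ok (C2k _ cC).
  have [e [oe [eC c1e] le]] := ord_least (P := fun e => e ∈ C2 /\ c1 ∈ e) oc (conj cC c1c).
  exists e; last by apply: ord_trans xc1 c1e.
  apply/mem_sep; split=> //; exists c1; split=> // c' c'C c'e.
  apply: ord_le; [exact: ord_mem ok (C2k _ c'C)|exact: ord_mem ok c1k|].
  by move=> h; apply: (le c').
move=> d dk [d0 u]; have od := ord_mem ok dk; split; split=> // x xd.
  have [c /mem_inter[/mem_sep[cC _] cd] xc] := u x xd.
  have [e /mem_inter[/mem_sep[eC [c1 [c1C c1e h]]] ed] ce] := u c cd.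
  exists c1; first by apply/mem_inter; split=> //; apply: ord_trans c1e ed.
  have oc1 : ordinal c1 by apply: ord_mem ok (C1k _ c1C).
  by case/mem_succ: (h c cC ce) => [cc1|<- //]; apply: ord_trans xc cc1.
have [c /mem_inter[/mem_sep[cC _] cd] xc] := u x xd.
by exists c => //; apply/mem_inter.
Qed.

Lemma unb_lim k Y : Y ⊆ k -> ordinal k -> unbounded k Y -> k = ∅ \/ lim k.
Proof.
move=> Yk ok u; case: (EM (k = ∅)) => [|/neq0P[x xk]]; [by left|right]; split=> //.
  exact: ord_0_mem xk.
move=> y yk; have [c /Yk ck yc] := u y yk.
have /mem_succ[h|-> //] : succ y ∈ succ c.
  apply: ord_le; [exact/ord_succ/(ord_mem ok)|exact: ord_mem ck|].
  by move/mem_succ => [/(mem_asym yc)|e] //; rewrite e in yc; case: (mem_irr yc).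
exact: ord_trans h ck.
Qed.

Lemma lim_unb k : lim k -> unbounded k k.
Proof. by move=> [_ _ ks] x /ks xk; exists (succ x) => //; apply/mem_succ; right. Qed.

Lemma not_stat k Z : lim k -> Z ⊆ k -> ~ stat k Z ->
  exists C, [/\ C ⊆ k, unbounded k C & forall y, y ∈ Z -> ~ limpt C y].
Proof.
move=> kl Zk; have ok := lim_ord kl.
move=> /not_andP[/not_unb[x xk hx]|/existsNP[C /not_implyP[Ck /not_implyP[uC h]]]].
  exists (sep k (fun c => x ∈ c)); split.
  - exact: sep_sub.
  - exact: unb_tail (lim_unb kl) xk.
  move=> y yZ [/neq0P[z zy] /(_ z zy)[c /mem_inter[/mem_sep[_ xc] cy] _]].
  by apply: (hx y yZ); apply: ord_trans xc cy; exact: ord_mem ok (Zk _ yZ).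
by exists C; split=> // y yZ l; apply: h; exists y.
Qed.

Lemma stat_or k Y Q : ordinal k -> Y ⊆ k -> stat k Y ->
  stat k (sep Y Q) \/ stat k (sep Y (fun a => ~ Q a)).
Proof.
move=> ok Yk [uY sY].
case: (unb_lim Yk ok uY) => [k0|kl].
  left; split=> [x|C Ck uC]; first by rewrite k0 => /mem_empty.
  have [y /Yk] := sY C Ck uC; by rewrite k0 => /mem_empty.
apply: contrapT => /not_orP[/(not_stat kl)[x /mem_sep[/Yk]//|C1 [C1k u1 h1]] /(not_stat kl)[x /mem_sep[/Yk]//|C2 [C2k u2 h2]]].
have [C [Ck uC hC]] := unb_limpt2 kl C1k C2k u1 u2.
have [y yY /(hC y (Yk _ yY))[l1 l2]] := sY C Ck uC.
case: (EM (Q y)) => q; [apply: h1 l1|apply: h2 l2]; exact/mem_sep.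
Qed.

(** For gluing, take a limit point [a] of [C] in [Y]: then [C ∩ a] is unbounded in [a], and
    [stat a (X ∩ a)] gives a limit point of [C] in [X]. *)
Lemma stat_largeness : largeness stat.
Proof.
split; first by move=> k Y [].
- move=> k Y Y' [u h] YY; split; first exact: unb_sub u.
  by move=> C Ck uC; have [y /YY] := h C Ck uC; exists y.
- exact: stat_or.
move=> k X Y ok Yk [uY sY] h; split.
  by apply: (lg_glue unb_largeness ok Yk uY) => a /h[].
move=> C Ck uC; have [a aY [a0 ua]] := sY C Ck uC.
have [_ /(_ (C ∩ a))[|//|y /mem_inter[yX ya] l]] := h a aY.
  by move=> x /mem_inter[].
by exists y => //; apply: limpt_sub l => x /mem_inter[].
Qed.

(** Unbounded sets [C a] whose limit points avoid [Y] cohere to one unbounded subset of [k]. It has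
    a limit point [y] in [Y], which is then a limit point of [C a] for [a ∈ H] above [y]. *)
Lemma stat_reflect k P Y T : lim k -> nfam k P -> has_branches k P ->
  thin k P T -> P T -> Y ⊆ k -> stat k Y -> (forall a, a ∈ T -> ~ stat a (Y ∩ a)) -> False.
Proof.
move=> kl nf br tT PT Yk [uY sY] hT; have ok := lim_ord kl.
case: (nf_add kl nf PT (Q1 := fun a => unbounded a (Y ∩ a)) (Q2 := fun a => ~ unbounded a (Y ∩ a)) (fun a _ => EM _)) => [PT1|PT1]; last first.
  by apply: (unb_reflect kl nf PT1 Yk uY) => a /mem_sep[].
set T1 := sep _ _ in PT1.
have /choice[C CP] : forall a, exists C, a ∈ T1 ->
    [/\ C ⊆ a, unbounded a C & forall y, y ∈ Y -> y ∈ a -> ~ limpt C y].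
  move=> a.
  case: (EM (a ∈ T1)) => [/mem_sep[aT u]|]; last by exists ∅.
  have /not_andP[//|/existsNP[C /not_implyP[Ca /not_implyP[uC h]]]] := hT a aT.
  by exists C => _; split=> // y yY ya l; apply: h; exists y => //; apply/mem_inter.
have TT : T1 ⊆ T by exact: sep_sub.
have [H [b [PH HT hb]]] := homog1 (fun a x => x ∈ C a) kl nf br PT1 (thin_sub tT TT).
have big x : x ∈ k -> exists2 a, a ∈ H & x ∈ a by move=> xk; exact: (nf_unb nf PH).
have [|y yY ly] := sY (sep k b) (@sep_sub k b).
  move=> x /big[a aH xa]; have [Ca uC _] := CP a (HT _ aH).
  have [c cC xc] := uC x xa; exists c => //; apply/mem_sep; split.
    exact: ord_trans ok (Ca _ cC) (nf_sub nf PH aH).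
  by apply/(hb a c aH) => //; apply: Ca.
have [a aH ya] := big y (Yk _ yY).
have [_ _ /(_ y yY ya)] := CP a (HT _ aH); apply.
have oa : ordinal a by apply: ord_mem ok (nf_sub nf PH aH).
case: ly => y0 uy; split=> // x /uy[c /mem_inter[/mem_sep[_ bc] cy] xc].
exists c => //; apply/mem_inter; split=> //; apply/(hb a c aH) => //.
exact: ord_trans cy ya.
Qed.

(* The Mostowski collapse of the set of ordinals [H]. *)
Definition ot (H : V) : V -> V := Vrec (fun y rec => img (H ∩ y) rec).

Lemma otE H y : ot H y = img (H ∩ y) (ot H).
Proof.
apply: VrecE => g h gh; apply: V_ext => z; rewrite !mem_img.
by split=> -[x xH ->]; exists x => //; rewrite gh //; case/mem_inter: xH.
Qed.

Section Ot.
Variables k H : V.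
Hypotheses (ok : ordinal k) (Hk : H ⊆ k).

Lemma mem_ot y z : z ∈ ot H y <-> exists x, [/\ x ∈ H, x ∈ y & z = ot H x].
Proof.
rewrite otE mem_img; split=> [[x /mem_inter[xH xy] ->]|[x [xH xy ->]]]; first by exists x.
by exists x => //; apply/mem_inter.
Qed.

Lemma ot_trans y : ordinal y -> transitive (ot H y).
Proof.
move=> oy z /mem_ot[x [xH xy ->]] w /mem_ot[x' [x'H x'x ->]]; apply/mem_ot; exists x'; split=> //.
exact: ord_trans x'x xy.
Qed.

Lemma ord_ot y : ordinal y -> ordinal (ot H y).
Proof.
move=> oy; split; first exact: ot_trans.
by move=> z /mem_ot[x [xH xy ->]]; apply: ot_trans; apply: ord_mem xy.
Qed.

Lemma ot_le y : ordinal y -> ot H y ⊆ y.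
Proof.
elim/V_ind: y => y IH oy z /mem_ot[x [xH xy ->]]; have ox := ord_mem oy xy.
have /mem_succ[h|-> //] : ot H x ∈ succ x.
  apply: ord_le => //; first exact: ord_ot.
  by move/(IH x xy ox); exact: mem_irr.
exact: ord_trans h xy.
Qed.

Lemma ord_img_ot : ordinal (img H (ot H)).
Proof.
split=> z /mem_img[x xH ->]; last by apply: ot_trans; apply: ord_mem ok (Hk xH).
by move=> w /mem_ot[x' [x'H _ ->]]; apply/mem_img; exists x'.
Qed.

Lemma equip_ot : equipotent H (img H (ot H)).
Proof.
exists (ot H); split; [by move=> x xH; apply/mem_img; exists x| |by move=> y /mem_img].
have lt x y : x ∈ H -> x ∈ y -> ot H x ∈ ot H y by move=> xH xy; apply/mem_ot; exists x.
move=> x y xH yH e.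
case: (ord_tri (ord_mem ok (Hk xH)) (ord_mem ok (Hk yH))) => // [xy|yx].
  by have := lt x y xH xy; rewrite e => /mem_irr.
by have := lt y x yH yx; rewrite e => /mem_irr.
Qed.

End Ot.

(** A set bounded by [x] collapses to an ordinal at most [succ x], which is below [k] and so not of
    size [k]. *)
Lemma equip_unb k H : cardinal k -> lim k -> H ⊆ k -> equipotent H k -> unbounded k H.
Proof.
move=> [ok ck] kl Hk eH; apply: contrapT => /not_unb[x xk hx].
pose a := img H (ot H); have ox := ord_mem ok xk.
have oa : ordinal a := ord_img_ot ok Hk.
case: (ck a); last by apply: equip_trans eH; apply: equip_sym; exact: equip_ot ok Hk.
have xxk : succ x ∈ k by case: kl => _ _; apply.
have /mem_succ[h|-> //] : a ∈ succ (succ x).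
  apply: ord_le => //; first exact: ord_succ.
  move/mem_img => [y yH e]; have oy := ord_mem ok (Hk _ yH).
  have : x ∈ y by apply: (@ot_le H _ oy); rewrite -e; apply/mem_succ; right.
  exact: hx.
exact: ord_trans h xxk.
Qed.

Lemma unb_equip k H : lim k -> reg k -> H ⊆ k -> unbounded k H -> equipotent H k.
Proof.
move=> kl kr Hk uH; have ok := lim_ord kl; pose a := img H (ot H).
have oa : ordinal a := ord_img_ot ok Hk.
have eH : equipotent H a := equip_ot ok Hk.
have /mem_succ[ak|<- //] : a ∈ succ k.
  apply: ord_le => // /mem_img[y yH e]; have yk := Hk _ yH; have oy := ord_mem ok yk.
  have : y ∈ ot H y by rewrite -e.
  by move/(@ot_le H _ oy); exact: mem_irr.
have [f [f1 f2 f3]] := equip_sym eH.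
have [|c ck h] := kr a f ak; first by move=> i /f1/Hk.
have [y yH cy] := uH c ck; have [i ia e] := f3 y yH.
by case: (mem_asym cy); rewrite e; apply: h.
Qed.

Lemma almost_ineffableE k S : infinite_cardinal k ->
  almost_ineffable k S <-> listable unbounded k S.
Proof.
move=> ki; have kl := inf_card_lim ki; case: ki => ck _.
split=> PS; have [Sk h] := PS; split=> // L /h[H [HS hH eH]]; exists H; split=> //.
  by apply: equip_unb => // x /HS/Sk.
apply: unb_equip => //; last by move=> x /HS/Sk.
exact: (listable_reg unb_largeness) PS.
Qed.

Lemma club_lim k C : ordinal k -> C ⊆ k -> unbounded k (sep k (limpt C)) -> club k (sep k (limpt C)).
Proof.
move=> ok Ck u; split=> //; first exact: sep_sub.
move=> d dk d0 ud; apply/mem_sep; split=> //; apply: limpt_limpt dk _ => //.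
Qed.

(* If the limit points of [C] are bounded, a tail of [C] is a club, and a list
   of upper bounds of the [C ∩ a] has only bounded homogeneous sets. *)
Lemma club_nolim k C x : lim k -> C ⊆ k -> unbounded k C ->
  (forall c, c ∈ sep k (limpt C) -> x ∉ c) -> x ∈ k ->
  club k (sep C (fun c => x ∈ c)) /\ forall d, d ∈ k -> ~ limpt (sep C (fun c => x ∈ c)) d.
Proof.
move=> kl Ck uC nx xk; set C' := sep _ _; have ok := lim_ord kl.
have nl d : d ∈ k -> ~ limpt C' d.
  move=> dk l; have lC : limpt C d by apply: limpt_sub l; exact: sep_sub.
  have [/neq0P[z zd] /(_ z zd)[c /mem_inter[/mem_sep[_ xc] cd] _]] := l.
  apply: (nx d); first exact/mem_sep.
  by apply: ord_trans xc cd; apply: ord_mem ok dk.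
split=> //; split; first by move=> y /mem_sep[/Ck].
  exact: unb_tail.
by move=> d dk d0 ud; case: (nl d dk).
Qed.

Lemma stationary_unb k H : lim k -> stationary k H -> unbounded k H.
Proof.
move=> kl [Hk sH] g gk; have ok := lim_ord kl.
have kk := lim_unb kl.
have [|x /mem_inter[xH /mem_sep[_ gx]]] := sH (sep k (fun x => g ∈ x)); last by exists x.
split; [exact: sep_sub|exact: unb_tail|].
move=> d dk /neq0P[z zd] u; apply/mem_sep; split=> //.
have [c /mem_inter[/mem_sep[_ gc] cd] _] := u z zd.
by apply: ord_trans gc cd; apply: ord_mem ok dk.
Qed.

Lemma ineffableE k S : lim k -> ineffable k S <-> listable stat k S.
Proof.
move=> kl; have ok := lim_ord kl.
split=> -[Sk h]; split=> // L lL; have [H [HS hH sH]] := h L lL; exists H; split=> //; last first.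
  have Hk : H ⊆ k by move=> x /HS/Sk.
  split=> // C [Ck uC cC]; have [_ /(_ C Ck uC)[y yH [y0 uy]]] := sH.
  by exists y; apply/mem_inter; split=> //; apply: cC => //; apply: Hk.
split; first exact: stationary_unb sH.
move=> C Ck uC; have [Hk sH'] := sH.
case: (EM (unbounded k (sep k (limpt C)))) => [u|/not_unb[x xk nx]].
  have [y /mem_inter[yH /mem_sep[_ l]]] := sH' _ (club_lim ok Ck u).
  by exists y.
have [cC' nl] := club_nolim kl Ck uC nx xk; set C' := sep _ _ in cC' nl.
pose R a m := m ∈ a /\ forall c, c ∈ C' -> c ∈ a -> m ∉ c.
have RP a : a ∈ k -> a <> ∅ -> R a (eps (R a)).
  move=> ak a0; apply: epsP; have /not_andP[//|/not_unb[m ma hm]] := nl a ak.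
  by exists m; split=> // c cC ca; apply: hm; apply/mem_inter.
(* Homogeneity makes one [m] the chosen bound at all later members of [H'], but a member beyond an
   element of [C'] above [m] cannot have this bound. *)
pose L' a := sep a (fun z => z = eps (R a)).
have [|H' [H'S hH' sH'']] := h L'; first by move=> a _; exact: sep_sub.
have H'k : H' ⊆ k by move=> y /H'S/Sk.
have uH' := stationary_unb kl sH''.
have k0 := lim_num 0 kl.
have [a0 a0H /mem_neq0 a00] := uH' _ k0; have a0k := H'k _ a0H.
have [m0 _] := RP a0 a0k a00; set m := eps _ in m0.
have [_ uC' _] := cC'; have mk : m ∈ k by apply: ord_trans ok m0 a0k.
have [c cC mc] := uC' m mk.
have ck : c ∈ k by apply: Ck; case/mem_sep: cC.
have [a /mem_sep[aH a0a] ca] := unb_tail kl H'k uH' a0k ck.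
have : m ∈ L' a ∩ a0 by rewrite -(hH' _ _ a0H aH a0a); apply/mem_sep.
case/mem_inter => /mem_sep[_ e] _.
have [_ /(_ c cC ca)] := RP a (H'k _ aH) (mem_neq0 a0a).
by rewrite -e.
Qed.

Lemma nowhere_saturated_listable Lg Q k : largeness Lg -> lim k ->
  (forall k Y T, lim k -> nfam k (listable Lg k) -> thin k (listable Lg k) T ->
     listable Lg k T -> Y ⊆ k -> Lg k Y -> (forall a, a ∈ T -> ~ Lg a (Y ∩ a)) -> False) ->
  (forall S, Q k S <-> listable Lg k S) -> nowhere_saturated k (ideal_of k Q).
Proof.
move=> lg kl hr QL; apply: (nowhere_saturated_thin kl (listable_nfam lg kl) QL).
by move=> S; apply: listable_not_thin.
Qed.

Theorem nowhere_saturated_almost_ineffable k : infinite_cardinal k ->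
  nowhere_saturated k (ideal_of k almost_ineffable).
Proof.
move=> ki; apply: nowhere_saturated_listable unb_largeness (inf_card_lim ki) _ (fun S => almost_ineffableE S ki).
by move=> k' Y T kl nf _ PT Yk uY h; apply: (unb_reflect kl nf PT Yk uY).
Qed.

Theorem nowhere_saturated_ineffable k : infinite_cardinal k ->
  nowhere_saturated k (ideal_of k ineffable).
Proof.
move=> ki; have kl := inf_card_lim ki.
apply: nowhere_saturated_listable stat_largeness kl _ (fun S => ineffableE S kl).
move=> k' Y T kl' nf tT PT; apply: (stat_reflect kl' nf) => //.
exact: (listable_branches stat_largeness).
Qed.

(** * Weak compactness *)

Lemma nsubsetsS m X c y : c ∈ nsubsets m X -> y ∈ X -> y ∉ c -> un c (one y) ∈ nsubsets m.+1 X.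
Proof.
move=> /mem_sep[/mem_pow cX [f [f1 f2 f3]]] yX yc; apply/mem_sep; split.
  by apply/mem_pow => x /mem_un[/cX|/mem_one ->].
pose g x := if pselect (x = y) then num m else f x.
have gy : g y = num m by rewrite /g; case: pselect.
have gc x : x ∈ c -> g x = f x by move=> xc; rewrite /g; case: pselect => // e; rewrite e in xc.
exists g; split.
- move=> x /mem_un[xc|/mem_one ->]; apply/mem_succ; [left|by right].
  by rewrite gc //; apply: f1.
- move=> x x' /mem_un[xc|/mem_one ->] /mem_un[x'c|/mem_one ->] //; rewrite ?gy ?gc //.
  + exact: f2.
  + by move=> e; have := f1 x xc; rewrite e => /mem_irr.
  + by move=> e; have := f1 x' x'c; rewrite -e => /mem_irr.
- move=> z /mem_succ[/f3[x xc ->]|->].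
    by exists x; [apply/mem_un; left|rewrite gc].
  by exists y => //; apply/mem_un; right; apply/mem_one.
Qed.

Lemma nsubsets0 X : ∅ ∈ nsubsets 0 X.
Proof.
apply/mem_sep; split; first by apply/mem_pow => x /mem_empty.
by exists id; split=> [x /mem_empty|x x' /mem_empty|x /mem_empty].
Qed.

Lemma nsubsets2 X x y : x ∈ X -> y ∈ X -> x <> y -> two x y ∈ nsubsets 2 X.
Proof.
move=> xX yX xy.
have -> : two x y = un (un ∅ (one x)) (one y).
  apply: V_ext => z; rewrite mem_two !mem_un !mem_one.
  by split=> [[]|[[/mem_empty|]|]]; tauto.
apply: nsubsetsS => //; first by apply: nsubsetsS => //; [exact: nsubsets0|exact: mem_empty].
by case/mem_un => [/mem_empty //|/mem_one e]; apply: xy.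
Qed.

Section WC.
Variable k : V.
Hypothesis wc : weakly_compact k.

Let kl : lim k.
Proof.
case: wc => -[ck wk] _; apply: inf_card_lim; split=> // x xo.
by apply: ord_trans xo wk; case: ck.
Qed.

Let ok := lim_ord kl.

Lemma wc_hom (f : V -> Prop) : exists H, [/\ H ⊆ k, unbounded k H, equipotent H k &
  (forall x y, x ∈ H -> y ∈ H -> x ∈ y -> f (two x y)) \/
  (forall x y, x ∈ H -> y ∈ H -> x ∈ y -> ~ f (two x y))].
Proof.
case: wc => -[ck _] /(_ (fun s => `[<f s>]))[H [Hk eH hH]].
have uH : unbounded k H by exact: equip_unb.
exists H; split=> //.
have ne x y : x ∈ y -> x <> y by move=> xy e; rewrite e in xy; case: (mem_irr xy).
have key x y x' y' : x ∈ H -> y ∈ H -> x ∈ y -> x' ∈ H -> y' ∈ H -> x' ∈ y' -> f (two x y) -> f (two x' y').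
  move=> xH yH xy x'H y'H x'y'.
  have E : `[<f (two x y)>] = `[<f (two x' y')>]; last by case: (asbool_eq_equiv E).
  by apply: hH; apply: nsubsets2 => //; apply: ne.
case: (EM (exists x y, [/\ x ∈ H, y ∈ H, x ∈ y & f (two x y)])).
  by move=> [x [y [xH yH xy h]]]; left=> x' y' x'H y'H x'y'; apply: key h.
by move=> h; right=> x y xH yH xy fxy; apply: h; exists x, y.
Qed.

(** Let [f] on [a] be unbounded and [m x] an index with [f (m x)] not below [x]. If [m] is constant
    on a homogeneous set, the set is bounded by [f (m x)]; if [m] is injective there, a set of size
    [k] is included in [a]. *)
Lemma wc_reg : reg k.
Proof.
move=> a f ak fk; apply: contrapT => nb; have oa := ord_mem ok ak.
pose m x := eps (fun i => i ∈ a /\ f i ∉ x).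
have mP x : x ∈ k -> m x ∈ a /\ f (m x) ∉ x.
  move=> xk; apply: (epsP (P := fun i => i ∈ a /\ f i ∉ x)); apply: contrapT => h.
  by apply: nb; exists x => // i ia; apply: contrapT => fx; apply: h; exists i.
have [H [Hk uH eH]] := wc_hom (fun s => forall x y, x ∈ s -> y ∈ s -> m x = m y).
have tl x y : x ∈ two x y by apply/mem_two; left.
have tr x y : y ∈ two x y by apply/mem_two; right.
case=> [h|h].
  have [x xH _] := uH _ (lim_num 0 kl); have [mxa _] := mP x (Hk _ xH).
  have fmk := fk _ mxa.
  have [y yH hy] := uH _ (lim_max kl fmk (Hk _ xH)); have oy := ord_mem ok (Hk _ yH).
  have lt v : v ∈ succ (un (f (m x)) x) -> v ∈ y by case/mem_succ => [h'|-> //]; apply: ord_trans h' hy.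
  have ofm := ord_mem ok fmk; have ox := ord_mem ok (Hk _ xH).
  have xy : x ∈ y by apply: lt; apply: maxr.
  have [_] := mP y (Hk _ yH); rewrite -(h x y xH yH xy x y (tl _ _) (tr _ _)).
  by apply; apply: lt; apply: maxl.
have minj x y : x ∈ H -> y ∈ H -> m x = m y -> x = y.
  have ne x' y' : x' ∈ H -> y' ∈ H -> m x' = m y' -> x' ∉ y'.
    move=> xH yH e xy; apply: (h x' y' xH yH xy).
    by move=> u v /mem_two[] -> /mem_two[] ->.
  move=> xH yH e; case: (ord_tri (ord_mem ok (Hk _ xH)) (ord_mem ok (Hk _ yH))) => // xy.
    by case: (ne x y).
  by case: (ne y x).
have eZ : equipotent (img H m) k.
  apply: equip_trans eH; apply: equip_sym; exists m; split=> //.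
    by move=> x xH; apply/mem_img; exists x.
  by move=> y /mem_img.
have Za z : z ∈ img H m -> z ∈ a by move=> /mem_img[x /Hk/mP[mxa _] ->].
have [[ck _] _] := wc.
have [|c /Za ca ac] := equip_unb ck kl _ eZ ak; last by case: (mem_asym ca).
by move=> z /Za za; apply: ord_trans za ak.
Qed.

(** By induction and regularity the values below [xi] are settled beyond some [g]. From there on
    [R x xi] is monotone in [x], hence constantly true after its first truth or false throughout. *)
Lemma stabilises H (R : V -> V -> Prop) : H ⊆ k -> unbounded k H ->
  (forall x y d, x ∈ H -> y ∈ H -> x ∈ y -> d ∈ k ->
     (forall d', d' ∈ d -> R x d' <-> R y d') -> R x d -> R y d) ->
  forall xi, xi ∈ k -> exists2 g, g ∈ k &
    forall x y d, x ∈ H -> y ∈ H -> g ∈ x -> g ∈ y -> d ∈ succ xi -> R x d <-> R y d.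
Proof.
move=> Hk uH mono; elim/V_ind => xi IH xik.
have /choice[G GP] : forall z, exists g, z ∈ xi -> g ∈ k /\
    forall x y d, x ∈ H -> y ∈ H -> g ∈ x -> g ∈ y -> d ∈ succ z -> R x d <-> R y d.
  move=> z; case: (EM (z ∈ xi)) => [zxi|]; last by exists ∅.
  by have [g gk h] := IH z zxi (ord_trans ok zxi xik); exists g.
have [|g gk gP] := wc_reg (f := G) xik; first by move=> z /GP[].
have below x y d : x ∈ H -> y ∈ H -> g ∈ x -> g ∈ y -> d ∈ xi -> R x d <-> R y d.
  move=> xH yH gx gy dxi; have [Gk hG] := GP d dxi.
  have lt z : z ∈ H -> g ∈ z -> G d ∈ z.
    by move=> zH gz; apply: ord_trans (gP d dxi) gz; apply: ord_mem ok (Hk _ zH).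
  by apply: hG => //; [apply: lt|apply: lt|apply/mem_succ; right].
case: (EM (exists2 x, x ∈ H & g ∈ x /\ R x xi)) => [[x0 x0H [gx0 Rx0]]|no]; last first.
  exists g => // x y d xH yH gx gy /mem_succ[|->]; first exact: below.
  by split=> r; case: no; [exists x|exists y].
exists x0; first exact: Hk.
have gt x : x ∈ H -> x0 ∈ x -> g ∈ x.
  by move=> xH; apply: ord_trans gx0; apply: ord_mem ok (Hk _ xH).
have R1 x : x ∈ H -> x0 ∈ x -> R x xi.
  move=> xH x0x; apply: (mono x0 x xi) => // d dxi.
  by apply: below => //; apply: gt.
move=> x y d xH yH gx gy /mem_succ[|->]; first by apply: below => //; apply: gt.
by split=> _; apply: R1.
Qed.

(* The lexicographic comparison of the [W a] along a homogeneous set is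
   monotone, so that the initial segments of the [W a] stabilise. *)
Lemma wc_branches P : (forall X, P X -> X ⊆ k /\ unbounded k X) -> has_branches k P.
Proof.
move=> Pu X W /Pu[Xk uX].
(* Homogeneous sets are subsets of [k], not of [X]; [e] carries them over to [X]. *)
pose e xi := eps (fun a => a ∈ X /\ xi ∈ a).
have eP xi : xi ∈ k -> e xi ∈ X /\ xi ∈ e xi.
  move=> xik; apply: (epsP (P := fun a => a ∈ X /\ xi ∈ a)).
  by have [a aX xia] := uX _ xik; exists a.
pose U x d := W (e x) d.
pose lex x y := exists2 d, d ∈ k & [/\ forall d', d' ∈ d -> U x d' <-> U y d', ~ U x d & U y d].
have [H [Hk uH _ hH]] := wc_hom (fun s => exists x y, [/\ x ∈ s, y ∈ s, x ∈ y & lex x y]).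
have stab xi : xi ∈ k -> exists2 g, g ∈ k &
    forall x y d, x ∈ H -> y ∈ H -> g ∈ x -> g ∈ y -> d ∈ succ xi -> U x d <-> U y d.
  move=> xik; case: hH => [hH|hH].
    apply: (stabilises Hk uH) => // x y d xH yH xy dk ag Ux.
    have [u [v [/mem_two u2 /mem_two v2 uv [d' d'k [ag' nU U']]]]] := hH x y xH yH xy.
    have [eu ev] : u = x /\ v = y.
      case: u2 v2 uv => -> [] -> // h; try by case: (mem_irr h).
      by case: (mem_asym xy).
    subst u v.
    case: (ord_tri (ord_mem ok dk) (ord_mem ok d'k)) => [/ag' h|-> //|/ag h]; first exact/h.
    by case: nU; apply/h.
  (* On a homogeneous set without lexicographic increase, it is the complements that are
     monotone. *)
  have [|g gk h] := stabilises (R := fun x d => ~ U x d) Hk uH _ xik; last first.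
    by exists g => // x y d xH yH gx gy dxi; apply/iff_not2; apply: h.
  move=> x y d xH yH xy dk ag nU Uy; apply: (hH x y xH yH xy).
  exists x, y; split; [by apply/mem_two; left|by apply/mem_two; right|exact: xy|].
  exists d => //; split=> // d' d'd; apply/iff_not2; exact: ag.
have above g g' : g ∈ k -> g' ∈ k -> exists x, [/\ x ∈ H, g ∈ x & g' ∈ x].
  by move=> gk g'k; have [x /mem_sep[xH gx] g'x] := unb_tail kl Hk uH gk g'k; exists x.
exists (fun d => exists2 x0, x0 ∈ k & forall x, x ∈ H -> x0 ∈ x -> U x d) => xi xik.
have [g gk gP] := stab xi xik; have [x [xH gx xix]] := above _ _ gk xik.
have [eX xe] := eP x (Hk _ xH).
exists (e x); split=> //; first by apply: ord_trans xix xe; apply: ord_mem ok (Xk _ eX).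
apply/agree_eqK => d dxi; split=> [Wd|[x0 x0k h]].
  by exists g => // y yH gy; apply/(gP x y d xH yH gx gy dxi).
have [y [yH gy x0y]] := above _ _ gk x0k.
by apply/(gP x y d xH yH gx gy dxi); apply: h.
Qed.

End WC.

(** * Subtle sets *)

Lemma club_tail k C g : lim k -> club k C -> g ∈ k -> club k (sep C (fun c => g ∈ c)).
Proof.
move=> kl [Ck uC cC] gk; split; first by move=> x /mem_sep[/Ck].
  exact: unb_tail.
move=> d dk d0 u; have [z zd] := neq0P d0; apply/mem_sep; split.
  by apply: cC => //; apply: unb_sub u => x /mem_inter[/mem_sep[xC _] xd]; apply/mem_inter.
have [c /mem_inter[/mem_sep[_ gc] cd] _] := u z zd.
by apply: ord_trans gc cd; apply: ord_mem (lim_ord kl) dk.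
Qed.

Lemma club_closed k G : lim k -> reg k -> omega ∈ k -> (forall x, x ∈ k -> G x ∈ k) ->
  club k (sep k (fun a => forall x, x ∈ a -> G x ∈ a)).
Proof.
move=> kl kr wk Gk; have ok := lim_ord kl; have [_ _ ks] := kl; split.
- exact: sep_sub.
- move=> x xk; pose c n := iter n (fun y => un (succ y) (cup (succ y) (fun z => succ (G z)))) (succ x).
  have ck n : c n ∈ k.
    elim: n => [|n IH]; first exact: ks.
    apply: lim_max => //; first exact: ks.
    apply: reg_cup => //; first exact: ks.
    by move=> z zc; apply: (ks); apply: (Gk); apply: ord_trans zc (ks _ IH).
  (* Closing off takes [omega] steps; as [reg] concerns functions on members of [k], the sequence
     [c] is reindexed by [omega], where the default 0 is not reached. *)
  pose h z := c (if pselect (exists n, z = num n) is left e then sval (cid e) else 0).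
  have hE n : h (num n) = c n.
    rewrite /h; case: pselect => [e|]; last by case; exists n.
    by case: cid => m mE; rewrite [sval _]/= -(num_inj mE).
  have uk : cup omega h ∈ k by apply: reg_cup => // z _; exact: ck.
  exists (cup omega h); last first.
    apply/mem_cup; exists (num 0); first by apply/mem_omega; exists 0.
    by rewrite hE; apply/mem_succ; right.
  apply/mem_sep; split=> // y /mem_cup[z /mem_omega[n ->]]; rewrite hE => yc.
  apply/mem_cup; exists (num n.+1); first by apply/mem_omega; exists n.+1.
  rewrite hE /=; apply/mem_un; right; apply/mem_cup; exists y; first by apply/mem_succ; left.
  by apply/mem_succ; right.
- move=> d dk d0 u; apply/mem_sep; split=> // x xd.
  have [e /mem_inter[/mem_sep[_ h] ed] xe] := u x xd.
  by apply: ord_trans (h x xe) ed; apply: ord_mem ok dk.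
Qed.

Lemma clo_club k Q : lim k -> reg k -> omega ∈ k -> clo k Q ->
  exists2 C, club k C & forall a, a ∈ C -> Q a.
Proof.
move=> kl kr wk [G Gk GQ].
exists (sep (sep k (fun a => forall x, x ∈ a -> G x ∈ a)) (fun a => ∅ ∈ a)).
  by apply: club_tail => //; [exact: club_closed|exact: lim_num 0 kl].
by move=> a /mem_sep[/mem_sep[ak h] /mem_neq0 a0]; apply: GQ.
Qed.

Lemma subtle_up k S S' : subtle k S -> S ⊆ S' -> S' ⊆ k -> subtle k S'.
Proof.
move=> [Sk h] SS S'k; split=> // L C lL cC.
have [|a [b [/mem_inter[aS aC] /mem_inter[bS bC] ab e]]] := h L C _ cC; first by move=> a /SS/lL.
by exists a, b; split=> //; apply/mem_inter; split=> //; apply: SS.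
Qed.

Lemma not_subtle k S : S ⊆ k -> ~ subtle k S -> exists L C, [/\ is_list S L, club k C &
  forall a b, a ∈ S -> a ∈ C -> b ∈ S -> b ∈ C -> a ∈ b -> L a <> L b ∩ a].
Proof.
move=> Sk /not_andP[//|/existsNP[L /existsNP[C /not_implyP[lL /not_implyP[cC h]]]]].
exists L, C; split=> // a b aS aC bS bC ab e; apply: h; exists a, b; split=> //; exact/mem_inter.
Qed.

Lemma subtle_nfam k : lim k -> reg k -> omega ∈ k -> nfam k (subtle k).
Proof.
move=> kl kr wk; have ok := lim_ord kl; have [_ k0 ks] := kl; split.
- by move=> X [].
- by move=> X Y PX XY Yk; apply: subtle_up PX XY Yk.
- move=> X [Xk h] g gk.
  have kk : club k k by split=> //; exact: lim_unb.
  have [|a [b [/mem_inter[aX /mem_sep[_ ga]] _ _ _]]] := h (fun=> ∅) _ _ (club_tail kl kk gk).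
    by move=> a _ x /mem_empty.
  by exists a.
move=> X g c0 PX c0k ga; apply: contrapT => /forallNP nP; have [Xk hX] := PX.
pose Xc c := sep X (fun a => c0 ∈ a /\ g a = c).
have /choice[LC LCP] : forall c, exists LC : (V -> V) * V, [/\ is_list (Xc c) LC.1, club k LC.2 &
  forall a b, a ∈ Xc c -> a ∈ LC.2 -> b ∈ Xc c -> b ∈ LC.2 -> a ∈ b -> LC.1 a <> LC.1 b ∩ a].
  move=> c; have [|L [C h]] := not_subtle _ (nP c); first by move=> x /mem_sep[/Xk].
  by exists (L, C).
have LCu c : (LC c).2 ⊆ k /\ unbounded k (LC c).2 by case: (LCP c) => _ [].
(* The diagonal intersection puts each [a ∈ E] into the club belonging to its own value [g a], which
   is not known in advance. *)
have [E cE EQ] := clo_club kl kr wk (clo_and kl (clo_and kl (clo_gt c0k) (clo_gt (lim_num 1 kl)))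
  (clo_and kl (clo_pair kl kr) (clo_diag kl kr LCu))).
have EP a : a ∈ E -> [/\ ordinal a, c0 ∈ a, num 1 ∈ a, pair_closed_ord a &
    forall c, c ∈ a -> a ∈ (LC c).2].
  move=> aE; have ak : a ∈ k by case: cE => + _ _; apply.
  have [[ca a1] [pa da]] := EQ a aE; split=> //; first exact: ord_mem ak.
  move=> c /da[a0 u]; have [_ [_ _ cC] _] := LCP c; exact: cC.
pose L a := code2 a (g a) ((LC (g a)).1 a).
have [|a [b [/mem_inter[aX aE] /mem_inter[bX bE] ab e]]] := hX L E _ cE.
  by move=> a _; exact: sep_sub.
have [oa ca a1 pa aC] := EP a aE; have [ob cb b1 pb bC] := EP b bE.
have gaa := ga a aX ca; have gbb := ga b bX cb.
have aXc : a ∈ Xc (g a) by apply/mem_sep.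
have bXc : b ∈ Xc (g b) by apply/mem_sep.
have ll c x : x ∈ Xc c -> (LC c).1 x ⊆ x by case: (LCP c) => + _ _; apply.
have [ge Le] := code2_inj ob ab pa pb a1 gaa gbb (ll _ _ aXc) (ll _ _ bXc) e.
have [_ _] := LCP (g a); apply; [exact: aXc| | | |exact: ab|by rewrite Le ge].
- exact: aC.
- by rewrite ge.
- by rewrite ge; apply: bC.
Qed.

(** If [L] and [C] refute the conclusion, they do so also below each limit point [a] of [C] in [S].
    By induction [S ∩ a] is then not subtle, so [a] lies in [lacking subtle S]; subtlety of [S] on
    these limit points contradicts the choice of [L]. *)
Lemma subtle_lacking k S : ordinal k -> subtle k S -> subtle k (lacking subtle S).
Proof.
elim/V_ind: k S => k IH S ok PS; have [Sk hS] := PS.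
apply: contrapT => /not_subtle[x /mem_sep[/Sk]//|L [C [lL cC nLC]]].
have [Ck uC _] := cC.
have T0 a : a ∈ S -> limpt C a -> a ∈ lacking subtle S.
  move=> aS [a0 ua]; apply/mem_sep; split=> // sa.
  have ak := Sk _ aS; have oa := ord_mem ok ak.
  have [_ hT] : subtle a (lacking subtle S ∩ a).
    rewrite lacking_trace //; exact: IH.
  have [||x [y [/mem_inter[/mem_inter[xT xa] /mem_inter[xC _]] /mem_inter[/mem_inter[yT _] /mem_inter[yC _]] xy e]]] := hT L (C ∩ a).
  - by move=> x /mem_inter[/lL].
  - split=> //; first by move=> x /mem_inter[].
    move=> d da d0 ud; apply/mem_inter; split=> //; case: cC => _ _; apply=> //.
      exact: ord_trans ok da ak.
    by apply: unb_sub ud => x /mem_inter[/mem_inter[xC _] xd]; apply/mem_inter.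
  exact: (nLC x y).
case: (unb_lim Ck ok uC) => [k0|kl].
  have [|a [b [/mem_inter[/Sk + _]]]] := hS (fun=> ∅) C _ cC; first by move=> a _ x /mem_empty.
  by rewrite k0 => /mem_empty.
case: (EM (unbounded k (sep k (limpt C)))) => [u|/not_unb[x xk nx]].
  pose L' a := if pselect (a ∈ lacking subtle S) then L a else ∅.
  have [|a [b [/mem_inter[aS /mem_sep[ak la]] /mem_inter[bS /mem_sep[bk lb]] ab]]] := hS L' _ _ (club_lim ok Ck u).
    by move=> a aS; rewrite /L'; case: pselect => [h|h x /mem_empty //]; exact: lL.
  have aT := T0 a aS la; have bT := T0 b bS lb.
  have cl d : d ∈ k -> limpt C d -> d ∈ C by case: cC => _ _ h dk [d0 ud]; apply: h.
  by rewrite /L'; case: pselect => // ?; case: pselect => // ?; apply: nLC => //; apply: cl.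
(* With bounded limit points, a list of bounds of [C' ∩ a] is used: coherent entries at [a ∈ b] in
   [C'] give a bound of [C' ∩ b] below [a], though [a] belongs to [C' ∩ b]. *)
have [cC' nl] := club_nolim kl Ck uC nx xk; set C' := sep _ _ in cC' nl.
pose R a m := m ∈ a /\ forall c, c ∈ C' -> c ∈ a -> m ∉ c.
have RP a : a ∈ k -> a <> ∅ -> R a (eps (R a)).
  move=> ak a0; apply: epsP; have /not_andP[//|/not_unb[m ma hm]] := nl a ak.
  by exists m; split=> // c cC0 ca; apply: hm; apply/mem_inter.
pose L' a := sep a (fun z => z = eps (R a)).
have [|a [b [/mem_inter[aS aC] /mem_inter[bS bC] ab e]]] := hS L' _ _ cC'.
  by move=> a _; exact: sep_sub.
have C'k : C' ⊆ k by case: cC'.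
have a0 : a <> ∅ by have /mem_sep[_ /mem_neq0] := aC.
have [ma _] := RP a (C'k _ aC) a0.
have [_ mb] := RP b (C'k _ bC) (mem_neq0 ab).
have : eps (R a) ∈ L' b ∩ a by rewrite -e; apply/mem_sep.
case/mem_inter => /mem_sep[_ e'] _; apply: (mb a aC ab).
by rewrite -e'.
Qed.

Lemma subtle_not_thin k S : lim k -> reg k -> omega ∈ k -> has_branches k (subtle k) ->
  subtle k S -> thin k (subtle k) S -> False.
Proof.
move=> kl kr wk br PS tS; have nf := subtle_nfam kl kr wk; have ok := lim_ord kl.
have [Sk hS] := PS.
have PT := subtle_lacking ok PS; set T := lacking subtle S in PT.
have TS : T ⊆ S by exact: sep_sub.
have /choice[MC MCP] : forall a, exists MC : (V -> V) * V, a ∈ T -> [/\ is_list (S ∩ a) MC.1, club a MC.2 &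
  forall x y, x ∈ S ∩ a -> x ∈ MC.2 -> y ∈ S ∩ a -> y ∈ MC.2 -> x ∈ y -> MC.1 x <> MC.1 y ∩ x].
  move=> a; case: (EM (a ∈ T)) => [/mem_sep[aS n]|]; last by exists (id, ∅).
  have [|L [C h]] := not_subtle _ n; first by move=> x /mem_inter[].
  by exists (L, C).
(* A witness is a list together with a club, so there are two homogenisations, the second inside the
   first. *)
have [H1 [b [PH1 H1T hb]]] := homog2 (fun a x y => y ∈ (MC a).1 x) kl nf br PT (thin_sub tS TS).
have [H [c [PH HH1 hc]]] := homog1 (fun a x => x ∈ (MC a).2) kl nf br PH1 (thin_sub (thin_sub tS TS) H1T).
have HT a : a ∈ H -> a ∈ T by move=> /HH1/H1T.
have big x : x ∈ k -> exists2 a, a ∈ H & x ∈ a by apply: (nf_unb nf PH).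
pose M x := sep x (b x); pose C := sep k c.
have Ca a : a ∈ H -> C ∩ a = (MC a).2.
  move=> aH; have [_ [Ca _ _] _] := MCP a (HT a aH); have ak := nf_sub nf PH aH.
  apply: V_ext => x; rewrite mem_inter mem_sep; split=> [[[xk cx] xa]|xC].
    by apply/(hc a x aH xa).
  have xa := Ca _ xC; split=> //; split; first exact: ord_trans ok xa ak.
  exact/(hc a x aH xa).
have cC : club k C.
  split; first exact: sep_sub.
    move=> x xk; have [a aH xa] := big x xk; have [_ [_ u _] _] := MCP a (HT a aH).
    have [y + xy] := u x xa; rewrite -Ca // => /mem_inter[yC _]; by exists y.
  move=> d dk d0 ud; have [a aH da] := big d dk.
  have [_ [_ _ cl] _] := MCP a (HT a aH).
  have : d ∈ (MC a).2.
    apply: cl => //; rewrite -Ca //; apply: unb_sub ud => x /mem_inter[xC xd].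
    apply/mem_inter; split=> //; apply/mem_inter; split=> //.
    by apply: ord_trans xd da; apply: ord_mem ok (nf_sub nf PH aH).
  by rewrite -Ca // => /mem_inter[].
have [|x [y [/mem_inter[xS xC] /mem_inter[yS yC] xy e]]] := hS M C _ cC; first by move=> x _; exact: sep_sub.
have [a aH ya] := big y (Sk _ yS).
have oa : ordinal a by apply: ord_mem ok (nf_sub nf PH aH).
have xa := ord_trans oa xy ya.
have [lM _ hM] := MCP a (HT a aH).
have ME z : z ∈ S -> z ∈ a -> (MC a).1 z = M z.
  move=> zS za; apply: V_ext => w; rewrite mem_sep.
  have wz : w ∈ (MC a).1 z -> w ∈ z by apply: lM; apply/mem_inter.
  have wa : w ∈ z -> w ∈ a by move=> h; apply: ord_trans h za.
  have hh h := hb a z w (HH1 _ aH) za (wa h).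
  by split=> [wM|[h /(hh h)] //]; have h := wz wM; split=> //; apply/(hh h).
apply: (hM x y _ _ _ _ xy); [exact/mem_inter| |exact/mem_inter| |by rewrite !ME].
- by rewrite -Ca //; apply/mem_inter.
- by rewrite -Ca //; apply/mem_inter.
Qed.

Theorem nowhere_saturated_subtle k : weakly_compact k -> nowhere_saturated k (ideal_of k subtle).
Proof.
move=> wc; have [[ck wk] _] := wc; have kr := wc_reg wc.
have kl : lim k by apply: inf_card_lim; split=> // x xo; apply: ord_trans xo wk; case: ck.
have nf := subtle_nfam kl kr wk.
apply: (nowhere_saturated_thin kl nf) => // S PS tS.
apply: (subtle_not_thin kl kr wk _ PS tS); apply: (wc_branches wc) => X PX.
by split; [exact: nf_sub PX|exact: nf_unb PX].
Qed.

(** * Ramsey sets *)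

Lemma eps_neq0 P : eps P <> ∅ -> P (eps P).
Proof. by rewrite /eps; case: pselect => // e _; case: cid. Qed.

Lemma is_min_uniq x y a : is_min x a -> is_min y a -> x = y.
Proof.
move=> [xa hx] [ya hy]; case: (hx y ya) => // xy; case: (hy x xa) => // yx.
by case: (mem_asym xy).
Qed.

Lemma is_min_ex k a : ordinal k -> a ⊆ k -> a <> ∅ -> exists m, is_min m a.
Proof.
move=> ok ak /neq0P[x xa].
have [m [om ma h]] := ord_least (P := fun x => x ∈ a) (ord_mem ok (ak _ xa)) xa.
exists m; split=> // y ya; case: (ord_tri om (ord_mem ok (ak _ ya))) => // [my|-> |/h //]; [by right|by left].
Qed.

Definition mn (a : V) : V := eps (fun m => is_min m a).

Lemma mnE m a : is_min m a -> mn a = m.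
Proof. by move=> h; apply: (is_min_uniq (a := a)) => //; apply: (epsP (P := fun m => is_min m a)); exists m. Qed.

Lemma fin_enum a m : equipotent a (num m) ->
  exists h : nat -> V, forall x, x ∈ a <-> exists2 i, i < m & x = h i.
Proof.
move/equip_sym => [g [g1 g2 g3]]; exists (fun i => g (num i)) => x.
split=> [/g3[z /mem_num[i im ->] ->]|[i im ->]]; first by exists i.
by apply: g1; apply: num_lt.
Qed.

Lemma fin_bounded k s m : lim k -> equipotent s (num m) -> s ⊆ k -> exists2 g, g ∈ k & s ⊆ g.
Proof.
move=> kl /fin_enum[h hs] sk; have ok := lim_ord kl; have [_ k0 ks] := kl.
suff [g gk gP] : exists2 g, g ∈ k & forall i, i < m -> h i ∈ g.
  by exists g => // x /hs[i im ->]; apply: gP.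
have hk i : i < m -> h i ∈ k by move=> im; apply: sk; apply/hs; exists i.
elim: m hk {hs} => [|m IH] hk; first by exists ∅.
have [i im|g gk gP] := IH; first by apply: hk; apply: ltnW.
have hmk := hk m (ltnSn m); have og := ord_mem ok gk; have oh := ord_mem ok hmk.
exists (succ (un g (h m))); first by apply: (ks); apply: lim_max.
move=> i; rewrite ltnS leq_eqVlt => /orP[/eqP ->|im]; first exact: maxr.
have ou : ordinal (succ (un g (h m))) by apply: ord_succ; apply: ord_max.
exact: ord_trans ou (gP i im) (maxl og oh).
Qed.

Lemma nsubsets_empty m X Y a b : a ∈ nsubsets m X -> b ∈ nsubsets m Y -> a = ∅ -> b = ∅.
Proof.
move=> /mem_sep[_ [f [_ _ f3]]] /mem_sep[_ [g [g1 _ _]]] a0.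
apply: contrapT => /neq0P[x xb]; have [y] := f3 _ (g1 _ xb).
by rewrite a0 => /mem_empty.
Qed.

Lemma nsubsets_sub m X Y a : a ∈ nsubsets m X -> (forall x, x ∈ a -> x ∈ Y) -> a ∈ nsubsets m Y.
Proof. by move=> /mem_sep[_ e] h; apply/mem_sep; split=> //; apply/mem_pow. Qed.

Lemma nsubsetsP m X a : a ∈ nsubsets m X -> a ⊆ X /\ equipotent a (num m).
Proof. by move=> /mem_sep[/mem_pow]. Qed.

(** Leaving the values at sets with minimum [∅] free removes [k] from the notion, so that it passes
    to [S ∩ a] unchanged. *)
Definition regr (S : V) (f : V -> V) : Prop :=
  forall a m, a ⊆ S -> is_min m a -> m <> ∅ -> f a ∈ m.

Definition const_on (f : V -> V) (H : V) : Prop :=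
  forall m a b, a ∈ nsubsets m H -> b ∈ nsubsets m H -> f a = f b.

Definition ramsey_unb (k S : V) : Prop :=
  S ⊆ k /\ forall f, regr S f -> exists H, [/\ H ⊆ S, unbounded k H & const_on f H].

Lemma ramsey_up k S S' : ramsey_unb k S -> S ⊆ S' -> S' ⊆ k -> ramsey_unb k S'.
Proof.
move=> [Sk h] SS S'k; split=> // f rf.
have [|H [HS uH cH]] := h f; first by move=> a m aS; apply: rf => x /aS/SS.
by exists H; split=> // x /HS/SS.
Qed.

Lemma not_ramsey k S : S ⊆ k -> ~ ramsey_unb k S -> exists f, regr S f /\
  forall H, H ⊆ S -> unbounded k H -> ~ const_on f H.
Proof.
move=> Sk /not_andP[//|/existsNP[f /not_implyP[rf h]]].
by exists f; split=> // H HS uH cH; apply: h; exists H.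
Qed.

Lemma ramsey_or k S Q : ordinal k -> ramsey_unb k S ->
  ramsey_unb k (sep S Q) \/ ramsey_unb k (sep S (fun a => ~ Q a)).
Proof.
move=> ok [Sk h]; apply: contrapT => /not_orP[].
move=> /not_ramsey[x /mem_sep[/Sk]//|f1 [r1 n1]] /not_ramsey[x /mem_sep[/Sk]//|f2 [r2 n2]].
pose f a := if pselect (a ⊆ sep S Q) then f1 a
  else if pselect (a ⊆ sep S (fun a => ~ Q a)) then f2 a else ∅.
have [|H [HS uH cH]] := h f.
  move=> a m aS ma m0; rewrite /f; case: pselect => h1; first exact: r1.
  case: pselect => h2; first exact: r2.
  have [x xm] := neq0P m0; apply: ord_0_mem xm.
  by apply: ord_mem ok _; case: ma => /aS/Sk.
have Hk : H ⊆ k by move=> x /HS/Sk.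
case: (unb_or Q ok Hk uH) => u; [apply: n1 u _|apply: n2 u _].
- by move=> x /mem_sep[/HS xS q]; apply/mem_sep.
- move=> m a b aH bH.
  have sub c : c ∈ nsubsets m (sep H Q) -> f c = f1 c /\ c ∈ nsubsets m H.
    move=> cH'; have [cQ _] := nsubsetsP cH'; split; last first.
      by apply: nsubsets_sub cH' _ => x /cQ/mem_sep[].
    by rewrite /f; case: pselect => // -[] x /cQ/mem_sep[/HS xS q]; apply/mem_sep.
  have [<- aH'] := sub a aH; have [<- bH'] := sub b bH; exact: cH aH' bH'.
- by move=> x /mem_sep[/HS xS q]; apply/mem_sep.
(* The empty set is a subset of both parts and [f] follows [f1] there, so it is treated apart. *)
- move=> m a b aH bH; case: (EM (a = ∅)) => [a0|a0].
    by rewrite a0 (nsubsets_empty aH bH a0).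
  have b0 : b <> ∅ by move=> /(nsubsets_empty bH aH).
  have sub c : c <> ∅ -> c ∈ nsubsets m (sep H (fun a => ~ Q a)) -> f c = f2 c /\ c ∈ nsubsets m H.
    move=> /neq0P[z zc] cH'; have [cQ _] := nsubsetsP cH'; split; last first.
      by apply: nsubsets_sub cH' _ => x /cQ/mem_sep[].
    rewrite /f; case: pselect => [h1|?].
      by have /mem_sep[_ nq] := cQ _ zc; have /mem_sep[] := h1 _ zc.
    by case: pselect => // -[] x /cQ/mem_sep[/HS xS q]; apply/mem_sep.
  have [<- aH'] := sub a a0 aH; have [<- bH'] := sub b b0 bH; exact: cH aH' bH'.
Qed.

(* Three subsets of an ordinal cannot first differ pairwise at the same place. *)
Lemma ramsey_list k S W : ordinal k -> ramsey_unb k S ->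
  exists H, [/\ H ⊆ S, unbounded k H &
    forall a b x, a ∈ H -> b ∈ H -> a ∈ b -> x ∈ a -> x <> ∅ -> W a x <-> W b x].
Proof.
move=> ok [Sk h].
pose R s d := exists a b, [/\ a ∈ s, b ∈ s, a ∈ b & [/\ d ∈ a, d <> ∅ & ~ (W a d <-> W b d)]].
(* A place of difference, with [∅] signalling that there is none; this is why the place [∅] is left
   out of [R] and of the conclusion. *)
pose f s := if pselect (eps (R s) ∈ mn s) then eps (R s) else ∅.
have [|H [HS uH cH]] := h f.
  move=> s m sS ms m0; rewrite /f (mnE ms); case: pselect => // ?.
  have [x xm] := neq0P m0; apply: ord_0_mem xm.
  by apply: ord_mem ok _; case: ms => /sS/Sk.
exists H; split=> // a b x aH bH ab xa x0; apply: contrapT => ne.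
have min2 u v : u ∈ v -> is_min u (two u v).
  by move=> uv; split=> [|y /mem_two[->|->]]; [apply/mem_two; left|left|right].
have R2 u v d : u ∈ v -> R (two u v) d -> [/\ d ∈ u, d <> ∅ & ~ (W u d <-> W v d)].
  move=> uv [u' [v' [/mem_two[->|->] /mem_two[->|->] u'v' hd]]] //.
  - by case: (mem_irr u'v').
  - by case: (mem_asym uv).
  - by case: (mem_irr u'v').
have /epsP Re : exists d, R (two a b) d.
  by exists x; exists a, b; split=> //; apply/mem_two; [left|right].
have [va v0 _] := R2 _ _ _ ab Re.
have fab : f (two a b) = eps (R (two a b)).
  by rewrite /f (mnE (min2 _ _ ab)); case: pselect.
have key u v : u ∈ H -> v ∈ H -> u ∈ v -> ~ (W u (eps (R (two a b))) <-> W v (eps (R (two a b)))).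
  move=> uH1 vH uv; have ne2 y z : y ∈ z -> y <> z by move=> yz e; rewrite e in yz; case: (mem_irr yz).
  have E : f (two u v) = eps (R (two a b)).
    by rewrite -fab; apply: (cH 2); apply: nsubsets2 => //; apply: ne2.
  move: E; rewrite /f; case: pselect => [? /= E|? /= E]; last by case: v0; rewrite -E.
  have : R (two u v) (eps (R (two u v))) by apply: eps_neq0; rewrite E.
  by rewrite E => /(R2 _ _ _ uv)[].
have [c cH' bc] := uH b (Sk _ (HS _ bH)).
have ac : a ∈ c by apply: ord_trans ab bc; apply: ord_mem ok (Sk _ (HS _ cH')).
have := key _ _ aH bH ab; have := key _ _ aH cH' ac; have := key _ _ bH cH' bc.
by case: (EM (W a (eps (R (two a b))))); case: (EM (W b (eps (R (two a b))))); case: (EM (W c (eps (R (two a b))))); tauto.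
Qed.

Definition nonmax (a : V) : V := sep a (fun x => exists2 y, y ∈ a & x ∈ y).

Lemma nonmax_one x : nonmax (one x) = ∅.
Proof.
apply: V_ext => y; rewrite mem_sep; split=> [[/mem_one -> [z /mem_one ->]]|/mem_empty //].
by move/mem_irr.
Qed.

Lemma nonmax_add a y : (forall x, x ∈ a -> x ∈ y) -> nonmax (un a (one y)) = a.
Proof.
move=> ay; apply: V_ext => x; rewrite mem_sep; split=> [[/mem_un[//|/mem_one ->]]|xa].
  move=> [z /mem_un[za|/mem_one ->]]; last by move/mem_irr.
  by move=> yz; case: (mem_asym yz); apply: ay.
by split; [apply/mem_un; left|exists y; [apply/mem_un; right; apply/mem_one|exact: ay]].
Qed.

Lemma is_min_add a y m : (forall x, x ∈ a -> x ∈ y) -> is_min m a -> is_min m (un a (one y)).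
Proof.
move=> ay [ma h]; split; first by apply/mem_un; left.
by move=> x /mem_un[/h //|/mem_one ->]; right; apply: ay.
Qed.

Lemma is_min_one x : is_min x (one x).
Proof. by split=> [|y /mem_one ->]; [apply/mem_one|left]. Qed.

(* The colouring [a |-> g (min a)] of singletons is joined with a colouring [fc]
   of the fibre by giving [a] the [fc]-colour of [a] without its maximum. *)
Lemma ramsey_nfam k : lim k -> nfam k (ramsey_unb k).
Proof.
move=> kl; have ok := lim_ord kl; have [_ k0 ks] := kl; split.
- by move=> X [].
- by move=> X Y PX XY Yk; apply: ramsey_up PX XY Yk.
- move=> X [Xk h]; have [|H [HX uH _]] := h (fun=> ∅); last exact: unb_sub uH.
  move=> a m aX [/aX/Xk mk _] /neq0P[x]; apply: ord_0_mem; exact: ord_mem mk.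
move=> X g c0 [Xk hX] c0k ga; apply: contrapT => /forallNP nP.
pose Xc c := sep X (fun a => c0 ∈ a /\ g a = c).
have /choice[fc fcP] : forall c, exists f, regr (Xc c) f /\
    forall H, H ⊆ Xc c -> unbounded k H -> ~ const_on f H.
  by move=> c; apply: not_ramsey (nP c) => x /mem_sep[/Xk].
pose v a := if pselect (nonmax a = ∅) then g (mn a) else fc (g (mn a)) (nonmax a).
pose f a := if pselect (v a ∈ mn a) then v a else ∅.
have [|H [HX uH cH]] := hX f.
  move=> a m aX ma m0; rewrite /f (mnE ma); case: pselect => // ?.
  have [x xm] := neq0P m0; apply: ord_0_mem xm.
  by apply: ord_mem ok _; case: ma => /aX/Xk.
have Hk : H ⊆ k by move=> x /HX/Xk.
pose H1 := sep H (fun a => c0 ∈ a).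
have uH1 : unbounded k H1 by apply: unb_tail.
have H1X a : a ∈ H1 -> [/\ a ∈ H, a ∈ X, c0 ∈ a & g a ∈ a].
  by move=> /mem_sep[aH ca]; split=> //; [exact: HX|apply: ga => //; exact: HX].
have f1 a : a ∈ H1 -> f (one a) = g a.
  move=> /H1X[_ _ _ gaa].
  have va : v (one a) = g a by rewrite /v nonmax_one (mnE (is_min_one a)); case: pselect.
  by rewrite /f va (mnE (is_min_one a)); case: pselect.
have one1 a : a ∈ H -> one a ∈ nsubsets 1 H.
  move=> aH; have -> : one a = un ∅ (one a).
    apply: V_ext => x; rewrite mem_un; split; [by right|by case=> // /mem_empty].
  by apply: nsubsetsS => //; [exact: nsubsets0|exact: mem_empty].
have [a0 a0H _] := uH1 _ k0.
have gc a : a ∈ H1 -> g a = g a0.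
  move=> aH; rewrite -!f1 //; apply: (cH 1); apply: one1; [by case: (H1X a aH)|by case: (H1X a0 a0H)].
have H1c : H1 ⊆ Xc (g a0).
  by move=> a aH; have [_ aX ca _] := H1X a aH; apply/mem_sep; split=> //; split=> //; apply: gc.
apply: ((fcP (g a0)).2 H1 H1c uH1) => m a b aH bH.
case: (EM (a = ∅)) => [a00|a00]; first by rewrite a00 (nsubsets_empty aH bH a00).
have b00 : b <> ∅ by move=> /(nsubsets_empty bH aH).
(* Appending a late [y'] makes [c] the part without the maximum, so constancy of [f] at size [m.+1]
   gives that of [fc (g a0)] at size [m]. *)
have key c : c <> ∅ -> c ∈ nsubsets m H1 -> exists2 y, y ∈ k & forall y', y' ∈ H1 -> y ∈ y' ->
    un c (one y') ∈ nsubsets m.+1 H /\ f (un c (one y')) = fc (g a0) c.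
  move=> c00 cH1; have [cHs eq] := nsubsetsP cH1.
  have ck : c ⊆ k by move=> x /cHs/H1X[/Hk].
  have [y yk cy] := fin_bounded kl eq ck; exists y => // y' y'H yy'.
  have [y'H' _ _ _] := H1X y' y'H; have oy' := ord_mem ok (Hk _ y'H').
  have cy' x : x ∈ c -> x ∈ y' by move=> /cy xy; apply: ord_trans xy yy'.
  split.
    apply: nsubsetsS => //; last by move/cy'/mem_irr.
    by apply: nsubsets_sub cH1 _ => x /cHs/H1X[].
  have [m0 ms] := is_min_ex ok ck c00; have m0c : m0 ∈ c by case: ms.
  have ms' := is_min_add cy' ms.
  have vE : v (un c (one y')) = fc (g a0) c.
    by rewrite /v nonmax_add // (mnE ms'); case: pselect => // ?; rewrite gc //; apply: cHs.
  rewrite /f vE (mnE ms'); case: pselect => // -[]; apply: (fcP (g a0)).1 ms _.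
    by move=> x /cHs/H1c.
  by have [_ _ /mem_neq0] := H1X _ (cHs _ m0c).
have [ya yak hya] := key a a00 aH; have [yb ybk hyb] := key b b00 bH.
have [y /mem_sep[yH1 yay] yby] := unb_tail kl (fun x h => Hk _ (sep_sub h)) uH1 yak ybk.
have [na <-] := hya y yH1 yay; have [nb <-] := hyb y yH1 yby.
exact: cH na nb.
Qed.

Lemma ramsey_branches k : lim k -> has_branches k (ramsey_unb k).
Proof.
move=> kl X W PX; have ok := lim_ord kl; have nf := ramsey_nfam kl.
(* [ramsey_list] says nothing at the place [∅], so membership of [∅] is settled first. *)
have [Y [PY YX Yc]] : exists Y, [/\ ramsey_unb k Y, Y ⊆ X & forall a b, a ∈ Y -> b ∈ Y -> W a ∅ <-> W b ∅].
  case: (ramsey_or (fun a => W a ∅) ok PX) => PY; [exists (sep X (fun a => W a ∅))|exists (sep X (fun a => ~ W a ∅))];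
    split=> // [x /mem_sep[] //|a b /mem_sep[_ h1] /mem_sep[_ h2]]; by split.
have [H [HY uH hH]] := ramsey_list W ok PY; have Yk := nf_sub nf PY.
exists (fun x => exists a, [/\ a ∈ H, x ∈ a & W a x]) => xi xik.
have [a aH xia] := uH _ xik; have oa := ord_mem ok (Yk _ (HY _ aH)).
exists a; split=> //; first by apply: YX; apply: HY.
apply/agree_eqK => x xxi; have xa : x ∈ a by case/mem_succ: xxi => [h'|-> //]; apply: ord_trans h' xia.
split=> [Wa|[b [bH xb Wb]]]; first by exists a.
case: (EM (x = ∅)) => [x0|x0]; first by rewrite x0 in Wb *; apply/(Yc a b); rewrite ?Wb //; apply: HY.
case: (ord_tri oa (ord_mem ok (Yk _ (HY _ bH)))) => [ab|-> //|ba]; first exact/(hH a b x).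
exact/(hH b a x).
Qed.

(** As for lists, with [ramsey_list] making the homogeneous sets [X a] coherent away from [∅]. Their
    union is homogeneous because two finite subsets of it lie in a common [X a]. *)
Lemma ramsey_lacking k S : ordinal k -> ramsey_unb k S -> ramsey_unb k (lacking ramsey_unb S).
Proof.
elim/V_ind: k S => k IH S ok PS; have [Sk hS] := PS.
case: (ramsey_or (fun a => ~ ramsey_unb a (S ∩ a)) ok PS) => // PS0.
set S0 := sep _ _ in PS0; split=> [x /mem_sep[/Sk] //|f rf].
have /choice[X XP] : forall a, exists X, a ∈ S0 -> [/\ X ⊆ lacking ramsey_unb S ∩ a, unbounded a X & const_on f X].
  move=> a; case: (EM (a ∈ S0)) => [/mem_sep[aS /contrapT Pa]|]; last by exists ∅.
  have ak := Sk _ aS; have oa := ord_mem ok ak.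
  have [_ /(_ f)[]] : ramsey_unb a (lacking ramsey_unb S ∩ a).
    rewrite lacking_trace //; exact: IH.
  - by move=> s m sT; apply: rf => x /sT /mem_inter[].
  - by move=> X hX; exists X.
have [Y [YS uY hY]] := ramsey_list (fun a x => x ∈ X a) ok PS0.
have Yk : Y ⊆ k by move=> x /YS/mem_sep[/Sk].
have YX a : a ∈ Y -> [/\ X a ⊆ lacking ramsey_unb S ∩ a, unbounded a (X a) & const_on f (X a)] by move/YS/XP.
pose U := sep k (fun x => x <> ∅ /\ exists2 a, a ∈ Y & x ∈ X a).
have UX a x : a ∈ Y -> x ∈ a -> x ∈ U -> x ∈ X a.
  move=> aY xa /mem_sep[_ [x0 [b bY xb]]].
  have [Xb _ _] := YX b bY; have /mem_inter[_ xb'] := Xb _ xb.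
  case: (ord_tri (ord_mem ok (Yk _ aY)) (ord_mem ok (Yk _ bY))) => [ab|-> //|ba].
    exact/(hY a b x).
  exact/(hY b a x).
have Uk : U ⊆ k by exact: sep_sub.
have uU : unbounded k U.
  move=> x xk; have [a aY xa] := uY x xk; have [Xa uXa _] := YX a aY.
  have [y yX xy] := uXa x xa; exists y => //; have /mem_inter[_ ya] := Xa _ yX.
  apply/mem_sep; split; first exact: ord_trans ok ya (Yk _ aY).
  by split; [exact: mem_neq0 xy|exists a].
exists U; split=> //.
  by move=> x /mem_sep[_ [_ [a aY xa]]]; have [Xa _ _] := YX a aY; have /mem_inter[] := Xa _ xa.
move=> m s t sU tU; have [sk es] := nsubsetsP sU; have [tk et] := nsubsetsP tU.
case: (unb_lim Uk ok uU) => [k0|kl].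
  have e0 u : u ⊆ U -> u = ∅.
    by move=> uU'; apply: contrapT => /neq0P[x /uU'/Uk]; rewrite k0 => /mem_empty.
  by rewrite (e0 s) // (e0 t).
have [g gk sg] := fin_bounded kl es (fun x h => Uk _ (sk _ h)).
have [g' g'k tg] := fin_bounded kl et (fun x h => Uk _ (tk _ h)).
have [a /mem_sep[aY ga] g'a] := unb_tail kl Yk uY gk g'k.
have oa := ord_mem ok (Yk _ aY); have [_ _ c] := YX a aY.
apply: (c m).
  apply: nsubsets_sub sU _ => x xs; apply: UX => //; last exact: sk.
  exact: ord_trans oa (sg _ xs) ga.
apply: nsubsets_sub tU _ => x xs; apply: UX => //; last exact: tk.
exact: ord_trans oa (tg _ xs) g'a.
Qed.

(** * Ordinal codes of finite sets of ordinals *)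

Fixpoint seqcode (h : nat -> V) (m : nat) : V :=
  if m is n.+1 then succ (pair (h n) (seqcode h n)) else ∅.

Definition enumerates (s : V) (p : (nat -> V) * nat) : Prop :=
  forall x, x ∈ s <-> exists2 i, i < p.2 & x = p.1 i.

(** The code depends on a chosen enumeration, but the enumeration can be read off the code, which
    makes it injective on finite sets of ordinals. *)
Definition code (s : V) : V :=
  if pselect (exists p, enumerates s p) is left e then seqcode (sval (cid e)).1 (sval (cid e)).2 else ∅.

Lemma succ_inj x y : ordinal x -> ordinal y -> succ x = succ y -> x = y.
Proof.
move=> ox oy e.
have /mem_succ[xy|//] : x ∈ succ y by rewrite -e; apply/mem_succ; right.
have /mem_succ[yx|//] : y ∈ succ x by rewrite e; apply/mem_succ; right.
by case: (mem_asym xy).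
Qed.

Lemma ord_pair x y : ordinal (pair x y).
Proof. exact/ord_add/ord_qsum. Qed.

Lemma ord_seqcode h m : ordinal (seqcode h m).
Proof. by case: m => [|m]; [exact: ord_0|exact/ord_succ/ord_pair]. Qed.

Lemma succ_neq0 x : succ x <> ∅.
Proof. by move=> e; apply: (mem_empty (x := x)); rewrite -e; apply/mem_succ; right. Qed.

Lemma seqcode_inj h h' m m' : (forall i, i < m -> ordinal (h i)) -> (forall i, i < m' -> ordinal (h' i)) ->
  seqcode h m = seqcode h' m' -> m = m' /\ forall i, i < m -> h i = h' i.
Proof.
elim: m m' => [|m IH] [|m'] //= oh oh'.
- by move/esym/succ_neq0.
- by move/succ_neq0.
move/(succ_inj (ord_pair _ _) (ord_pair _ _)).
case/(pair_inj (oh m (ltnSn m)) (ord_seqcode _ _) (oh' m' (ltnSn m')) (ord_seqcode _ _)) => e /IH[||mm hh].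
- by move=> i im; apply: oh; apply: ltnW.
- by move=> i im; apply: oh'; apply: ltnW.
rewrite -mm in e *; split=> // i; rewrite ltnS leq_eqVlt => /orP[/eqP -> //|]; exact: hh.
Qed.

Lemma codeP s m : equipotent s (num m) -> exists2 p, enumerates s p & code s = seqcode p.1 p.2.
Proof.
move=> /fin_enum[h hs]; rewrite /code; case: pselect => [e|]; last by case; exists (h, m).
by case: cid => p ps; exists p.
Qed.

Lemma code_inj s s' m m' : (forall x, x ∈ s -> ordinal x) -> (forall x, x ∈ s' -> ordinal x) ->
  equipotent s (num m) -> equipotent s' (num m') -> code s = code s' -> s = s'.
Proof.
move=> os os' /codeP[p ps ->] /codeP[p' ps' ->] /seqcode_inj[||e h].
- by move=> i ip; apply: os; apply/ps; exists i.
- by move=> i ip; apply: os'; apply/ps'; exists i.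
apply: V_ext => x; rewrite ps ps' -e.
by split=> -[i ip ->]; exists i => //; rewrite h.
Qed.

Lemma code_closed a s m : lim a -> pair_closed_ord a -> s ⊆ a -> equipotent s (num m) -> code s ∈ a.
Proof.
move=> [oa a0 asucc] pa sa /codeP[p ps ->].
have : forall i, i < p.2 -> p.1 i ∈ a by move=> i ip; apply: sa; apply/ps; exists i.
elim: p.2 => //= n IH h; apply: asucc; apply: pa; first exact: h.
by apply: IH => i ip; apply: h; apply: ltnW.
Qed.

Lemma ramsey_not_thin k S : lim k -> ramsey_unb k S -> thin k (ramsey_unb k) S -> False.
Proof.
move=> kl PS tS; have nf := ramsey_nfam kl; have ok := lim_ord kl; have [_ k0 ks] := kl.
have [Sk hS] := PS.
have PT := ramsey_lacking ok PS; set T := lacking ramsey_unb S in PT.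
have TS : T ⊆ S by exact: sep_sub.
have /choice[F FP] : forall a, exists f, a ∈ T -> regr (S ∩ a) f /\
    forall H, H ⊆ S ∩ a -> unbounded a H -> ~ const_on f H.
  move=> a; case: (EM (a ∈ T)) => [/mem_sep[aS n]|]; last by exists id.
  have [|f hf] := not_ramsey _ n; first by move=> x /mem_inter[].
  by exists f.
pose M a x y := exists s m, [/\ s ∈ nsubsets m (S ∩ a), x = code s & y = F a s].
have [H0 [b [PH0 H0T hb]]] := homog2 M kl nf (ramsey_branches kl) PT (thin_sub tS TS).
have PH := nf_closed kl nf (nf_closed2 kl nf (nf_tail kl nf PH0 k0) (pair_closed kl (nf_reg kl nf PS))) ks.
set H := sep _ _ in PH.
have HP a : a ∈ H -> [/\ a ∈ H0, lim a & pair_closed_ord a].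
  move=> /mem_sep[/mem_sep[/mem_sep[aH a0] pa] sa]; split=> //; split=> //.
  exact: ord_mem ok (nf_sub nf PH0 aH).
(* The limit colouring. The bound [mn s] keeps it regressive, and below [a ∈ H] the only candidate
   is [F a s], as [b] is there the graph of [F a]. *)
pose f s := eps (fun y => y ∈ mn s /\ b (code s) y).
have fE a s m z : a ∈ H -> s ∈ nsubsets m (S ∩ a) -> is_min z s -> z <> ∅ -> f s = F a s.
  move=> aH sm zs z0; have [aH0 la pa] := HP a aH; have oa := lim_ord la.
  have [sa es] := nsubsetsP sm; have [rF _] := FP a (H0T _ aH0).
  have sa' x : x ∈ s -> x ∈ a by move=> /sa/mem_inter[].
  have Fz : F a s ∈ z by apply: rF zs z0.
  have za : z ∈ a by apply: sa'; case: zs.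
  have ca : code s ∈ a by apply: code_closed es.
  have Fa := ord_trans oa Fz za.
  have [fz bf] : f s ∈ mn s /\ b (code s) (f s).
    apply: (epsP (P := fun y => y ∈ mn s /\ b (code s) y)); exists (F a s).
    by rewrite (mnE zs); split=> //; apply/(hb a) => //; exists s, m.
  rewrite (mnE zs) in fz.
  have /(hb a _ _ aH0 ca (ord_trans oa fz za))[s' [m' [sm' ce ->]]] := bf.
  have [sa2 es'] := nsubsetsP sm'; congr (F a _); apply/esym.
  apply: (code_inj _ _ es es' ce) => x; [move=> /sa'|move=> /sa2/mem_inter[_]]; exact: ord_mem.
have [|Y [YS uY cY]] := hS f.
  move=> s z sS zs z0; have oz : ordinal z by apply: ord_mem ok _; case: zs => /sS/Sk.
  have [x xz] := neq0P z0; case: (EM (f s = ∅)) => [->|]; first exact: ord_0_mem xz.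
  by rewrite -(mnE zs) => /eps_neq0[].
have Yk : Y ⊆ k by move=> x /YS/Sk.
apply: (unb_reflect kl nf PH Yk uY) => a aH ua.
have [aH0 la _] := HP a aH; have [_ nF] := FP a (H0T _ aH0); have oa := lim_ord la.
have uZ : unbounded a (sep (Y ∩ a) (fun y => ∅ ∈ y)).
  apply: unb_tail => //; first by move=> x /mem_inter[].
  by case: la.
set Z := sep _ _ in uZ.
have ZP x : x ∈ Z -> [/\ x ∈ Y, x ∈ a & x <> ∅] by move=> /mem_sep[/mem_inter[xY xa] /mem_neq0].
apply: (nF Z) => //; first by move=> x /ZP[/YS xS xa _]; apply/mem_inter.
move=> m s t sZ tZ; case: (EM (s = ∅)) => [s0|s0]; first by rewrite s0 (nsubsets_empty sZ tZ s0).
have t0 : t <> ∅ by move=> /(nsubsets_empty tZ sZ).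
have key u : u <> ∅ -> u ∈ nsubsets m Z -> u ∈ nsubsets m Y /\ f u = F a u.
  move=> u0 uZ'; have [uu _] := nsubsetsP uZ'; split.
    by apply: nsubsets_sub uZ' _ => x /uu/ZP[].
  have [|z zu] := is_min_ex oa _ u0; first by move=> x /uu/ZP[].
  apply: (fE a u m z) => //; last by have [/uu/ZP[]] := zu.
  by apply: nsubsets_sub uZ' _ => x /uu/ZP[/YS xS xa _]; apply/mem_inter.
have [sY <-] := key s s0 sZ; have [tY <-] := key t t0 tZ; exact: cY sY tY.
Qed.

(** The two notions of regressive function differ at infinite sets and at sets with minimum [∅] or
    none. Unsuitable values are reset to [∅], and [∅] is removed from the homogeneous sets. *)
Lemma ramseyE k S : infinite_cardinal k -> ramsey k S <-> ramsey_unb k S.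
Proof.
move=> ki; have kl := inf_card_lim ki; have [ck _] := ki; have ok := lim_ord kl.
have k0 := lim_num 0 kl.
have mo a m : a ⊆ k -> is_min m a -> ordinal m by move=> ak [/ak h _]; apply: ord_mem h.
have pos H m a : H ⊆ k -> a <> ∅ -> a ∈ nsubsets m (sep H (fun x => ∅ ∈ x)) ->
    [/\ a ∈ nsubsets m H, a ⊆ H & exists2 z, is_min z a & z <> ∅].
  move=> Hk a0 aH; have [aa _] := nsubsetsP aH.
  have aH' : a ⊆ H by move=> x /aa/mem_sep[].
  split=> //; first by apply: nsubsets_sub aH _ => x /aH'.
  have [|z zm] := is_min_ex ok _ a0; first by move=> x /aH'/Hk.
  by exists z => //; have [/aa/mem_sep[_ /mem_neq0]] := zm.
split=> PS; have [Sk h] := PS; split=> // f rf.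
  have [|H [HS eH cH]] := h (fun a => if pselect (a ⊆ S /\ exists2 z, is_min z a & z <> ∅) then f a else ∅).
    split=> [a aS|a m aS ma m0].
      case: pselect => [[aS' [z za z0]]|? //].
      have zk : z ∈ k by case: za => /aS'/Sk.
      exact: ord_trans ok (rf a z aS' za z0) zk.
    case: pselect => [[aS' ?] /=|[]]; first exact: rf aS' ma m0.
    by split; [move: aS => /mem_sep[/mem_pow]|exists m].
  have Hk : H ⊆ k by move=> x /HS/Sk.
  have uH : unbounded k H by exact: equip_unb.
  exists (sep H (fun x => ∅ ∈ x)); split; [by move=> x /mem_sep[/HS]|exact: unb_tail|].
  move=> m a b aH bH; case: (EM (a = ∅)) => [a0|a0]; first by rewrite a0 (nsubsets_empty aH bH a0).
  have b0 : b <> ∅ by move=> /(nsubsets_empty bH aH).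
  have [aH' aa ma] := pos _ _ _ Hk a0 aH; have [bH' bb mb] := pos _ _ _ Hk b0 bH.
  have := cH m a b aH' bH'; case: pselect => [?|[]]; last by split=> // x /aa/HS.
  by case: pselect => [?|[]] //; split=> // x /bb/HS.
have kr := nf_reg kl (ramsey_nfam kl) PS.
have [|H [HS uH cH]] := h (fun a => if pselect (f a ∈ mn a) then f a else ∅).
  move=> a m aS ma m0; rewrite (mnE ma); case: pselect => // ?.
  have [x xm] := neq0P m0; apply: ord_0_mem xm; apply: mo ma.
  by move=> y /aS/Sk.
have Hk : H ⊆ k by move=> x /HS/Sk.
have uH' : unbounded k (sep H (fun x => ∅ ∈ x)) by apply: unb_tail.
exists (sep H (fun x => ∅ ∈ x)); split; first by move=> x /mem_sep[/HS].
  by apply: unb_equip => // x /mem_sep[/Hk].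
move=> m a b aH bH; case: (EM (a = ∅)) => [a0|a0]; first by rewrite a0 (nsubsets_empty aH bH a0).
have b0 : b <> ∅ by move=> /(nsubsets_empty bH aH).
have key c : c <> ∅ -> c ∈ nsubsets m (sep H (fun x => ∅ ∈ x)) -> c ∈ nsubsets m H /\ f c ∈ mn c.
  move=> c0 cH0; have [cH' cc [z zc z0]] := pos _ _ _ Hk c0 cH0; split=> //.
  rewrite (mnE zc); apply: rf.2 zc z0; apply/mem_sep; split; first by apply/mem_pow => x /cc/HS.
  by exists m; case: (nsubsetsP cH').
have [aH' fa] := key a a0 aH; have [bH' fb] := key b b0 bH.
by have := cH m a b aH' bH'; case: pselect => // ?; case: pselect.
Qed.

Theorem nowhere_saturated_ramsey k : infinite_cardinal k -> nowhere_saturated k (ideal_of k ramsey).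
Proof.
move=> ki; have kl := inf_card_lim ki.
apply: (nowhere_saturated_thin kl (ramsey_nfam kl)) => S; first exact: ramseyE.
exact: ramsey_not_thin.
Qed.

(** * Inaccessibility and first-order reflection *)

Lemma Vlevel_trans a : ordinal a -> transitive (Vlevel a).
Proof.
elim/V_ind: a => a IH oa x /mem_Vlevel[b ba xb] y /xb/mem_Vlevel[c cb yc].
by apply/mem_Vlevel; exists c => //; apply: ord_trans cb ba.
Qed.

Lemma Vlevel_mono a b : ordinal a -> b ∈ a -> Vlevel b ⊆ Vlevel a.
Proof. by move=> oa ba x /mem_Vlevel[c cb xc]; apply/mem_Vlevel; exists c => //; apply: ord_trans cb ba. Qed.

Lemma Vlevel_mem a b : b ∈ a -> Vlevel b ∈ Vlevel a.
Proof. by move=> ba; apply/mem_Vlevel; exists b. Qed.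

Lemma ord_Vlevel a b : ordinal a -> ordinal b -> b ∈ Vlevel a <-> b ∈ a.
Proof.
elim/V_ind: a b => a IH b oa ob; split=> [/mem_Vlevel[c ca bc]|].
  have oc := ord_mem oa ca; have /mem_succ[h|-> //] : b ∈ succ c.
    by apply: ord_le => // /bc /(IH c ca _ oc oc); exact: mem_irr.
  exact: ord_trans h ca.
move=> ba; apply/mem_Vlevel; exists b => // c cb.
by apply/IH => //; apply: ord_mem cb.
Qed.

Lemma ord_sub_Vlevel a : ordinal a -> a ⊆ Vlevel a.
Proof. by move=> oa x xa; apply/ord_Vlevel => //; apply: ord_mem xa. Qed.

Lemma Vlevel_inj a b : ordinal a -> ordinal b -> Vlevel a = Vlevel b -> a = b.
Proof.
move=> oa ob e; case: (ord_tri oa ob) => // /Vlevel_mem; rewrite e => /mem_irr //.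
Qed.

Lemma Vlevel_mem_inv a b : ordinal a -> ordinal b -> Vlevel a ∈ Vlevel b -> a ∈ b.
Proof.
move=> oa ob h; case: (ord_tri oa ob) => // [e|ba]; first by rewrite e in h; case: (mem_irr h).
by case: (mem_asym h (Vlevel_mem ba)).
Qed.

Definition kp x y : V := two (one x) (two x y).

Lemma one_two x y z : one x = two y z -> x = y /\ x = z.
Proof.
move=> e; have: y ∈ one x by rewrite e; apply/mem_two; left.
have: z ∈ one x by rewrite e; apply/mem_two; right.
by move=> /mem_one -> /mem_one ->.
Qed.

Lemma one_inj x y : one x = one y -> x = y.
Proof. by move=> e; apply/mem_one; rewrite -e; apply/mem_one. Qed.

Lemma one_kp x y z : one x ∈ kp y z -> x = y.
Proof. by case/mem_two => [/one_inj|/one_two[]]. Qed.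

Lemma kp_inj x y x' y' : kp x y = kp x' y' -> x = x' /\ y = y'.
Proof.
move=> e; have xx : x = x' by apply: (@one_kp _ x' y'); rewrite -e; apply/mem_two; left.
split=> //; subst x'.
have: two x y ∈ kp x y' by rewrite -e; apply/mem_two; right.
have: two x y' ∈ kp x y by rewrite e; apply/mem_two; right.
case/mem_two => [/esym/one_two[_ xy']|e1] /mem_two[/esym/one_two[_ xy]|e2].
- by rewrite -xy.
- have: y ∈ two x y' by rewrite -e2; apply/mem_two; right.
  by case/mem_two => ->.
- have: y' ∈ two x y by rewrite -e1; apply/mem_two; right.
  by case/mem_two => ->.
have: y ∈ two x y' by rewrite -e2; apply/mem_two; right.
have: y' ∈ two x y by rewrite e2; apply/mem_two; right.
by case/mem_two => [->|-> //] /mem_two[].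
Qed.

Section Lim.
Variable a : V.
Hypothesis al : lim a.
Let oa := lim_ord al.

Lemma Vlevel_succ x b : b ∈ a -> x ⊆ Vlevel b -> x ∈ Vlevel a.
Proof. by move=> ba xb; apply/mem_Vlevel; exists b. Qed.

Lemma Vlevel_bound x y : x ∈ Vlevel a -> y ∈ Vlevel a -> exists b, [/\ b ∈ a, x ∈ Vlevel b & y ∈ Vlevel b].
Proof.
move=> /mem_Vlevel[b ba xb] /mem_Vlevel[c ca yc]; have [_ _ as_] := al.
have ob := ord_mem oa ba; have oc := ord_mem oa ca.
exists (succ (un b c)); split; first by apply: as_; apply: lim_max.
  by apply/mem_Vlevel; exists b => //; apply: maxl.
by apply/mem_Vlevel; exists c => //; apply: maxr.
Qed.

Lemma Vlevel_two x y : x ∈ Vlevel a -> y ∈ Vlevel a -> two x y ∈ Vlevel a.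
Proof.
move=> xa ya; have [b [ba xb yb]] := Vlevel_bound xa ya.
by apply: (Vlevel_succ ba) => z /mem_two[] ->.
Qed.

Lemma Vlevel_one x : x ∈ Vlevel a -> one x ∈ Vlevel a.
Proof.
move=> xa; have [b [ba xb _]] := Vlevel_bound xa xa.
by apply: (Vlevel_succ ba) => z /mem_one ->.
Qed.

Lemma Vlevel_kp x y : kp x y ∈ Vlevel a <-> x ∈ Vlevel a /\ y ∈ Vlevel a.
Proof.
split=> [h|[xa ya]]; last by apply: Vlevel_two; [exact: Vlevel_one|exact: Vlevel_two].
have t := Vlevel_trans oa; have h2 : two x y ∈ Vlevel a by apply: (t _ h); apply/mem_two; right.
by split; apply: (t _ h2); apply/mem_two; [left|right].
Qed.

Lemma Vlevel_un x y : x ∈ Vlevel a -> y ∈ Vlevel a -> un x y ∈ Vlevel a.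
Proof.
move=> xa ya; have [b [ba xb yb]] := Vlevel_bound xa ya; have ob := ord_mem oa ba.
by apply: (Vlevel_succ ba) => z /mem_un[]; apply: Vlevel_trans.
Qed.

Lemma Vlevel_sub x y : x ⊆ y -> y ∈ Vlevel a -> x ∈ Vlevel a.
Proof. by move=> xy /mem_Vlevel[b ba yb]; apply: (Vlevel_succ ba) => z /xy/yb. Qed.

Lemma Vlevel_ex x : x ∈ Vlevel a -> exists2 b, b ∈ a & x ∈ Vlevel b.
Proof. by move=> xa; have [b [ba xb _]] := Vlevel_bound xa xa; exists b. Qed.

Lemma Vlevel_num n : num n ∈ Vlevel a.
Proof. by apply: ord_sub_Vlevel => //; apply: lim_num. Qed.

Lemma Vlevel_0 : ∅ ∈ Vlevel a. Proof. exact: (Vlevel_num 0). Qed.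

End Lim.

Lemma Vlevel_lim a : ordinal a -> a <> ∅ ->
  (forall x, x ∈ Vlevel a -> exists2 y, y ∈ Vlevel a & x ∈ y) -> lim a.
Proof.
move=> oa /neq0P[z za] h; split=> //; first exact: ord_0_mem za.
move=> b ba; have [|y /mem_Vlevel[c ca yc] yb] := h b; first exact: ord_sub_Vlevel.
have ob := ord_mem oa ba; have oc := ord_mem oa ca.
have bc : b ∈ c by apply/ord_Vlevel => //; apply: yc.
have /mem_succ[h'|-> //] : succ b ∈ succ c.
  apply: ord_le => //; first exact: ord_succ.
  by case/mem_succ => [/(mem_asym bc)//|e]; rewrite e in bc; case: (mem_irr bc).
exact: ord_trans h' ca.
Qed.

(* Inaccessibility, as collection over the levels [Vlevel xi]. *)
Definition inac (k : V) : Prop := [/\ lim k, omega ∈ k & forall xi f, xi ∈ k ->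
  (forall x, x ∈ Vlevel xi -> f x ∈ k) -> exists2 g, g ∈ k & forall x, x ∈ Vlevel xi -> f x ∈ g].

Lemma inac_lim k : inac k -> lim k. Proof. by case. Qed.

Lemma inac_reg k : inac k -> reg k.
Proof.
move=> [kl wk h] a f ak fk; have ok := lim_ord kl; have oa := ord_mem ok ak.
have [|g gk gP] := h a (fun x => if pselect (x ∈ a) then f x else ∅) ak.
  by move=> x _; case: pselect => [/fk //|?] /=; exact: lim_num 0 kl.
exists g => // i ia; have := gP i (ord_sub_Vlevel oa ia).
by case: pselect.
Qed.

(** * First-order formulas with all connectives *)

Inductive xform : Type :=
| XMem (i j : nat) | XEq (i j : nat) | XPred (i : nat) | XVar (X i : nat)
| XAnd (p q : xform) | XOr (p q : xform) | XImp (p q : xform) | XIff (p q : xform)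
| XAll (i : nat) (p : xform) | XEx (i : nat) (p : xform).

Definition FNot p := FImp p FBot.
Definition FAnd p q := FNot (FImp p (FNot q)).

Fixpoint tr (p : xform) : formula :=
  match p with
  | XMem i j => FMem i j
  | XEq i j => FEq i j
  | XPred i => FPred i
  | XVar X i => FVar X i
  | XAnd p q => FAnd (tr p) (tr q)
  | XOr p q => FImp (FNot (tr p)) (tr q)
  | XImp p q => FImp (tr p) (tr q)
  | XIff p q => FAnd (FImp (tr p) (tr q)) (FImp (tr q) (tr p))
  | XAll i p => FAll i (tr p)
  | XEx i p => FNot (FAll i (FNot (tr p)))
  end.

(** Unfolds to the connectives of the metalanguage, so the meaning of a concrete sentence is
    obtained by computation; the encoding by [FImp] and [FAll] is dealt with once, in [sat_tr]. *)
Fixpoint xsat (M A : V) (R r : nat -> V) (p : xform) : Prop :=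
  match p with
  | XMem i j => r i ∈ r j
  | XEq i j => r i = r j
  | XPred i => r i ∈ A
  | XVar X i => r i ∈ R X
  | XAnd p q => xsat M A R r p /\ xsat M A R r q
  | XOr p q => xsat M A R r p \/ xsat M A R r q
  | XImp p q => xsat M A R r p -> xsat M A R r q
  | XIff p q => xsat M A R r p <-> xsat M A R r q
  | XAll i p => forall x, x ∈ M -> xsat M A R (update r i x) p
  | XEx i p => exists2 x, x ∈ M & xsat M A R (update r i x) p
  end.

Lemma sat_and M A R r p q : sat M A R r (FAnd p q) <-> sat M A R r p /\ sat M A R r q.
Proof. by move=> /=; split=> [h|[h1 h2] h]; [split; apply: contrapT => n; apply: h|apply: (h h1)]. Qed.

Lemma sat_tr M A R r p : sat M A R r (tr p) <-> xsat M A R r p.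
Proof.
elim: p r => [i j|i j|i|X i|p IHp q IHq|p IHp q IHq|p IHp q IHq|p IHp q IHq|i p IHp|i p IHp] r //.
- by rewrite [tr _]/= sat_and IHp IHq.
- rewrite /= IHp IHq; split=> [h|[h|h] n //].
  by case: (EM (xsat M A R r p)) => n; [left|right; apply: h].
- by rewrite /= IHp IHq.
- by rewrite [tr _]/= sat_and /= IHp IHq.
- by split=> h x xM; apply/IHp; apply: h.
- split=> /= [h|[x xM hx] h]; last by apply: (h x xM); apply/IHp.
  by apply: contrapT => n; apply: h => x xM /IHp hx; apply: n; exists x.
Qed.

Lemma first_order_tr p : first_order (tr p).
Proof. by elim: p => //= [p -> q ->|p -> q ->|p -> q ->|p -> q ->|i p ->]. Qed.

Lemma Pi1_Sigma1_cumul : (forall n p, Pi1 n p -> Pi1 n.+1 p) /\ (forall n p, Sigma1 n p -> Sigma1 n.+1 p).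
Proof.
suff h n : (forall p, Pi1 n p -> Pi1 n.+1 p) /\ (forall p, Sigma1 n p -> Sigma1 n.+1 p).
  by split=> n; case: (h n).
elim: n => [|n [IH1 IH2]].
  split=> p h; inversion h; subst.
    by apply: Pi1_Sigma1; apply: Sigma1_first_order.
  by apply: Sigma1_Pi1; apply: Pi1_first_order.
split=> p.
  move: {-2}n.+1 (erefl n.+1) => m e h.
  elim: h e => [q _ //|m' q hq [e]|m' X q _ IH [e]]; subst.
    by apply: Pi1_Sigma1; apply: IH2.
  by apply: Pi1_all; apply: IH.
move: {-2}n.+1 (erefl n.+1) => m e h.
elim: h e => [q _ //|m' q hq [e]|m' X q _ IH [e]]; subst.
  by apply: Sigma1_Pi1; apply: IH1.
by apply: Sigma1_ex; apply: IH.
Qed.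

Lemma Pi1_le m n p : m <= n -> Pi1 m p -> Pi1 n p.
Proof.
elim: n => [|n IH]; first by rewrite leqn0 => /eqP->.
rewrite leq_eqVlt => /orP[/eqP-> //|]; rewrite ltnS => mn h.
by apply: Pi1_Sigma1_cumul.1; apply: IH.
Qed.

Lemma indescribable_le m n k S : m <= n -> indescribable n k S -> indescribable m k S.
Proof. by move=> mn [Sk h]; split=> // A p Ak /(Pi1_le mn); apply: h. Qed.

(* The universe is closed under the function whose Kuratowski pairs are in [A]. *)
Definition XClosed := XAnd (XEx 0 (XEq 0 0)) (XAll 0 (XEx 1 (XAnd (XPred 1)
  (XEx 2 (XAnd (XMem 2 1) (XAll 3 (XIff (XMem 3 2) (XEq 3 0)))))))).

Lemma indescribable_closed n k S F : lim k -> indescribable n k S ->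
  (forall x, x ∈ Vlevel k -> F x ∈ Vlevel k) ->
  exists a, [/\ a ∈ S, ∅ ∈ a & forall x, x ∈ Vlevel a -> F x ∈ Vlevel a].
Proof.
move=> kl /(indescribable_le (leq0n n))[Sk h] Fk; have ok := lim_ord kl.
pose A := img (Vlevel k) (fun x => kp x (F x)).
have AP u : u ∈ A <-> exists2 x, x ∈ Vlevel k & u = kp x (F x) by exact: mem_img.
have tk := Vlevel_trans ok.
have [||||a aS] := h A (tr XClosed).
- by move=> u /AP[x xk ->]; apply/(Vlevel_kp kl); split=> //; apply: Fk.
- by apply: Pi1_first_order; apply: first_order_tr.
- by [].
- apply/sat_tr; split; first by exists ∅; first exact: Vlevel_0.
  move=> x xk; have kk : kp x (F x) ∈ Vlevel k by apply/(Vlevel_kp kl); split=> //; apply: Fk.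
  exists (kp x (F x)) => //; split; first by apply/AP; exists x.
  exists (one x); first exact: Vlevel_one.
  by split=> [|z _]; [apply/mem_two; left|exact: mem_one].
have oa := ord_mem ok (Sk _ aS); have ta := Vlevel_trans oa.
rewrite /models sat_tr /= => -[[x0 x0a _] hx]; exists a; split=> //.
  by have /mem_Vlevel[b ba _] := x0a; apply: ord_0_mem ba.
move=> x xa; have [u ua [/mem_inter[/AP[x' x'k ue] _] [s sa [su hs]]]] := hx x xa; rewrite /update /= in ue su hs.
have se : s = one x.
  apply: V_ext => z; rewrite mem_one; split=> [zs|->]; last exact/hs.
  by apply/hs => //; apply: ta zs.
(* Among the pairs in [A] only that of [x] contains [one x], which is why the sentence can do
   without a definition of pairs. *)
have xx : x = x' by apply: (@one_kp _ x' (F x')); rewrite -ue -se.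
have h2 : two x (F x) ∈ Vlevel a by apply: (ta _ ua); rewrite ue -xx; apply/mem_two; right.
by apply: (ta _ h2); apply/mem_two; right.
Qed.

(** A level below [k] closed under [succ] has limit height, so [omega ∈ k]. For collection the
    constant [Vlevel xi] is built into the values: a level closed under the function with values
    [two (Vlevel xi) (f' x)] contains [Vlevel xi] and every [f x]. *)
Lemma indescribable_inac n k : lim k -> indescribable n k k -> inac k.
Proof.
move=> kl hk; have ok := lim_ord kl; split=> //.
  have [|a [ak a0 ha]] := indescribable_closed (F := succ) kl hk.
    move=> x xk; have [b bk xb] := Vlevel_ex kl xk; apply: (Vlevel_succ bk) => y.
    by case/mem_succ => [yx|->] //; apply: Vlevel_trans (ord_mem ok bk) _ xb _ yx.
  have oa := ord_mem ok ak; have al : lim a.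
    apply: Vlevel_lim => //; first exact: mem_neq0 a0.
    by move=> x xa; exists (succ x); [exact: ha|apply/mem_succ; right].
  have /mem_succ[wa|-> //] : omega ∈ succ a.
    apply: ord_le => //; first exact: ord_omega.
    by move/(lim_omega al); exact: mem_irr.
  exact: ord_trans wa ak.
move=> xi f xik fk; pose f' x := if pselect (x ∈ Vlevel xi) then f x else ∅.
have [|a [ak a0 ha]] := indescribable_closed (F := fun x => two (Vlevel xi) (f' x)) kl hk.
  move=> x xk; apply: Vlevel_two => //; first exact: Vlevel_mem.
  rewrite /f'; case: pselect => [h|?] /=; last exact: Vlevel_0.
  by apply: ord_sub_Vlevel => //; apply: fk.
have oa := ord_mem ok ak; have ta := Vlevel_trans oa.
have xia : Vlevel xi ∈ Vlevel a.
  by apply: (ta _ (ha ∅ (ord_sub_Vlevel oa a0))); apply/mem_two; left.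
exists a => // x xxi; have xa : x ∈ Vlevel a by apply: ta xxi.
have : f' x ∈ Vlevel a by apply: (ta _ (ha x xa)); apply/mem_two; right.
rewrite /f'; case: pselect => //= ?; move/ord_Vlevel; apply=> //.
exact: ord_mem ok (fk _ xxi).
Qed.

Lemma indescribable_stat n k S : lim k -> indescribable n k S -> stat k S.
Proof.
move=> kl hS; have ok := lim_ord kl; have [Sk _] := hS; split.
  move=> g gk; have [|a [aS a0 ha]] := indescribable_closed (F := fun=> g) kl hS.
    by move=> _ _; apply: ord_sub_Vlevel.
  have oa := ord_mem ok (Sk _ aS); exists a => //; apply/ord_Vlevel => //; first exact: ord_mem gk.
  exact: ha (ord_sub_Vlevel oa a0).
move=> C Ck uC; pose F x := eps (fun c => c ∈ C /\ x ∈ c).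
have FP x : x ∈ k -> F x ∈ C /\ x ∈ F x.
  move=> xk; apply: (epsP (P := fun c => c ∈ C /\ x ∈ c)).
  by have [c cC xc] := uC x xk; exists c.
have [|a [aS a0 ha]] := indescribable_closed (F := fun x => if pselect (x ∈ k) then F x else ∅) kl hS.
  move=> x _; case: pselect => [h|?] /=; last exact: Vlevel_0.
  by apply: ord_sub_Vlevel => //; apply: Ck; case: (FP x h).
have ak := Sk _ aS; have oa := ord_mem ok ak.
exists a => //; split; first exact: mem_neq0 a0.
move=> x xa; have xk := ord_trans ok xa ak; have [FC xF] := FP x xk.
exists (F x) => //; apply/mem_inter; split=> //; apply/ord_Vlevel => //.
  exact: ord_mem ok (Ck _ FC).
by have := ha x (ord_sub_Vlevel oa xa); case: pselect.
Qed.

Definition restr (a : V) (R : nat -> V) : nat -> V := fun X => R X ∩ Vlevel a.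

(* Witnesses for the assignments into [Vlevel xi] are bounded, since these
   assignments are coded in a level below [k]. *)
Lemma reflect_fo k A R p : inac k -> first_order p ->
  clo k (fun a => forall r, (exists2 xi, xi ∈ a & forall i, r i ∈ Vlevel xi) ->
     sat (Vlevel k) A R r p <-> sat (Vlevel a) (A ∩ Vlevel a) (restr a R) r p).
Proof.
move=> ki; have [kl wk hk] := ki; have kr := inac_reg ki; have ok := lim_ord kl.
have [_ k0 ks] := kl.
have va a (r : nat -> V) i : a ∈ k -> (exists2 xi, xi ∈ a & forall i, r i ∈ Vlevel xi) -> r i ∈ Vlevel a.
  by move=> ak [xi xia h]; apply: Vlevel_mono (ord_mem ok ak) xia _ (h i).
elim: p => [i j|i j|i|X i||p IHp q IHq|i p IHp|X p _|X p _] //=.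
- by move=> _; exists id.
- by move=> _; exists id.
- move=> _; exists id => // a ak _ _ r /(va a r i ak) h.
  by rewrite mem_inter; split=> [|[]].
- move=> _; exists id => // a ak _ _ r /(va a r i ak) h.
  by rewrite mem_inter; split=> [|[]].
- by move=> _; exists id.
- move=> /andP[/IHp hp /IHq hq]; apply: clo_imp (clo_and kl hp hq) => a ak _ [h1 h2] r hr.
  by rewrite (h1 r hr) (h2 r hr).
move=> /IHp hp.
(* An assignment as a set. Pairs cost two levels above the maximum of [xi] and [omega], and the set
   of them a third, whence the three successors in [ze]. *)
pose rc (r : nat -> V) := mkset (fun i => kp (num i) (r i)).
have rcE r r' : rc r = rc r' -> r = r'.
  move=> e; apply: funext => n; have : kp (num n) (r n) ∈ rc r' by rewrite -e; apply/mem_mkset; exists n.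
  by case/mem_mkset => j /kp_inj[/num_inj <-].
pose ze xi := succ (succ (succ (un xi omega))).
have zek xi : xi ∈ k -> ze xi ∈ k by move=> xik; do 3!apply: (ks); apply: lim_max.
have rcV r xi : ordinal xi -> (forall i, r i ∈ Vlevel xi) -> rc r ∈ Vlevel (ze xi).
  move=> oxi hr; apply/mem_Vlevel; exists (succ (succ (un xi omega))); first by apply/mem_succ; right.
  have om := ord_max oxi ord_omega.
  have V1 x y : x ∈ Vlevel (un xi omega) -> y ∈ Vlevel (un xi omega) -> two x y ∈ Vlevel (succ (un xi omega)).
    by move=> hx hy; apply/mem_Vlevel; exists (un xi omega); [apply/mem_succ; right|move=> z /mem_two[] ->].
  have rV j : r j ∈ Vlevel (un xi omega).
    by case/mem_Vlevel: (hr j) => b bxi rb; apply/mem_Vlevel; exists b => //; apply/mem_un; left.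
  have nV j : num j ∈ Vlevel (un xi omega).
    by apply: ord_sub_Vlevel => //; apply/mem_un; right; apply/mem_omega; exists j.
  move=> z /mem_mkset[j ->]; apply/mem_Vlevel; exists (succ (un xi omega)); first by apply/mem_succ; right.
  move=> w /mem_two[]->; last exact: V1.
  have -> : one (num j) = two (num j) (num j) by apply: V_ext => v; rewrite mem_one mem_two; tauto.
  exact: V1.
pose wit z b := exists r x, [/\ z = rc r, x ∈ Vlevel b & ~ sat (Vlevel k) A R (update r i x) p].
pose f z := if pselect (exists b, b ∈ k /\ wit z b) is left e then sval (cid e) else ∅.
have fk z : f z ∈ k by rewrite /f; case: pselect => [e|?] //; case: cid => b [].
have /choice[G GP] : forall xi, exists g, xi ∈ k -> g ∈ k /\ forall z, z ∈ Vlevel (ze xi) -> f z ∈ g.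
  move=> xi; case: (EM (xi ∈ k)) => [xik|]; last by exists ∅.
  by have [|g gk gP] := hk (ze xi) f (zek _ xik); [by []|exists g].
have cG : clo k (fun a => forall xi, xi ∈ a -> G xi ∈ a).
  by exists G => // xi /GP[].
apply: clo_imp (clo_and kl (clo_and kl hp cG) (clo_lim kl)) => a ak _ [[ha Ga] al] r hr.
have oa := ord_mem ok ak.
have hu x : x ∈ Vlevel a -> exists2 xi, xi ∈ a & forall j, update r i x j ∈ Vlevel xi.
  move=> xa; have [xi xia rxi] := hr; have [b ba xb] := Vlevel_ex al xa.
  have oxi := ord_mem oa xia; have ob := ord_mem oa ba.
  exists (un xi b); first exact: lim_max.
  move=> j; rewrite /update; case: eqP => _.
    by case/mem_Vlevel: xb => c cb xc; apply/mem_Vlevel; exists c => //; apply/mem_un; right.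
  by case/mem_Vlevel: (rxi j) => c cb xc; apply/mem_Vlevel; exists c => //; apply/mem_un; left.
split=> h x xa.
  by apply/(ha _ (hu x xa)); apply: h; apply: Vlevel_mono ok ak _ xa.
apply: contrapT => nx; have [xi xia rxi] := hr; have oxi := ord_mem oa xia.
have xik := ord_trans ok xia ak.
have rz := rcV r xi oxi rxi.
have [b bk xb] := Vlevel_ex kl xa.
have ex : exists b, b ∈ k /\ wit (rc r) b by exists b; split=> //; exists r, x.
have fga : f (rc r) ∈ a.
  by apply: ord_trans oa _ (Ga xi xia); case: (GP xi xik) => _; apply.
move: fga; rewrite /f; case: pselect => // e; case: cid => b' /= [b'k [r' [x' [/rcE rr x'b n']]]] b'a.
rewrite -rr in n'; apply: n'.
have x'a : x' ∈ Vlevel a by apply: Vlevel_mono oa b'a _ x'b.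
by apply/(ha _ (hu x' x'a)); apply: h.
Qed.

Lemma restr0 a : restr a (fun=> ∅) = fun=> ∅.
Proof. by apply: funext => X; apply: V_ext => x; rewrite mem_inter; split=> [[]|/mem_empty]. Qed.

Lemma clo_stat k Q S : lim k -> reg k -> omega ∈ k -> clo k Q -> stat k S -> S ⊆ k ->
  exists2 a, a ∈ S & Q a.
Proof.
move=> kl kr wk cQ [_ sS] Sk; have [C [Ck uC cC] CQ] := clo_club kl kr wk cQ.
have [y yS [y0 uy]] := sS C Ck uC; exists y => //; apply: CQ; apply: cC => //; exact: Sk.
Qed.

Lemma indescribable0E k S : inac k -> indescribable 0 k S <-> S ⊆ k /\ stat k S.
Proof.
move=> ki; have [kl wk _] := ki; have ok := lim_ord kl; have kr := inac_reg ki.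
split=> [h|[Sk sS]]; first by split; [case: h|exact: indescribable_stat h].
split=> // A p Ak hp _ hs; have fp : first_order p by inversion hp.
have := clo_and kl (reflect_fo A (fun=> ∅) ki fp) (clo_lim kl).
case/(clo_stat kl kr wk)/(_ sS Sk) => a aS [h al]; exists a => //.
move: hs; rewrite /models (h (fun=> ∅)) ?restr0 //; exists (num 1); first exact: lim_num.
by move=> _; apply/mem_Vlevel; exists ∅; [apply/mem_succ; right|move=> x /mem_empty].
Qed.

Section Stat.
Variable k : V.
Hypotheses (kl : lim k) (kr : reg k) (wk : omega ∈ k).
Let ok := lim_ord kl.

Definition statk (S : V) : Prop := S ⊆ k /\ stat k S.

Lemma stat_nfam : nfam k statk.
Proof.
split.
- by move=> X [].
- by move=> X Y [Xk sX] XY Yk; split=> //; exact: (lg_up stat_largeness sX XY).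
- by move=> X [_ []].
move=> X g c0 [Xk sX] c0k ga; apply: contrapT => /forallNP nP.
have /choice[C CP] : forall c, exists C, [/\ C ⊆ k, unbounded k C &
    forall y, y ∈ sep X (fun a => c0 ∈ a /\ g a = c) -> ~ limpt C y].
  move=> c; have Yk : sep X (fun a => c0 ∈ a /\ g a = c) ⊆ k by move=> x /mem_sep[/Xk].
  by apply: not_stat => // s; apply: (nP c).
have cC := clo_diag kl kr (C := C) (fun c => let: And3 h1 h2 _ := CP c in conj h1 h2).
have [a aX [ca h]] := clo_stat kl kr wk (clo_and kl (clo_gt c0k) cC) sX Xk.
have [_ _ n] := CP (g a); apply: (n a) (h _ (ga a aX ca)).
exact/mem_sep.
Qed.

(* Almost all [a] have the same bound [G] for the next element of the club
   [C a] witnessing that [S ∩ a] is not stationary, so that closure points of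
   [G] belong to [C a]. *)
Lemma stat_not_thin S : statk S -> thin k statk S -> False.
Proof.
move=> [Sk sS] tS; have nf := stat_nfam.
pose bad a C := [/\ C ⊆ a, unbounded a C & forall y, y ∈ S -> y ∈ a -> ~ limpt C y].
pose T := sep S (fun a => exists C, bad a C).
have TS : T ⊆ S by exact: sep_sub.
have sT : statk T.
  split; first by move=> x /TS/Sk.
  apply: contrapT => /(not_stat kl)[x /TS/Sk//|C [Ck uC nC]].
  have [y0 y0S l0] := sS.2 C Ck uC; have oy0 := ord_mem ok (Sk _ y0S).
  (* At the least limit point [y] of [C] in [S], the set [C ∩ y] witnesses that [S ∩ y] is not
     stationary. *)
  have [y [oy [yS ly] my]] := ord_least (P := fun y => y ∈ S /\ limpt C y) oy0 (conj y0S l0).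
  apply: (nC y) => //; apply/mem_sep; split=> //; exists (C ∩ y); split.
  - by move=> x /mem_inter[].
  - by case: ly.
  - move=> z zS zy lz; apply: (my z zy); split=> //; apply: limpt_sub lz.
    by move=> x /mem_inter[].
have /choice[C CP] : forall a, exists C, a ∈ T -> bad a C.
  by move=> a; case: (EM (a ∈ T)) => [/mem_sep[_ [C h]]|]; [exists C|exists ∅].
pose h a i := eps (fun c => c ∈ C a /\ i ∈ c).
have hP a i : a ∈ T -> i ∈ a -> h a i ∈ C a /\ i ∈ h a i.
  move=> aT ia; apply: (epsP (P := fun c => c ∈ C a /\ i ∈ c)).
  by have [_ u _] := CP a aT; have [c cC ic] := u i ia; exists c.
(* For fixed [i] the fibres of [h a i] are disjoint, so [thin] bounds the values taken positively
   often. *)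
have /choice[G GP] : forall i, exists g, g ∈ k /\ forall d, d ∈ k -> statk (sep T (fun a => i ∈ a /\ h a i = d)) -> d ∈ g.
  move=> i; have [||g gk gP] := tS (fun d => sep T (fun a => i ∈ a /\ h a i = d)).
  - by move=> d _ x /mem_sep[/TS].
  - by move=> d d' x _ _ /mem_sep[_ [_ <-]] /mem_sep[_ [_ <-]].
  by exists g.
pose ok_ a := forall i, i ∈ a -> h a i ∈ G i.
have k0 := lim_num 0 kl.
case: (nf_add kl nf sT (Q1 := ok_) (Q2 := fun a => ~ ok_ a) (fun a _ => EM _)) => sT'; last first.
  have [|i ik Pi] := nf_norm_rel kl nf (R := fun a i => h a i ∉ G i) sT' k0.
    by move=> a /mem_sep[_ /existsNP[i /not_implyP[ia n]]] _; exists i.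
  have [|d dk Pd] := nf_norm_rel kl nf (R := fun a d => h a i = d) Pi k0.
    move=> a /mem_sep[/mem_sep[aT _] [_ ia _]] _; exists (h a i) => //.
    by have [Ca _ _] := CP a aT; apply: Ca; case: (hP a i aT ia).
  have dG : d ∈ G i.
    apply: (GP i).2 => //; apply: (nf_up nf Pd); last by move=> x /mem_sep[/TS/Sk].
    by move=> x /mem_sep[/mem_sep[/mem_sep[xT _] [_ ix _]] [_ _ e]]; apply/mem_sep.
  have [x /mem_sep[/mem_sep[_ [_ _ n]] [_ _ e]]] := nf_elt kl nf Pd.
  by apply: n; rewrite e.
have cG : clo k (fun a => a <> ∅ /\ forall i, i ∈ a -> G i ∈ a).
  by exists G => // i _; case: (GP i).
have [b bT [b0 Gb]] := clo_stat kl kr wk cG sT.2 sT.1.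
have [a /mem_sep[aT oka] ba] := nf_unb nf sT' (sT.1 _ bT).
have [Ca _ n] := CP a aT; apply: (n b (TS _ bT) ba); split=> // x xb.
have xa : x ∈ a by apply: ord_trans xb ba; apply: ord_mem ok (sT.1 _ aT).
have [hC xh] := hP a x aT xa; exists (h a x) => //; apply/mem_inter; split=> //.
by apply: ord_trans (oka x xa) (Gb x xb); apply: ord_mem ok (sT.1 _ bT).
Qed.

End Stat.

Theorem nowhere_saturated_indescribable0 k : infinite_cardinal k -> indescribable 0 k k ->
  nowhere_saturated k (ideal_of k (indescribable 0)).
Proof.
move=> /inf_card_lim kl /(indescribable_inac kl) ki; have kr := inac_reg ki; have [_ wk _] := ki.
apply: (nowhere_saturated_thin kl (stat_nfam kl kr wk)) => S; first exact: indescribable0E.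
exact: stat_not_thin.
Qed.

(** * Quantifier games *)

Fixpoint game (n : nat) (b : bool) (M : V) (Phi : seq V -> Prop) : Prop :=
  if n is m.+1 then
    if b then forall Y, Y ⊆ M -> game m false M (fun ys => Phi (Y :: ys))
    else exists2 Y, Y ⊆ M & game m true M (fun ys => Phi (Y :: ys))
  else Phi [::].

Fixpoint allsub (M : V) (ys : seq V) : Prop :=
  if ys is y :: ys' then y ⊆ M /\ allsub M ys' else True.

Lemma game_mono n b M (Phi Psi : seq V -> Prop) :
  (forall ys, size ys = n -> allsub M ys -> Phi ys -> Psi ys) -> game n b M Phi -> game n b M Psi.
Proof.
elim: n b Phi Psi => [|n IH] b Phi Psi h /=; first exact: h.
case: b => [hP Y YM|[Y YM hP]]; last exists Y => //.
  by apply: IH (hP Y YM) => ys sy ay; apply: h; rewrite /= ?sy.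
by apply: IH hP => ys sy ay; apply: h; rewrite /= ?sy.
Qed.

Lemma game_ext n b M (Phi Psi : seq V -> Prop) :
  (forall ys, size ys = n -> allsub M ys -> Phi ys <-> Psi ys) -> game n b M Phi <-> game n b M Psi.
Proof. by move=> h; split; apply: game_mono => ys sy ay; case: (h ys sy ay). Qed.

Lemma empty_sub M : ∅ ⊆ M. Proof. by move=> x /mem_empty. Qed.

Lemma game_all n b M (Phi : seq V -> Prop) :
  (forall ys, size ys = n -> allsub M ys -> Phi ys) -> game n b M Phi.
Proof.
elim: n b Phi => [|n IH] b Phi h /=; first exact: h.
case: b => [Y YM|]; last exists ∅; try exact: empty_sub.
  by apply: IH => ys sy ay; apply: h; rewrite /= ?sy.
by apply: IH => ys sy ay; apply: h; rewrite /= ?sy //; split=> //; exact: empty_sub.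
Qed.

Lemma game_and n b M (P : Prop) (Phi : seq V -> Prop) :
  game n b M (fun ys => P /\ Phi ys) <-> P /\ game n b M Phi.
Proof.
elim: n b Phi => [|n IH] b Phi //=; case: b; split.
- by move=> h; split=> [|Y YM]; [have /IH[] := h _ (@empty_sub M)|have /IH[] := h Y YM].
- by move=> [p h] Y YM; apply/IH; split=> //; apply: h.
- by move=> [Y YM /IH[p h]]; split=> //; exists Y.
- by move=> [p [Y YM h]]; exists Y => //; apply/IH.
Qed.

(* [{xi : Gd xi}] contains a club of [a] or is stationary in [a]. *)
Definition smat (b : bool) (a : V) (Gd : V -> Prop) : Prop :=
  if b then forall C, C ⊆ a -> unbounded a C -> exists xi, [/\ xi ∈ a, limpt C xi & Gd xi]
  else exists C, [/\ C ⊆ a, unbounded a C & forall xi, xi ∈ a -> limpt C xi -> Gd xi].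

Lemma clo_ex k Q : inac k -> clo k Q -> exists2 a, a ∈ k & Q a.
Proof.
move=> ki cQ; have [kl wk _] := ki.
have [C [Ck uC _] CQ] := clo_club kl (inac_reg ki) wk cQ.
have [c cC _] := uC _ (lim_num 0 kl); exists c; [exact: Ck|exact: CQ].
Qed.

Lemma clo_lim_unb k Q : inac k -> clo k Q ->
  exists C, [/\ C ⊆ k, unbounded k C & forall a, a ∈ k -> limpt C a -> Q a].
Proof.
move=> ki cQ; have [kl wk _] := ki.
have [C [Ck uC cC] CQ] := clo_club kl (inac_reg ki) wk cQ.
by exists C; split=> // a ak [a0 ua]; apply: CQ; apply: cC.
Qed.

Lemma smat_mono b k Gd Gd' : inac k -> clo k (fun xi => Gd xi -> Gd' xi) -> smat b k Gd -> smat b k Gd'.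
Proof.
move=> ki cG; have [kl _ _] := ki; have kr := inac_reg ki.
have h C : C ⊆ k -> unbounded k C -> exists C', [/\ C' ⊆ k, unbounded k C' &
    forall xi, xi ∈ k -> limpt C' xi -> limpt C xi /\ (Gd xi -> Gd' xi)].
  move=> Ck uC; have [C' [C'k uC' hC']] := clo_lim_unb ki (clo_and kl (clo_limpt kl kr Ck uC) cG).
  by exists C'.
case: b => [sm C Ck uC|[C [Ck uC hC]]]; have [C' [C'k uC' hC']] := h C Ck uC.
  have [xi [xik l g]] := sm C' C'k uC'; have [l' g'] := hC' xi xik l.
  by exists xi; split=> //; apply: g'.
by exists C'; split=> // xi xik /(hC' xi xik)[l g]; apply: g; apply: hC.
Qed.

(** A statement decided on a club can be read through either club quantifier. Its kind may thus be
    chosen to match the last move of a game, so that it adds no alternation. *)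
Lemma smat_clo b k Gd Q : inac k -> clo k (fun xi => Gd xi <-> Q) -> smat b k Gd <-> Q.
Proof.
move=> ki cG; have [kl _ _] := ki; have kr := inac_reg ki.
have [C [Ck uC hC]] := clo_lim_unb ki cG.
have uk := lim_unb kl.
split; case: b => [sm|].
- by have [xi [xik l /(hC xi xik l)]] := sm C Ck uC.
- move=> [C' [C'k uC' hC']].
  have [xi xik [h g]] := clo_ex ki (clo_and kl cG (clo_limpt kl kr C'k uC')).
  by apply/h; apply: hC'.
- move=> C' C'k uC'.
  have [xi xik [h g]] := clo_ex ki (clo_and kl cG (clo_limpt kl kr C'k uC')).
  by exists xi; split=> //; apply/h.
- by exists C; split=> // xi xik /(hC xi xik)->.
Qed.

(* [enc e v ys] codes the sequence of the [y ∩ v]; as [v] lies below [e] in the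
   transitive closure, [e] is the only member of [(y ∩ v) ∪ {e}] not in [v]. *)
Fixpoint enc (e v : V) (ys : seq V) : V :=
  if ys is y :: ys' then enc (un (y ∩ v) (one e)) v ys' else e.

Definition below (v e : V) : Prop := forall M, transitive M -> e ∈ M -> v ∈ M.

Lemma below_un v y e : below v e -> below v (un (y ∩ v) (one e)).
Proof.
move=> be M tM h; apply: be => //; apply: (tM _ h); apply/mem_un; right; exact/mem_one.
Qed.

Lemma Vlevel_nbelow a e : ordinal a -> below (Vlevel a) e -> e ∉ Vlevel a.
Proof. by move=> oa be /(be _ (Vlevel_trans oa)); exact: mem_irr. Qed.

Lemma enc_inj a a' e e' ys ys' : ordinal a -> ordinal a' -> size ys = size ys' ->
  below (Vlevel a) e -> below (Vlevel a') e' -> enc e (Vlevel a) ys = enc e' (Vlevel a') ys' ->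
  e = e' /\ (a = a' -> map (inter^~ (Vlevel a)) ys = map (inter^~ (Vlevel a)) ys').
Proof.
move=> oa oa'; elim: ys ys' e e' => [|y ys IH] [|y' ys'] e e' //= [sz] be be' E.
have [E1 E2] := IH _ _ _ sz (below_un be) (below_un be') E.
have ta := Vlevel_trans oa; have ta' := Vlevel_trans oa'.
have ee : e = e'.
  have: e ∈ un (y' ∩ Vlevel a') (one e') by rewrite -E1; apply/mem_un; right; apply/mem_one.
  have: e' ∈ un (y ∩ Vlevel a) (one e) by rewrite E1; apply/mem_un; right; apply/mem_one.
  case/mem_un => [/mem_inter[_ h]|/mem_one//]; case/mem_un => [/mem_inter[_ h']|/mem_one//].
  by case: (mem_asym (be' _ ta h) (be _ ta' h')).
split=> // aa; rewrite (E2 aa); subst a' e'; congr (_ :: _).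
have ne := Vlevel_nbelow oa be.
apply: V_ext => x; split=> xy.
  have: x ∈ un (y' ∩ Vlevel a) (one e) by rewrite -E1; apply/mem_un; left.
  by case/mem_un => // /mem_one xe; case: ne; rewrite -xe; case/mem_inter: xy.
have: x ∈ un (y ∩ Vlevel a) (one e) by rewrite E1; apply/mem_un; left.
by case/mem_un => // /mem_one xe; case: ne; rewrite -xe; case/mem_inter: xy.
Qed.

Lemma enc_Vlevel k e v ys : lim k -> e ∈ Vlevel k -> v ∈ Vlevel k -> enc e v ys ∈ Vlevel k.
Proof.
move=> kl; elim: ys e => [|y ys IH] e //= ek vk; apply: IH => //.
apply: Vlevel_un => //; last exact: Vlevel_one.
by apply: Vlevel_sub vk => // x /mem_inter[].
Qed.

Definition lenc (xi : V) (ys : seq V) : V := enc (Vlevel xi) (Vlevel xi) ys.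

Lemma lenc_inj a a' ys ys' : ordinal a -> ordinal a' -> size ys = size ys' ->
  lenc a ys = lenc a' ys' -> a = a' /\ map (inter^~ (Vlevel a)) ys = map (inter^~ (Vlevel a)) ys'.
Proof.
move=> oa oa' sz E; have b x : below x x by [].
have [/(Vlevel_inj oa oa') aa h] := enc_inj oa oa' sz (b _) (b _) E.
by split=> //; apply: h.
Qed.

Lemma lenc_Vlevel k xi ys : lim k -> xi ∈ k -> lenc xi ys ∈ Vlevel k.
Proof. by move=> kl xik; apply: enc_Vlevel => //; exact: Vlevel_mem. Qed.

(* The class of codes of the pairs (xi, ys) in [Good], where [Good xi] depends
   only on the traces of [ys] on [Vlevel xi]. *)
Definition codes (k : V) (n : nat) (Good : V -> seq V -> Prop) : V :=
  sep (Vlevel k) (fun z => exists xi ys, [/\ xi ∈ k, size ys = n, z = lenc xi ys &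
    Good xi (map (inter^~ (Vlevel xi)) ys)]).

Lemma mem_codes k n Good xi ys : lim k -> xi ∈ k -> size ys = n ->
  lenc xi ys ∈ codes k n Good <-> Good xi (map (inter^~ (Vlevel xi)) ys).
Proof.
move=> kl xik sy; have ok := lim_ord kl; rewrite mem_sep; split=> [[_ [xi' [ys' [xi'k sy' E g]]]]|g].
  have [e' e] := lenc_inj (ord_mem ok xik) (ord_mem ok xi'k) (etrans sy (esym sy')) E.
  by rewrite e; subst xi'.
by split; [exact: lenc_Vlevel|exists xi, ys].
Qed.

Definition Sem (n : nat) (a Z : V) : Prop :=
  game n true (Vlevel a) (fun ys => smat (odd n) a (fun xi => lenc xi ys ∈ Z)).

Lemma smat_ext b a Gd Gd' : (forall xi, xi ∈ a -> Gd xi <-> Gd' xi) -> smat b a Gd <-> smat b a Gd'.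
Proof.
move=> h; case: b => /=; split.
- by move=> s C Ca uC; have [xi [xia l /(h xi xia) g]] := s C Ca uC; exists xi.
- by move=> s C Ca uC; have [xi [xia l /(h xi xia) g]] := s C Ca uC; exists xi.
- by move=> [C [Ca uC g]]; exists C; split=> // xi xia l; apply/h => //; apply: g.
- by move=> [C [Ca uC g]]; exists C; split=> // xi xia l; apply/h => //; apply: g.
Qed.

Lemma Sem_ext n a Z Z' : lim a -> (forall x, x ∈ Vlevel a -> x ∈ Z <-> x ∈ Z') -> Sem n a Z <-> Sem n a Z'.
Proof.
move=> al h; apply: game_ext => ys _ _; apply: smat_ext => xi xia; apply: h.
exact: lenc_Vlevel.
Qed.

Lemma Sem_trace n a Z : lim a -> Sem n a (Z ∩ Vlevel a) <-> Sem n a Z.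
Proof.
move=> al; apply: Sem_ext => // x xa; rewrite mem_inter; by split=> [[]|].
Qed.

Definition sempos (n : nat) (k S : V) : Prop := S ⊆ k /\
  forall Z, Z ⊆ Vlevel k -> Sem n k Z -> exists a, [/\ a ∈ S, inac a & Sem n a Z].

(** * Normal forms of formulas *)

Definition proj (i : nat) (Y : V) : V :=
  sep (cup Y (fun u => cup u id)) (fun x => kp (num i) x ∈ Y).

Lemma mem_proj i Y x : x ∈ proj i Y <-> kp (num i) x ∈ Y.
Proof.
rewrite mem_sep; split=> [[]//|h]; split=> //.
apply/mem_cup; exists (kp (num i) x) => //; apply/mem_cup; exists (two (num i) x).
  by apply/mem_two; right.
by apply/mem_two; right.
Qed.

Definition join (Y Z : V) : V := un (img Y (kp (num 0))) (img Z (kp (num 1))).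

Lemma proj0_join Y Z : proj 0 (join Y Z) = Y.
Proof.
apply: V_ext => x; rewrite mem_proj mem_un !mem_img; split=> [[[y yY /kp_inj[_ ->]]|[y yZ /kp_inj[/num_inj]]] //|xY].
by left; exists x.
Qed.

Lemma proj1_join Y Z : proj 1 (join Y Z) = Z.
Proof.
apply: V_ext => x; rewrite mem_proj mem_un !mem_img; split=> [[[y yY /kp_inj[/num_inj]]|[y yZ /kp_inj[_ ->]]] //|xY].
by right; exists x.
Qed.

Lemma join_sub a Y Z : lim a -> Y ⊆ Vlevel a -> Z ⊆ Vlevel a -> join Y Z ⊆ Vlevel a.
Proof.
move=> al Ya Za x /mem_un[] /mem_img[y h ->]; apply/(Vlevel_kp al); split; try exact: Vlevel_num.
  exact: Ya.
exact: Za.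
Qed.

Lemma proj_sub a i Y : lim a -> Y ⊆ Vlevel a -> proj i Y ⊆ Vlevel a.
Proof. by move=> al Ya x /mem_proj/Ya/(Vlevel_kp al)[]. Qed.

Lemma proj_trace a i Y : lim a -> proj i (Y ∩ Vlevel a) = proj i Y ∩ Vlevel a.
Proof.
move=> al; apply: V_ext => x; rewrite mem_inter !mem_proj mem_inter (Vlevel_kp al).
by split=> [[h []]|[h1 h2]]; split=> //; split=> //; exact: Vlevel_num.
Qed.

Definition traces (a : V) : seq V -> seq V := map (inter^~ (Vlevel a)).

(** The matrix will be evaluated at levels [xi], where only the traces of the moves are visible, so
    decoding must commute with truncation. *)
Definition localdec (dec : (nat -> V) -> seq V -> nat -> V) : Prop :=
  forall xi R ys, lim xi -> dec (restr xi R) (traces xi ys) = restr xi (dec R ys).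

(** Each block is contracted to a single move; [dec] recovers the second-order variables from the
    moves, and the matrix is kept as it is. *)
Definition normal_form (n : nat) (b : bool) (p : formula) : Prop :=
  exists psi dec, [/\ first_order psi, localdec dec & forall a A R r, lim a ->
    sat (Vlevel a) A R r p <-> game n b (Vlevel a) (fun ys => sat (Vlevel a) A (dec R ys) r psi)].

Lemma restr_update a R X Z : restr a (update R X Z) = update (restr a R) X (Z ∩ Vlevel a).
Proof. by apply: funext => i; rewrite /restr /update; case: eqP. Qed.

Lemma normal_form_weaken n b p : normal_form n (~~ b) p -> normal_form n.+1 b p.
Proof.
move=> [psi [dec [fo ld h]]]; exists psi, (fun R ys => dec R (behead ys)); split=> //.
  by move=> xi R ys xl; rewrite -ld //; case: ys.
move=> a A R r al; rewrite (h a A R r al); case: {h}b => /=; split=> //.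
- by apply; exact: empty_sub.
- by move=> g; exists ∅ => //; exact: empty_sub.
- by case.
Qed.

Definition merge_dec X (dec : (nat -> V) -> seq V -> nat -> V) R ys :=
  if ys is Y :: ys' then dec (update R X (proj 0 Y)) (proj 1 Y :: ys') else R.

Lemma merge_local X dec : localdec dec -> localdec (merge_dec X dec).
Proof.
move=> ld xi R [|Y ys] xl //=; rewrite -ld // restr_update /=; congr (dec _ (_ :: _)).
  by rewrite proj_trace.
by rewrite proj_trace.
Qed.

Lemma normal_form_all n X p : normal_form n.+1 true p -> normal_form n.+1 true (FAll2 X p).
Proof.
move=> [psi [dec [fo ld h]]]; exists psi, (merge_dec X dec); split=> //; first exact: merge_local.
move=> a A R r al; split=> /= [s Y Ya|g Z Za].
  have /(h a A _ r al) := s _ (proj_sub (i := 0) al Ya); apply.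
  exact: proj_sub.
apply/(h a A _ r al) => Y Ya; have := g _ (join_sub al Za Ya).
by rewrite proj0_join proj1_join.
Qed.

Lemma normal_form_ex n X p : normal_form n.+1 false p -> normal_form n.+1 false (FEx2 X p).
Proof.
move=> [psi [dec [fo ld h]]]; exists psi, (merge_dec X dec); split=> //; first exact: merge_local.
move=> a A R r al; split=> /= [[Z Za /(h a A _ r al)[Y Ya g]]|[Y Ya g]].
  by exists (join Z Y); [exact: join_sub|rewrite proj0_join proj1_join].
exists (proj 0 Y); first exact: proj_sub.
by apply/(h a A _ r al); exists (proj 1 Y) => //; exact: proj_sub.
Qed.

Lemma normal_form_fo b p : first_order p -> normal_form 0 b p.
Proof. by move=> fo; exists p, (fun R _ => R); split. Qed.

Fixpoint Pi1_normal_form n p (h : Pi1 n p) : normal_form n true p :=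
  match h in Pi1 n p return normal_form n true p with
  | Pi1_first_order _ fo => normal_form_fo true fo
  | Pi1_Sigma1 _ _ h' => normal_form_weaken (b := true) (Sigma1_normal_form h')
  | Pi1_all _ X _ h' => normal_form_all X (Pi1_normal_form h')
  end
with Sigma1_normal_form n p (h : Sigma1 n p) : normal_form n false p :=
  match h in Sigma1 n p return normal_form n false p with
  | Sigma1_first_order _ fo => normal_form_fo false fo
  | Sigma1_Pi1 _ _ h' => normal_form_weaken (b := false) (Pi1_normal_form h')
  | Sigma1_ex _ X _ h' => normal_form_ex X (Sigma1_normal_form h')
  end.

(** By [reflect_fo], at an inaccessible [a] the matrix has the same truth value at [a] and at a club
    of levels below. These lower levels are recorded in [Z] independently of [a], so one [Z] serves
    all [a] up to [k]. *)
Lemma Pi1_Sem n k A p : lim k -> Pi1 n p -> exists2 Z, Z ⊆ Vlevel k &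
  forall a, a ∈ succ k -> inac a -> models (Vlevel a) (A ∩ Vlevel a) p <-> Sem n a Z.
Proof.
move=> kl /Pi1_normal_form[psi [dec [fo ld h]]]; have ok := lim_ord kl.
pose R0 : nat -> V := fun=> ∅.
pose Good xi ys := sat (Vlevel xi) (A ∩ Vlevel xi) (dec R0 ys) R0 psi.
exists (codes k n Good); first exact: sep_sub.
move=> a ak ai; have [al _ _] := ai.
rewrite /models (h a _ R0 R0 al); apply: game_ext => ys sy _; apply: iff_sym.
apply: smat_clo => //.
apply: clo_imp (clo_and al (reflect_fo (A ∩ Vlevel a) (dec R0 ys) ai fo) (clo_lim al)) => xi xia _ [hr xl].
have xik : xi ∈ k by case/mem_succ: ak => [ak|<- //]; apply: ord_trans xia ak.
rewrite (mem_codes Good kl xik sy) /Good (hr R0); last first.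
  exists (num 1); first exact: lim_num.
  by move=> i; apply/mem_Vlevel; exists ∅; [apply/mem_succ; right|exact: empty_sub].
rewrite -ld // restr0 -/(traces xi ys); suff -> : A ∩ Vlevel a ∩ Vlevel xi = A ∩ Vlevel xi by [].
apply: V_ext => x; rewrite !mem_inter; split=> [[[]] //|[xA xxi]]; split=> //; split=> //.
by apply: Vlevel_mono xia _ xxi; exact: lim_ord al.
Qed.

(** * Clubs and inaccessibility expressed inside a level *)

Definition limV (C v : V) : Prop := [/\ exists x, x ∈ v, transitive v &
  forall x, x ∈ v -> exists c, [/\ c ∈ C, c ∈ v & x ∈ c]].

Definition cofV (a C : V) : Prop := forall x, x ∈ Vlevel a -> exists2 c, c ∈ C & x ∈ c.

(** [smat] without ordinals, hence easy to write as a formula. A set [v] with [limV C v] is a level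
    if [C] consists of levels, and for any cofinal [C] a club of levels satisfies it; together this
    gives [matV_smat]. *)
Definition matV (b : bool) (a : V) (E : V -> Prop) : Prop :=
  if b then forall C, C ⊆ Vlevel a -> cofV a C -> exists v, [/\ v ∈ Vlevel a, limV C v & E v]
  else exists C, [/\ C ⊆ Vlevel a, cofV a C & forall v, v ∈ Vlevel a -> limV C v -> E v].

Lemma limV_Vlevel a C v : ordinal a -> C ⊆ a -> v ∈ Vlevel a -> limV (img C Vlevel) v ->
  exists xi, [/\ xi ∈ a, v = Vlevel xi & limpt C xi].
Proof.
move=> oa Ca va [[x0 x0v] tv hv].
pose xi := cup C (fun c => if pselect (Vlevel c ∈ v) then c else ∅).
have xiP x : x ∈ xi <-> exists c, [/\ c ∈ C, Vlevel c ∈ v & x ∈ c].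
  rewrite mem_cup; split=> [[c cC]|[c [cC cv xc]]].
    by case: pselect => [cv xc|? /mem_empty //]; exists c.
  by exists c => //; case: pselect.
have oxi : ordinal xi.
  apply: ord_cup => c cC; case: pselect => ? /=; [exact: ord_mem oa (Ca _ cC)|exact: ord_0].
have hC x : x ∈ v -> exists c, [/\ c ∈ C, Vlevel c ∈ v & x ∈ Vlevel c].
  by move=> /hv[w [/mem_img[c cC ->] wv xw]]; exists c.
have cxi c : c ∈ C -> Vlevel c ∈ v -> c ∈ xi.
  move=> cC cv; have [c' [c'C c'v cc']] := hC _ cv; apply/xiP; exists c'; split=> //.
  by apply: Vlevel_mem_inv cc'; apply: ord_mem oa (Ca _ _).
have vE : v = Vlevel xi.
  apply: V_ext => x; split=> [/hC[c [cC cv xc]]|/mem_Vlevel[b /xiP[c [cC cv bc]] xb]].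
    by apply: Vlevel_mono oxi (cxi c cC cv) _ xc.
  by apply: (tv _ cv); apply/mem_Vlevel; exists b.
exists xi; split=> //.
  by apply: Vlevel_mem_inv => //; rewrite -vE.
split.
  by have [c [cC cv _]] := hC _ x0v; apply: mem_neq0 (cxi c cC cv).
by move=> x /xiP[c [cC cv xc]]; exists c => //; apply/mem_inter; split=> //; apply: cxi.
Qed.

Lemma clo_limV a C : inac a -> C ⊆ Vlevel a -> cofV a C -> clo a (fun xi => limV C (Vlevel xi)).
Proof.
move=> ai Ca cC; have [al wa ha] := ai; have oa := lim_ord al; have [_ _ as_] := al.
pose f x := eps (fun g => g ∈ a /\ exists c, [/\ c ∈ C, c ∈ Vlevel g & x ∈ c]).
have fP x : x ∈ Vlevel a -> f x ∈ a /\ exists c, [/\ c ∈ C, c ∈ Vlevel (f x) & x ∈ c].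
  move=> xa; apply: (epsP (P := fun g => g ∈ a /\ exists c, [/\ c ∈ C, c ∈ Vlevel g & x ∈ c])).
  have [c cC' xc] := cC x xa; have [g ga cg] := Vlevel_ex al (Ca _ cC').
  by exists g; split=> //; exists c.
have /choice[G GP] : forall xi, exists g, xi ∈ a -> g ∈ a /\ forall x, x ∈ Vlevel xi -> f x ∈ g.
  move=> xi; case: (EM (xi ∈ a)) => [xia|]; last by exists ∅.
  have [|g ga gP] := ha xi f xia; last by exists g.
  by move=> x xxi; case: (fP x (Vlevel_mono oa xia xxi)).
have cG : clo a (fun xi => xi <> ∅ /\ forall x, x ∈ xi -> G x ∈ xi).
  by exists G => // xi /GP[].
apply: clo_imp (clo_and al cG (clo_lim al)) => xi xia _ [[xi0 Gxi] xl].
have oxi := ord_mem oa xia; split.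
- by exists ∅; exact: Vlevel_0.
- exact: Vlevel_trans.
- move=> x xxi; have [b bxi xb] := Vlevel_ex xl xxi.
  have [fa [c [cC' cf xc]]] := fP x (Vlevel_mono oa xia xxi).
  have ba := ord_trans oa bxi xia.
  have fxi : f x ∈ xi by apply: ord_trans oxi _ (Gxi b bxi); apply: (GP b ba).2.
  by exists c; split=> //; apply: Vlevel_mono oxi fxi _ cf.
Qed.

Lemma matV_smat b a E : inac a -> matV b a E <-> smat b a (fun xi => E (Vlevel xi)).
Proof.
move=> ai; have [al wa ha] := ai; have oa := lim_ord al.
have img1 C : C ⊆ a -> unbounded a C -> img C Vlevel ⊆ Vlevel a /\ cofV a (img C Vlevel).
  move=> Ca uC; split=> [v /mem_img[c cC ->]|x /mem_Vlevel[b' b'a xb]]; first exact/Vlevel_mem/Ca.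
  have [c cC bc] := uC _ b'a; exists (Vlevel c); first by apply/mem_img; exists c.
  by apply/mem_Vlevel; exists b'.
have lim2 C : C ⊆ Vlevel a -> cofV a C -> exists C', [/\ C' ⊆ a, unbounded a C' &
    forall xi, xi ∈ a -> limpt C' xi -> limV C (Vlevel xi)].
  by move=> Ca cC; apply: clo_lim_unb => //; exact: clo_limV.
case: b; split=> /=.
- move=> h C Ca uC; have [Ia Ic] := img1 C Ca uC.
  have [v [va lv Ev]] := h _ Ia Ic; have [xi [xia e l]] := limV_Vlevel oa Ca va lv.
  by exists xi; split=> //; rewrite -e.
- move=> h C Ca cC; have [C' [C'a uC' hC']] := lim2 C Ca cC.
  have [xi [xia l Exi]] := h C' C'a uC'.
  by exists (Vlevel xi); split=> //; [exact: Vlevel_mem|exact: hC'].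
- move=> [C [Ca cC h]]; have [C' [C'a uC' hC']] := lim2 C Ca cC.
  exists C'; split=> // xi xia l; apply: h; [exact: Vlevel_mem|exact: hC'].
- move=> [C [Ca uC h]]; have [Ia Ic] := img1 C Ca uC; exists (img C Vlevel); split=> // v va lv.
  by have [xi [xia -> l]] := limV_Vlevel oa Ca va lv; apply: h.
Qed.

Definition collD (a D : V) : Prop := forall x, x ∈ Vlevel a -> exists2 y, y ∈ Vlevel a &
  forall s, s ∈ Vlevel a -> s ∈ x -> (exists2 u, u ∈ Vlevel a & u ∈ D /\ s ∈ u) ->
    exists2 u, u ∈ Vlevel a & u ∈ D /\ (u ∈ y /\ s ∈ u).

(** The middle clause expresses [omega ∈ a]: a nonempty set each of whose members belongs to another
    member is not included in a finite level. *)
Definition inacD (a D : V) : Prop :=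
  (forall x, x ∈ Vlevel a -> exists2 y, y ∈ Vlevel a & x ∈ y) /\
  ((exists2 w, w ∈ Vlevel a & (exists2 z, z ∈ Vlevel a & z ∈ w) /\
    forall z, z ∈ Vlevel a -> z ∈ w -> exists2 t, t ∈ Vlevel a & t ∈ w /\ z ∈ t) /\
  collD a D).

Lemma inac_inacD a D : inac a -> D ⊆ Vlevel a -> inacD a D.
Proof.
move=> ai Da; have [al wa ha] := ai; have oa := lim_ord al; have [_ a0 as_] := al; split; [|split].
- move=> x xa; exists (one x); [exact: Vlevel_one|exact/mem_one].
- have wV : omega ∈ Vlevel a by apply: ord_sub_Vlevel.
  exists omega => //; split; first by exists ∅; [exact: Vlevel_0|apply/mem_omega; exists 0].
  move=> z _ /mem_omega[n ->]; exists (num n.+1); first exact: Vlevel_num.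
  by split; [apply/mem_omega; exists n.+1|apply/mem_succ; right].
move=> x /mem_Vlevel[xi xia xxi].
pose f s := if pselect (exists g, g ∈ a /\ exists u, [/\ u ∈ D, u ∈ Vlevel g & s ∈ u]) is left e
  then sval (cid e) else ∅.
have fa s : f s ∈ a by rewrite /f; case: pselect => [e|?] //; case: cid => g [].
have [//|g ga gP] := ha xi f xia.
exists (Vlevel g) => [|s sa sx [u ua [uD su]]]; first exact: Vlevel_mem.
have := gP s (xxi _ sx); rewrite /f; case: pselect => [e|[]] /=; last first.
  by have [g' g'a ug'] := Vlevel_ex al ua; exists g'; split=> //; exists u.
case: cid => g' /= [g'a [u' [u'D u'g su']]] g'g; exists u'; first exact: Da.
by split=> //; split=> //; apply: Vlevel_mono (ord_mem oa ga) g'g _ u'g.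
Qed.

Lemma inacD_inac a : ordinal a -> (forall D, D ⊆ Vlevel a -> inacD a D) -> inac a.
Proof.
move=> oa h; have [hl [[w wa [[z0 z0a z0w] hw]] _]] := h ∅ (@empty_sub _).
have ta := Vlevel_trans oa.
have al : lim a.
  by apply: Vlevel_lim => //; have /mem_Vlevel[b /mem_neq0] := wa.
have nw n : ~ w ⊆ Vlevel (num n).
  elim: n => [|n IH] wn; first by have /mem_Vlevel[b /mem_empty] := wn _ z0w.
  apply: IH => z zw; have [|t _ [tw zt]] := hw z _ zw; first exact: ta zw.
  have /mem_Vlevel[b bn tb] := wn _ tw; have on := ord_num n.
  have /mem_succ[bn'|e] : b ∈ succ (num n) := bn; last by rewrite -e; exact: tb.
  by apply: Vlevel_mono on bn' _ _; exact: tb.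
split=> //.
  have /mem_Vlevel[b ba wb] := wa; have ob := ord_mem oa ba.
  case: (ord_tri ord_omega oa) => // [wE|aw].
    by rewrite -wE in ba; have /mem_omega[n e] := ba; case: (nw n); rewrite -e.
  by have /mem_omega[n e] := ord_trans ord_omega ba aw; case: (nw n); rewrite -e.
move=> xi f xia fa; have oxi := ord_mem oa xia.
(* Raised to at least [xi], the values stay outside [Vlevel xi], so in the unordered pair
   [two x (f' x)] the argument can be told from the value. *)
pose f' x := un xi (f x).
have f'a x : x ∈ Vlevel xi -> f' x ∈ a by move=> /fa fxa; exact: lim_max.
pose D := img (Vlevel xi) (fun x => two x (f' x)).
have DP u : u ∈ D <-> exists2 x, x ∈ Vlevel xi & u = two x (f' x) by exact: mem_img.
have DV : D ⊆ Vlevel a.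
  move=> u /DP[x xxi ->]; apply: Vlevel_two => //; first exact: Vlevel_mono oa xia _ xxi.
  by apply: ord_sub_Vlevel => //; apply: f'a.
have [_ [_ /(_ (Vlevel xi) (Vlevel_mem xia))[y /mem_Vlevel[g ga yg] hy]]] := h D DV.
exists g => // x xxi; have xa := Vlevel_mono oa xia xxi.
have dx : two x (f' x) ∈ D by apply/DP; exists x.
have [|u _ [/DP[x' x'xi ->] [uy]]] := hy x xa xxi.
  by exists (two x (f' x)); [exact: DV|split=> //; apply/mem_two; left].
have of' := ord_mem oa (f'a _ x'xi).
case/mem_two => [xx'|xf]; last first.
  move: (xxi); rewrite xf => /(ord_Vlevel oxi of') f'xi.
  have : f' x' ∈ f' x' by apply/mem_un; left.
  by move/mem_irr.
rewrite -xx' in uy of' x'xi *.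
have og := ord_mem oa ga; have tg := Vlevel_trans og.
have : f' x ∈ Vlevel g by apply: (tg _ (yg _ uy)); apply/mem_two; right.
move/(ord_Vlevel og of') => f'g.
by case: (max_lt og oxi (ord_mem oa (fa _ xxi)) f'g).
Qed.

(** * The universal sentence and indescribability *)

(* In the matrix, [v_0] is the level at which the second-order variables are
   truncated and the second-order variable 0 serves for inaccessibility. *)
Definition XInac : xform :=
  XAnd (XAll 0 (XEx 1 (XMem 0 1)))
  (XAnd (XEx 0 (XAnd (XEx 1 (XMem 1 0)) (XAll 1 (XImp (XMem 1 0) (XEx 2 (XAnd (XMem 2 0) (XMem 1 2)))))))
  (XAll 0 (XEx 1 (XAll 2 (XImp (XMem 2 0) (XImp (XEx 3 (XAnd (XVar 0 3) (XMem 2 3)))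
     (XEx 3 (XAnd (XVar 0 3) (XAnd (XMem 3 1) (XMem 2 3)))))))))).

Lemma xsat_inac a A R r : xsat (Vlevel a) A R r XInac <-> inacD a (R 0).
Proof. by []. Qed.

Definition XCof (C : nat) : xform := XAll 0 (XEx 1 (XAnd (XVar C 1) (XMem 0 1))).

Definition XLim (C : nat) : xform :=
  XAnd (XEx 1 (XMem 1 0))
  (XAnd (XAll 1 (XImp (XMem 1 0) (XAll 2 (XImp (XMem 2 1) (XMem 2 0)))))
  (XAll 1 (XImp (XMem 1 0) (XEx 2 (XAnd (XVar C 2) (XAnd (XMem 2 0) (XMem 1 2))))))).

(** Follows the recursion of [enc]: [prev] names the code so far, [next] the following one, [v_0]
    the level, and [v_1] is a scratch variable; fresh variables therefore start at 2. *)
Fixpoint XEnc (prev next : nat) (Xs : seq nat) : xform :=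
  if Xs is X :: Xs' then XEx next (XAnd (XAll 1 (XIff (XMem 1 next)
    (XOr (XAnd (XMem 1 0) (XVar X 1)) (XEq 1 prev)))) (XEnc next next.+1 Xs'))
  else XPred prev.

Lemma update_same r i x : update r i x i = x.
Proof. by rewrite /update eqxx. Qed.

Lemma update_other r i j x : j != i -> update r i x j = r j.
Proof. by rewrite /update => /negbTE ->. Qed.

Lemma xsat_enc a A R r prev next Xs : lim a -> prev != 1 -> prev < next -> 2 <= next ->
  r 0 ∈ Vlevel a -> r prev ∈ Vlevel a ->
  xsat (Vlevel a) A R r (XEnc prev next Xs) <-> enc (r prev) (r 0) (map R Xs) ∈ A.
Proof.
move=> al; have ta := Vlevel_trans (lim_ord al).
elim: Xs r prev next => [|X Xs IH] r prev next p1 pn n2 v0 vp //.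
have n0 : 0 != next by rewrite neq_ltn (ltnW n2).
have n1 : 1 != next by rewrite neq_ltn n2.
have np : prev != next by rewrite neq_ltn pn.
have key x : x ∈ Vlevel a ->
    xsat (Vlevel a) A R (update r next x) (XAll 1 (XIff (XMem 1 next)
       (XOr (XAnd (XMem 1 0) (XVar X 1)) (XEq 1 prev)))) <-> x = un (R X ∩ r 0) (one (r prev)).
  move=> xa; split=> [h|-> t ta'] /=; last first.
    rewrite !update_same !(update_other _ _ p1) !(update_other _ _ np) !(@update_other _ 1 0) //.
    rewrite (update_other _ _ n0) (@update_other _ 1 next) 1?eq_sym // update_same.
    by rewrite mem_un mem_inter mem_one; tauto.
  have h' t : t ∈ Vlevel a -> t ∈ x <-> (t ∈ r 0 /\ t ∈ R X) \/ t = r prev.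
    move=> /h /=; rewrite !update_same !(update_other _ _ p1) !(update_other _ _ np) !(@update_other _ 1 0) //.
    by rewrite (update_other _ _ n0) (@update_other _ 1 next) 1?eq_sym // update_same.
  apply: V_ext => t; rewrite mem_un mem_inter mem_one; split=> [tx|h1].
    by have /h'[+ _] := ta _ xa _ tx => /(_ tx); tauto.
  have tV : t ∈ Vlevel a by case: h1 => [[_ t0]|-> //]; apply: ta v0 _ t0.
  by apply/(h' t tV); tauto.
have eV : un (R X ∩ r 0) (one (r prev)) ∈ Vlevel a.
  apply: Vlevel_un => //; last exact: Vlevel_one.
  by apply: Vlevel_sub v0 => // x /mem_inter[].
have IH' x : x ∈ Vlevel a -> xsat (Vlevel a) A R (update r next x) (XEnc next next.+1 Xs) <->
    enc x (r 0) (map R Xs) ∈ A.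
  move=> xa; rewrite IH ?update_same ?(update_other _ _ n0) //; first by rewrite eq_sym.
  exact: ltnW.
split=> [[x xa [/(key x xa) e /(IH' x xa)]]|h]; first by rewrite e.
by exists (un (R X ∩ r 0) (one (r prev))) => //; split; [exact/key|exact/IH'].
Qed.

Definition XMat (b : bool) (n : nat) : xform :=
  let E := XEnc 0 2 (iota 1 n) in
  XAnd XInac (if b then XImp (XCof n.+1) (XEx 0 (XAnd (XLim n.+1) E))
              else XAnd (XCof n.+1) (XAll 0 (XImp (XLim n.+1) E))).

Definition FBase (b : bool) (n : nat) : formula :=
  if b then FAll2 n.+1 (tr (XMat b n)) else FEx2 n.+1 (tr (XMat b n)).

Fixpoint FPre (m : nat) (b : bool) (j : nat) (p : formula) : formula :=
  if m is m'.+1 then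
    if b then FAll2 j (FPre m' false j.+1 p) else FEx2 j (FPre m' true j.+1 p)
  else p.

Definition FUniv (n : nat) : formula := FAll2 0 (FPre n true 1 (FBase (odd n) n)).

(** The outer quantifier over variable 0 joins the first universal block, and the club quantifier,
    by parity, the last block. With an empty prefix there would be no block to join, whence
    [n.+1]. *)
Lemma Pi1_FUniv n : Pi1 n.+1 (FUniv n.+1).
Proof.
suff h N m j : Pi1 m.+1 (FPre m.+1 true j (FBase (~~ odd m) N)) /\
    Sigma1 m.+1 (FPre m.+1 false j (FBase (odd m) N)).
  by apply: Pi1_all; case: (h n.+1 n 1).
elim: m j => [|m IH] j.
  split; [apply: Pi1_all; apply: Pi1_all; apply: Pi1_Sigma1; apply: Sigma1_first_order
         |apply: Sigma1_ex; apply: Sigma1_ex; apply: Sigma1_Pi1; apply: Pi1_first_order];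
    exact: first_order_tr.
have [h1 h2] := IH j.+1.
split; first by apply: Pi1_all; apply: Pi1_Sigma1; rewrite /= negbK.
by apply: Sigma1_ex; apply: Sigma1_Pi1.
Qed.

Lemma free_in_enc s t prev next Xs : (forall X, X \in Xs -> X \in s) -> 0 \in t -> prev \in t ->
  free_in s t (tr (XEnc prev next Xs)).
Proof.
elim: Xs t prev next => [|X Xs IH] t prev next hX t0 tp //=.
rewrite !inE !eqxx t0 tp hX ?mem_head //= !orbT /= !andbT.
apply: IH; [by move=> Y YX; apply: hX; rewrite inE YX orbT|by rewrite inE t0 orbT|by rewrite mem_head].
Qed.

Lemma free_in_base s b n : (forall i, i < n.+1 -> i \in s) -> free_in s [::] (FBase b n).
Proof.
move=> h; have s0 : 0 \in s by apply: h.
have hE t : 0 \in t -> free_in (n.+1 :: s) t (tr (XEnc 0 2 (iota 1 n))).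
  move=> t0; apply: free_in_enc => // X; rewrite mem_iota => /andP[_ Xn].
  by rewrite inE h ?orbT.
by case: b; rewrite /= ?inE ?eqxx ?s0 ?orbT /= ?andbT ?hE // ?inE ?eqxx ?s0 ?orbT.
Qed.

Lemma free_in_pre s m b j p : (forall i, i < j -> i \in s) ->
  (forall s', (forall i, i < j + m -> i \in s') -> free_in s' [::] p) -> free_in s [::] (FPre m b j p).
Proof.
elim: m s b j => [|m IH] s b j hs hp /=; first by apply: hp => i; rewrite addn0; exact: hs.
have hs' i : i < j.+1 -> i \in j :: s.
  by rewrite ltnS leq_eqVlt inE => /orP[->//|/hs ->]; rewrite orbT.
by case: b; apply: IH => // s' hs''; apply: hp => i; rewrite addnS -addSn; exact: hs''.
Qed.

Lemma sentence_FUniv n : sentence (FUniv n).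
Proof.
rewrite /sentence /=; apply: free_in_pre => [[] //|s hs]; exact: free_in_base.
Qed.

Fixpoint upds (R : nat -> V) (j : nat) (ys : seq V) : nat -> V :=
  if ys is y :: ys' then upds (update R j y) j.+1 ys' else R.

Lemma upds_lt R j ys i : i < j -> upds R j ys i = R i.
Proof.
elim: ys R j => [|y ys IH] R j ij //=; rewrite IH; last exact: ltnW.
by rewrite update_other // neq_ltn ij.
Qed.

Lemma upds_iota R j ys : map (upds R j ys) (iota j (size ys)) = ys.
Proof.
elim: ys R j => [|y ys IH] R j //=; rewrite upds_lt // update_same IH //.
Qed.

Lemma sat_pre a A R r m b j p : sat (Vlevel a) A R r (FPre m b j p) <->
  game m b (Vlevel a) (fun ys => sat (Vlevel a) A (upds R j ys) r p).
Proof.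
elim: m b j R => [|m IH] b j R //=; case: b; split=> /=.
- by move=> h Y Ya; apply/IH; apply: h.
- by move=> h Y Ya; apply/IH; apply: h.
- by move=> [Y Ya h]; exists Y => //; apply/IH.
- by move=> [Y Ya h]; exists Y => //; apply/IH.
Qed.

Lemma sat_FBase M A R r b n : sat M A R r (FBase b n) <->
  let xs C r' p := xsat M A (update R n.+1 C) r' p in
  if b then forall C, C ⊆ M -> xs C r XInac /\ (xs C r (XCof n.+1) ->
     exists2 v, v ∈ M & xs C (update r 0 v) (XLim n.+1) /\ xs C (update r 0 v) (XEnc 0 2 (iota 1 n)))
  else exists2 C, C ⊆ M & xs C r XInac /\ (xs C r (XCof n.+1) /\
     forall v, v ∈ M -> xs C (update r 0 v) (XLim n.+1) -> xs C (update r 0 v) (XEnc 0 2 (iota 1 n))).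
Proof.
have trE C : sat M A (update R n.+1 C) r (tr (XMat b n)) <-> xsat M A (update R n.+1 C) r (XMat b n) by exact: sat_tr.
case: b trE => trE; cbv zeta; split.
- by move=> h C CM; exact: (iffLR (trE C) (h C CM)).
- by move=> h C CM; exact: (iffRL (trE C) (h C CM)).
- by move=> [C CM h]; exists C => //; exact: (iffLR (trE C) h).
- by move=> [C CM h]; exists C => //; exact: (iffRL (trE C) h).
Qed.

Lemma sat_base a A R r b n ys : size ys = n -> lim a ->
  sat (Vlevel a) A (upds R 1 ys) r (FBase b n) <->
  inacD a (R 0) /\ matV b a (fun v => enc v v ys ∈ A).
Proof.
move=> sy al; have ta := Vlevel_trans (lim_ord al).
have R0 C : update (upds R 1 ys) n.+1 C 0 = R 0 by rewrite update_other // upds_lt.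
have encE C v : v ∈ Vlevel a -> xsat (Vlevel a) A (update (upds R 1 ys) n.+1 C) (update r 0 v) (XEnc 0 2 (iota 1 n)) <->
    enc v v ys ∈ A.
  move=> va; rewrite xsat_enc // !update_same //.
  suff -> : map (update (upds R 1 ys) n.+1 C) (iota 1 n) = ys by [].
  rewrite -[RHS](upds_iota R 1) sy; apply/eq_in_map => i; rewrite mem_iota add1n => /andP[_ h].
  by rewrite update_other // neq_ltn h.
have cofE C r' : C ⊆ Vlevel a ->
    xsat (Vlevel a) A (update (upds R 1 ys) n.+1 C) r' (XCof n.+1) <-> cofV a C.
  move=> Ca; rewrite /XCof /= /update !eqxx /=; split=> h x xa.
    by have [c ca [cC xc]] := h x xa; exists c.
  by have [c cC xc] := h x xa; exists c => //; exact: Ca.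
have limE C v : C ⊆ Vlevel a -> v ∈ Vlevel a ->
    xsat (Vlevel a) A (update (upds R 1 ys) n.+1 C) (update r 0 v) (XLim n.+1) <-> limV C v.
  move=> Ca va; rewrite /= /update !eqxx /=; split=> [[[x xa xv] [h1 h2]]|[[x xv] h1 h2]].
    split; first by exists x.
      by move=> y yv z zy; have ya := ta _ va _ yv; apply: (h1 y ya yv) => //; apply: ta zy.
    by move=> y yv; have [c ca [cC [cv yc]]] := h2 y (ta _ va _ yv) yv; exists c.
  split; first by exists x => //; apply: ta xv.
  split; first by move=> y _ yv z _ zy; apply: h1 zy.
  by move=> y _ yv; have [c [cC cv yc]] := h2 y yv; exists c => //; exact: Ca.
have incE C r' : xsat (Vlevel a) A (update (upds R 1 ys) n.+1 C) r' XInac <-> inacD a (R 0).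
  by rewrite xsat_inac R0.
rewrite sat_FBase /matV; case: b => /=; split.
- move=> h; split; first by have [/incE] := h ∅ (@empty_sub _).
  move=> C Ca cC; have [_ /(_ (iffRL (cofE C r Ca) cC))[v va [/(limE C v Ca va) l /(encE C v va) e]]] := h C Ca.
  by exists v.
- move=> [hi h] C Ca; split; first exact/incE.
  move=> /(cofE C r Ca) cC; have [v [va l e]] := h C Ca cC; exists v => //; split.
    exact/limE.
  exact/encE.
- move=> [C Ca [/incE hi [/(cofE C r Ca) cC h]]]; split=> //; exists C; split=> // v va l.
  by apply/(encE C v va); apply: (h v va); apply/limE.
- move=> [hi [C [Ca cC h]]]; exists C => //; split; first exact/incE.
  split; first exact/cofE.
  by move=> v va /(limE C v Ca va) l; apply/encE => //; apply: h.
Qed.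

Lemma sat_base_inac a A R r b n ys :
  sat (Vlevel a) A (upds R 1 ys) r (FBase b n) -> inacD a (R 0).
Proof.
have incE C : xsat (Vlevel a) A (update (upds R 1 ys) n.+1 C) r XInac -> inacD a (R 0).
  by move/xsat_inac; rewrite update_other // upds_lt.
move/sat_FBase; case: b => [/(_ ∅ (@empty_sub _))[/incE]|[C _ [/incE]]] //.
Qed.

Lemma models_FUniv n a Z : ordinal a -> models (Vlevel a) Z (FUniv n) <-> inac a /\ Sem n a Z.
Proof.
move=> oa; rewrite /models /=.
have SemE : inac a -> Sem n a Z <-> game n true (Vlevel a) (fun ys => matV (odd n) a (fun v => enc v v ys ∈ Z)).
  by move=> ai; apply: game_ext => ys _ _; apply: iff_sym; apply: matV_smat.
split=> [h|[ai /(SemE ai) g] D Da].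
  have ai : inac a.
    apply: inacD_inac => // D Da; have /sat_pre g := h D Da.
    (* The inaccessibility clause depends on [D] alone, not on the moves, and can be pulled out of
       the game. *)
    have : game n true (Vlevel a) (fun ys => inacD a D /\ True).
      by apply: game_mono g => ys _ _ /sat_base_inac.
    by case/game_and.
  split=> //; apply/(SemE ai); have /sat_pre := h ∅ (@empty_sub _).
  by apply: game_mono => ys sy _ /(sat_base _ _ _ _ sy (inac_lim ai))[].
apply/sat_pre; apply: game_mono g => ys sy _ m; apply/sat_base => //; first exact: inac_lim.
by split=> //; apply: inac_inacD.
Qed.

Lemma indescribable_sempos n k S : inac k -> indescribable n.+1 k S <-> sempos n.+1 k S.
Proof.
move=> ki; have [kl _ _] := ki; have ok := lim_ord kl.
split=> -[Sk h]; split=> //.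
  move=> Z Zk sZ; have [|||] := h Z (FUniv n.+1) Zk.
  - exact: Pi1_FUniv.
  - exact: sentence_FUniv.
  - by apply/models_FUniv.
  move=> a aS /(models_FUniv _ _ (ord_mem ok (Sk _ aS)))[ai sa]; exists a; split=> //.
  exact/(Sem_trace _ _ (inac_lim ai)).
move=> A p Ak hp _ m; have [Z Zk hZ] := Pi1_Sem A kl hp.
have [|a [aS ai sa]] := h Z Zk.
  apply/hZ => //; first by apply/mem_succ; right.
  suff -> : A ∩ Vlevel k = A by [].
  by apply: V_ext => x; rewrite mem_inter; split=> [[]|xA] //; split=> //; apply: Ak.
by exists a => //; apply/hZ => //; apply/mem_succ; left; apply: Sk.
Qed.

Lemma smat_ex b a Gd : inac a -> smat b a Gd -> exists2 xi, xi ∈ a & Gd xi.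
Proof.
move=> ai sm; apply: contrapT => n; suff c : clo a (fun xi => Gd xi <-> False).
  exact: (iffLR (smat_clo b ai c) sm).
by exists id => // xi xia _ _; split=> // g; apply: n; exists xi.
Qed.

Lemma smat_all b a Gd : inac a -> clo a Gd -> smat b a Gd.
Proof.
move=> ai cG; suff c : clo a (fun xi => Gd xi <-> True) by exact: (iffRL (smat_clo b ai c) Logic.I).
by apply: clo_imp cG.
Qed.

Lemma lenc_traces xi ys : lenc xi (traces xi ys) = lenc xi ys.
Proof.
rewrite /lenc; elim: ys {1 3}(Vlevel xi) => [|y ys IH] e //=; rewrite IH; congr (enc (un _ _) _ _).
by apply: V_ext => x; rewrite !mem_inter; tauto.
Qed.

Section Sempos.
Variables (k : V) (n : nat).
Hypothesis ki : inac k.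
Let kl := inac_lim ki.
Let ok := lim_ord kl.
Let P := sempos n.+1 k.

Lemma sempos_stat S : P S -> stat k S.
Proof. by move=> /(indescribable_sempos n _ ki)/(indescribable_stat kl). Qed.

(* The first move [Y] of the opponent codes an index [c] and a first move
   against [Z c]. *)
Lemma sempos_nfam : nfam k P.
Proof.
split; first by move=> X [].
- by move=> X Y [Xk h] XY Yk; split=> // Z Zk /(h Z Zk)[a [/XY aY ai sa]]; exists a.
- by move=> X /sempos_stat[].
move=> X g c0 [Xk hX] c0k ga; apply: contrapT => /forallNP nP.
pose Xc c := sep X (fun a => c0 ∈ a /\ g a = c).
have /choice[Z ZP] : forall c, exists Z, [/\ Z ⊆ Vlevel k, Sem n.+1 k Z &
    forall a, a ∈ Xc c -> inac a -> ~ Sem n.+1 a Z].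
  move=> c; have /not_andP[[]|/existsNP[Z /not_implyP[Zk /not_implyP[sZ h]]]] := nP c.
    by move=> x /mem_sep[/Xk].
  by exists Z; split=> // a aX ai sa; apply: h; exists a.
(* The index [c] is announced as a singleton in part 0 of the first move. If that part is no
   singleton, its trace on large levels is none either, and the condition is vacuous there. *)
pose Good xi ys := c0 ∈ xi /\ forall c, proj 0 (head ∅ ys) = one c ->
  lenc xi (proj 1 (head ∅ ys) :: behead ys) ∈ Z c.
pose Zs := codes k n.+1 Good.
have ZsE xi Y ys : xi ∈ k -> lim xi -> size ys = n -> lenc xi (Y :: ys) ∈ Zs <->
    c0 ∈ xi /\ forall c, proj 0 Y ∩ Vlevel xi = one c -> lenc xi (proj 1 Y :: ys) ∈ Z c.
  move=> xik xl sy; rewrite (mem_codes Good kl xik) /= ?sy // /Good /= !proj_trace //.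
  by rewrite -(lenc_traces xi (proj 1 Y :: ys)).
have sZs : Sem n.+1 k Zs.
  move=> Y Yk; case: (EM (exists c, proj 0 Y = one c)) => [[c Yc]|nc].
    have [_ sZ _] := ZP c; apply: game_mono (sZ _ (proj_sub (i := 1) kl Yk)) => ys sy _.
    apply: smat_mono => //; apply: clo_imp (clo_and kl (clo_gt c0k) (clo_lim kl)) => xi xik _ [c0xi xl] h.
    apply/ZsE => //; split=> // c' e; suff -> : c' = c by [].
    have : c' ∈ proj 0 Y ∩ Vlevel xi by rewrite e; apply/mem_one.
    by rewrite Yc => /mem_inter[/mem_one].
  apply: game_all => ys sy _; apply: smat_all => //.
  have [d dk hd] : exists2 d, d ∈ k & forall xi c, xi ∈ k -> d ∈ xi -> proj 0 Y ∩ Vlevel xi <> one c.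
    have ne c : proj 0 Y = ∅ -> forall xi, proj 0 Y ∩ Vlevel xi <> one c.
      move=> -> xi e; have : c ∈ ∅ ∩ Vlevel xi by rewrite e; apply/mem_one.
      by case/mem_inter => /mem_empty.
    case: (EM (proj 0 Y = ∅)) => [Y0|/neq0P[c1 c1Y]].
      by exists ∅; [exact: lim_num 0 kl|move=> xi c _ _; exact: ne].
    have [c2 c2Y c12] : exists2 c2, c2 ∈ proj 0 Y & c2 <> c1.
      apply: contrapT => h; apply: nc; exists c1; apply: V_ext => x; rewrite mem_one.
      by split=> [xY|->] //; apply: contrapT => xc; apply: h; exists x.
    have pk := proj_sub (i := 0) kl Yk.
    have [d [dk c1d c2d]] := Vlevel_bound kl (pk _ c1Y) (pk _ c2Y).
    exists d => // xi c xik dxi e; have oxi := ord_mem ok xik.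
    have /mem_one h1 : c1 ∈ one c by rewrite -e; apply/mem_inter; split=> //; apply: Vlevel_mono oxi dxi _ c1d.
    have /mem_one h2 : c2 ∈ one c by rewrite -e; apply/mem_inter; split=> //; apply: Vlevel_mono oxi dxi _ c2d.
    by apply: c12; rewrite h1 h2.
  apply: clo_imp (clo_and kl (clo_and kl (clo_gt c0k) (clo_gt dk)) (clo_lim kl)) => xi xik _ [[c0xi dxi] xl].
  apply/ZsE => //; split=> // c e; by case: (hd xi c xik dxi).
have [a [aX ai sa]] := hX Zs (@sep_sub _ _) sZs.
have [al _ _] := ai; have ak := Xk _ aX; have oa := ord_mem ok ak.
have xk xi : xi ∈ a -> xi ∈ k by move=> xia; exact: ord_trans ok xia ak.
(* This is what the clause [c0 ∈ xi] in [Good] is for: any good level below [a] puts [c0] below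
   [a]. *)
have c0a : c0 ∈ a.
  have : game n false (Vlevel a) (fun ys => c0 ∈ a /\ True).
    apply: game_mono (sa _ (@empty_sub _)) => ys sy _ sm; split=> //.
    have [xi xia /mem_sep[_ [xi' [ys' [xi'k sy' E [c0xi _]]]]]] := smat_ex ai sm.
    have sz : size (∅ :: ys) = size ys' by rewrite /= sy sy'.
    have [e _] := lenc_inj (ord_mem oa xia) (ord_mem ok xi'k) sz E.
    by rewrite -e in c0xi; exact: ord_trans oa c0xi xia.
  by case/game_and.
have gaa := ga a aX c0a; have [_ _ nS] := ZP (g a).
apply: (nS a) => //; first exact/mem_sep.
have gV : one (g a) ⊆ Vlevel a by move=> x /mem_one ->; exact: ord_sub_Vlevel.
move=> Y Ya; apply: game_mono (sa _ (join_sub al gV Ya)) => ys sy _.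
apply: smat_mono => //; apply: clo_imp (clo_and al (clo_gt gaa) (clo_lim al)) => xi xia _ [gxi xl].
case/(ZsE _ _ _ (xk _ xia) xl sy) => _ /(_ (g a)); rewrite proj0_join proj1_join; apply.
apply: V_ext => x; rewrite mem_inter mem_one; split=> [[]|->] //; split=> //.
by apply: ord_sub_Vlevel => //; exact: lim_ord xl.
Qed.

Definition levelK (xi x : V) : Prop := x ⊆ Vlevel xi.

(* "[Y] is not a branch of the tree of initial segments of the [W a]" is a
   universal statement whose reflection to [a] is refuted by [Y = W a]. *)
Lemma sempos_branches X W : P X -> exists b, branch k levelK X W b.
Proof.
move=> PX; apply: contrapT => /forallNP nb.
have [Xk h1] : sempos 1 k X.
  by apply/(indescribable_sempos 0 _ ki); apply: (@indescribable_le 1 n.+1) => //; apply/(indescribable_sempos n _ ki).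
pose Good xi ys := exists2 e, e ∈ xi & forall a, a ∈ X -> e ∈ a -> ~ agree levelK e (W a) (fun x => x ∈ head ∅ ys).
pose Z := codes k 1 Good.
have sZ : Sem 1 k Z.
  move=> Y Yk; apply: smat_all => //.
  have /existsNP[e /not_implyP[ek he]] := nb (fun x => x ∈ Y).
  apply: clo_imp (clo_and kl (clo_gt ek) (clo_lim kl)) => xi xik _ [exi xl].
  apply/(mem_codes Good kl xik) => //; exists e => // a aX ea ag; apply: he; exists a; split=> //.
  move=> d x de dx; rewrite (ag d x de dx) /= mem_inter; split=> [[]|xY] //; split=> //.
  have oxi := lim_ord xl; apply/mem_Vlevel; exists d => //.
  by case/mem_succ: de => [de|-> //]; exact: ord_trans oxi de exi.
have [a [aX ai sa]] := h1 Z (@sep_sub _ _) sZ; have ak := Xk _ aX; have oa := ord_mem ok ak.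
have := sa (sep (Vlevel a) (W a)) (@sep_sub _ _) => /= sm.
have [xi xia] := smat_ex (b := true) ai sm.
case/(mem_codes Good kl (ord_trans ok xia ak) (erefl : size [:: _] = 1)) => e exi /(_ a aX (ord_trans oa exi xia)); apply.
move=> d x de dx; rewrite /= mem_inter mem_sep.
have oxi := ord_mem oa xia.
have dxi : d ∈ xi by case/mem_succ: de => [de|-> //]; exact: ord_trans oxi de exi.
have xV : x ∈ Vlevel xi by apply/mem_Vlevel; exists d.
by split=> [w|[[]]] //; split=> //; split=> //; apply: Vlevel_mono oa xia _ xV.
Qed.

Lemma sempos_not_thin S : P S -> thin k P S -> False.
Proof.
move=> [Sk hS] tS; have nf := sempos_nfam.
pose T := sep S (fun a => inac a /\ ~ sempos n.+1 a (S ∩ a)).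
have TS : T ⊆ S by exact: sep_sub.
have PT : P T.
  split=> [x /TS/Sk //|Z Zk sZ]; have [a0 [a0S ai0 sa0]] := hS Z Zk sZ.
  (* At the least inaccessible member of [S] where [Z] holds, the trace of [Z] shows that [S ∩ a] is
     not positive. *)
  have [a [oa [aS [ai sa]] ma]] := ord_least (P := fun a => a ∈ S /\ (inac a /\ Sem n.+1 a Z))
    (ord_mem ok (Sk _ a0S)) (conj a0S (conj ai0 sa0)).
  exists a; split=> //; apply/mem_sep; split=> //; split=> // -[_ /(_ (Z ∩ Vlevel a))[]].
  - by move=> x /mem_inter[].
  - exact/(Sem_trace _ _ (inac_lim ai)).
  - move=> b [/mem_inter[bS ba] bi sb]; apply: (ma b ba); split=> //; split=> //.
    suff e : Sem n.+1 b (Z ∩ Vlevel a) <-> Sem n.+1 b Z by apply/e.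
    apply: Sem_ext (inac_lim bi) _ => x xb; rewrite mem_inter; split=> [[]|xZ] //; split=> //.
    exact: Vlevel_mono oa ba _ xb.
have /choice[Z ZP] : forall a, exists Z, a ∈ T -> [/\ inac a, Sem n.+1 a Z &
    forall b, b ∈ S -> b ∈ a -> inac b -> ~ Sem n.+1 b Z].
  move=> a; case: (EM (a ∈ T)) => [/mem_sep[aS [ai /not_andP[[]|]]]|]; last by exists ∅.
    by move=> x /mem_inter[].
  move=> /existsNP[Z /not_implyP[Za /not_implyP[sZ h]]]; exists Z => _; split=> //.
  by move=> b bS ba bi sb; apply: h; exists b; split=> //; apply/mem_inter.
have [|H [b [PH HT hb]]] := homog (K := levelK) kl nf (W := fun a x => x ∈ Z a) PT (thin_sub tS TS).
  by move=> X PX _; exact: sempos_branches.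
have [a1 a1H _] := nf_unb nf PH (lim_num 0 kl).
(* Two members of [H] are enough: [Z a1] and [Z a2] agree on [Vlevel a1], so [Z a2] holds at
   [a1 ∈ S], which its choice excludes. *)
have [a2 a2H a12] := nf_unb nf PH (nf_sub nf PH a1H).
have [ai1 s1 _] := ZP a1 (HT _ a1H); have [_ _ n2] := ZP a2 (HT _ a2H).
have o2 : ordinal a2 by apply: ord_mem ok (nf_sub nf PH a2H).
apply: (n2 a1) => //; first exact/TS/HT.
suff e : Sem n.+1 a1 (Z a1) <-> Sem n.+1 a1 (Z a2) by apply/e.
apply: Sem_ext (inac_lim ai1) _ => x /mem_Vlevel[d da1 xd].
rewrite (hb a1 d x a1H da1 xd) (hb a2 d x a2H (ord_trans o2 da1 a12) xd).
by [].
Qed.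

End Sempos.

Theorem nowhere_saturated_indescribable k n : infinite_cardinal k -> indescribable n k k ->
  nowhere_saturated k (ideal_of k (indescribable n)).
Proof.
case: n => [|n]; first exact: nowhere_saturated_indescribable0.
move=> /inf_card_lim kl /(indescribable_inac kl) ki.
apply: (nowhere_saturated_thin kl (sempos_nfam n ki)) => S; first exact: indescribable_sempos.
exact: sempos_not_thin.
Qed.

Theorem corollary4p4 (k : V) (k_inf : infinite_cardinal k) :
  (forall n : nat, indescribable n k k ->
     nowhere_saturated k (ideal_of k (indescribable n))) /\
  ((almost_ineffable k k ->
     nowhere_saturated k (ideal_of k almost_ineffable)) /\
   (ineffable k k ->
     nowhere_saturated k (ideal_of k ineffable))) /\
  (ramsey k k -> nowhere_saturated k (ideal_of k ramsey)) /\
  (weakly_compact k -> subtle k k ->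
     nowhere_saturated k (ideal_of k subtle)).
Proof.
split; first by move=> n; exact: nowhere_saturated_indescribable.
split; first split=> _.
- exact: nowhere_saturated_almost_ineffable.
- exact: nowhere_saturated_ineffable.
split=> [_|wc _]; first exact: nowhere_saturated_ramsey.
exact: nowhere_saturated_subtle.
Qed.
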